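(* Assume that there is $\Lambda>0$ such that $|\mu(|\mathbf{T}|)\mathbf{T}-\mu(|\mathbf{S}|)\mathbf{S}|\le\Lambda|\mathbf{T}-\mathbf{S}|$ for all symmetric trace-free $\mathbf{T},\mathbf{S}\in\mathbb{R}^{d\times d}$, and that the input data satisfy $$\frac{\gamma}{\alpha}\Lambda+\alpha\hat D\,\widetilde{C_{\mathbf{u}}}\le\theta<1$$ for some $0<\theta<1$. Then there exists a constant $C>0$ independent of $h$ such that the solution $(\mathbf{T}_h,\mathbf{u}_h,p_h)\in M_h\times V_h\times Q_h$ of $(\mathrm{P}_h)$ and the solution $(\mathbf{T},\mathbf{u},p)\in M\times V\times Q$ of (P) satisfy $$\|\mathbf{u}-\mathbf{u}_h\|_V+\|\mathbf{T}-\mathbf{T}_h\|_M+\|p-p_h\|_Q\le C\Big[\inf_{\mathbf{v}_h\in V_h}\|\mathbf{u}-\mathbf{v}_h\|_V+\inf_{\mathbf{S}_h\in M_h}\|\mathbf{T}-\mathbf{S}_h\|_M+\inf_{q_h\in Q_h}\|p-q_h\|_Q\Big].$$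
   Context: Let $d\in\{2,3\}$, let $\Omega\subset\mathbb{R}^d$ be a bounded, open, simply connected Lipschitz domain, $\mathbf{f}\in L^2(\Omega)^d$, and let $\alpha,\gamma>0$ be constants. Let $\mu\in C^1((0,\infty))\cap C^0([0,\infty))$ be real-valued with $\frac{d}{da}(\mu(a)a)>0$ for all $a>0$, and $\mu(a)>0$, $\mu(a)a\le C_1$ for all $a\ge0$, where $C_1>0$ is a constant; $\mu_{\max}=\sup_{a\ge0}\mu(a)<\infty$. Notation: $\mathbf{D}(\mathbf{v})=\frac12(\nabla\mathbf{v}+(\nabla\mathbf{v})^t)$; $|\cdot|$ is the Frobenius norm on matrices; $V=H_0^1(\Omega)^d$ with $\|\mathbf{v}\|_V=\|\mathbf{D}(\mathbf{v})\|_{L^2(\Omega)}$; $Q=L^2_0(\Omega)$ (mean-zero $L^2$ functions) with $\|\cdot\|_Q=\|\cdot\|_{L^2(\Omega)}$; $M=L^2(\Omega)^{d\times d}_{\mathrm{sym}}$ (symmetric tensor fields, no trace condition imposed) with $\|\cdot\|_M=\|\cdot\|_{L^2(\Omega)}$; $b_2(\mathbf{v},q)=-\int_\Omega q\operatorname{div}\mathbf{v}$; $\|\mathbf{f}\|_{H^{-1}(\Omega)}=\sup_{0\ne\mathbf{v}\in V}\int_\Omega\mathbf{f}\cdot\mathbf{v}/\|\mathbf{v}\|_V$. Problem (P): find $(\mathbf{T},\mathbf{u},p)\in M\times V\times Q$ with, for all $(\mathbf{S},\mathbf{v},q)\in M\times V\times Q$, $$\int_\Omega[(\mathbf{u}\cdot\nabla)\mathbf{u}]\cdot\mathbf{v}+\int_\Omega\mathbf{T}:\mathbf{D}(\mathbf{v})+b_2(\mathbf{v},p)=\int_\Omega\mathbf{f}\cdot\mathbf{v},$$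 $$\alpha\int_\Omega\mathbf{T}:\mathbf{S}+\gamma\int_\Omega\mu(|\mathbf{T}|)\mathbf{T}:\mathbf{S}=\int_\Omega\mathbf{D}(\mathbf{u}):\mathbf{S},\qquad b_2(\mathbf{u},q)=0.$$ Discrete spaces: for each discretisation parameter $h>0$ (tending to $0$), $V_h\subset V$, $Q_h\subset Q$, $M_h\subset M$ are finite-dimensional spaces such that: (i) for all $\mathbf{S}\in M$, $\mathbf{v}\in V$, $q\in Q$, the quantities $\inf_{\mathbf{S}_h\in M_h}\|\mathbf{S}_h-\mathbf{S}\|_M$, $\inf_{\mathbf{v}_h\in V_h}\|\mathbf{v}_h-\mathbf{v}\|_V$, $\inf_{q_h\in Q_h}\|q_h-q\|_Q$ tend to $0$ as $h\to0$; (ii) there is $\beta^*>0$ independent of $h$ with $\inf_{q_h\in Q_h}\sup_{\mathbf{v}_h\in V_h}\frac{b_2(\mathbf{v}_h,q_h)}{\|\mathbf{v}_h\|_V\|q_h\|_Q}\ge\beta^*$ (over nonzero functions); (iii) $\mathbf{D}(\mathbf{v}_h)\in M_h$ for all $\mathbf{v}_h\in V_{h,0}:=\{\mathbf{v}_h\in V_h: b_2(\mathbf{v}_h,q_h)=0\ \forall q_h\in Q_h\}$. Let $d(\mathbf{u};\mathbf{v},\mathbf{w})=\frac12\int_\Omega[(\mathbf{u}\cdot\nabla)\mathbf{v}]\cdot\mathbf{w}-\frac12\int_\Omega[(\mathbf{u}\cdot\nabla)\mathbf{w}]\cdot\mathbf{v}$, and let $\hat D$ be a constant such that $d(\mathbf{u};\mathbf{v},\mathbf{w})\le\hat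 D\|\mathbf{u}\|_V\|\mathbf{v}\|_V\|\mathbf{w}\|_V$ for all $\mathbf{u},\mathbf{v},\mathbf{w}\in V$ (it exists by Sobolev's and Korn's inequalities). Problem $(\mathrm{P}_h)$: find $(\mathbf{T}_h,\mathbf{u}_h,p_h)\in M_h\times V_h\times Q_h$ with, for all $(\mathbf{S}_h,\mathbf{v}_h,q_h)\in M_h\times V_h\times Q_h$, $$d(\mathbf{u}_h;\mathbf{u}_h,\mathbf{v}_h)+\int_\Omega\mathbf{T}_h:\mathbf{D}(\mathbf{v}_h)+b_2(\mathbf{v}_h,p_h)=\int_\Omega\mathbf{f}\cdot\mathbf{v}_h,$$ $$\alpha\int_\Omega\mathbf{T}_h:\mathbf{S}_h+\gamma\int_\Omega\mu(|\mathbf{T}_h|)\mathbf{T}_h:\mathbf{S}_h=\int_\Omega\mathbf{D}(\mathbf{u}_h):\mathbf{S}_h,\qquad b_2(\mathbf{u}_h,q_h)=0.$$ Constant: $$\widetilde{C_{\mathbf{u}}}=\min\Big\{\tfrac1\alpha(\alpha+\gamma\mu_{\max})^2\|\mathbf{f}\|_{H^{-1}(\Omega)},\ \alpha\|\mathbf{f}\|_{H^{-1}(\Omega)}+\gamma C_1|\Omega|^{1/2},\ \tfrac1\alpha(\alpha+\gamma\Lambda)^2\|\mathbf{f}\|_{H^{-1}(\Omega)}\Big\}.$$ *)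

(* Defs.v *)
From HB Require Import structures.
From mathcomp Require Import all_boot all_order all_algebra.
From mathcomp Require Import all_classical all_reals all_analysis.

Set Implicit Arguments.
Unset Strict Implicit.
Unset Printing Implicit Defensive.

Import Order.TTheory GRing.Theory Num.Theory.
Import numFieldNormedType.Exports.

Local Open Scope classical_set_scope.
Local Open Scope ring_scope.

(* Borel sets of R^n: the sigma-algebra generated by the coordinates; it is the
   one with respect to which lebesgue_rV, the n-fold product of the Lebesgue
   measure of R, is defined (see lebesgue_rV_box) *)
Definition rV_display : measure_display.
Proof. exact: default_measure_display. Qed.

Section measurable_rV.
Context (R : realType) (n : nat).

Definition rV_coord (i : 'I_n) (x : 'rV[R]_n) : R := x ord0 i.

Let rV_set0 : g_sigma_preimage rV_coord set0.
Proof. exact: sigma_algebra0. Qed.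

Let rV_setC A : g_sigma_preimage rV_coord A -> g_sigma_preimage rV_coord (~` A).
Proof. exact: sigma_algebraC. Qed.

Let rV_bigcup (F : (set 'rV[R]_n)^nat) :
  (forall i, g_sigma_preimage rV_coord (F i)) ->
  g_sigma_preimage rV_coord (\bigcup_i (F i)).
Proof. exact: sigma_algebra_bigcup. Qed.

HB.instance Definition _ := @isMeasurable.Build rV_display
  'rV[R]_n (g_sigma_preimage rV_coord) rV_set0 rV_setC rV_bigcup.

Lemma measurable_rV_coord (i : 'I_n) : measurable_fun setT (rV_coord i).
Proof.
move=> _ Y mY; rewrite setTI; apply: sub_sigma_algebra => /=.
rewrite -bigcup_seq/=; exists i => /=; first by rewrite mem_index_enum.
by exists Y => //; rewrite setTI.
Qed.

Lemma measurable_fun_rVP d (T : measurableType d) (f : T -> 'rV[R]_n) :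
  (forall i, measurable_fun setT (fun t => f t ord0 i)) -> measurable_fun setT f.
Proof.
move=> mf _ A mA; rewrite setTI.
have : (preimage_set_system [set: T] f (g_sigma_preimage rV_coord)) (f @^-1` A).
  by exists A => //; rewrite setTI.
rewrite -g_sigma_preimage_comp; apply: smallest_sub.
  exact: sigma_algebra_measurable.
rewrite -bigcup_seq/=; apply: bigcup_sub => i _ B [C mC <-].
exact: mf.
Qed.

End measurable_rV.

Section lebesgue_rV.
Context (R : realType).

Definition cons_rV n (p : measurableTypeR R * 'rV[R]_n) : 'rV[R]_n.+1 :=
  \row_i (if unlift ord0 i is Some j then p.2 ord0 j else p.1).

Lemma measurable_cons_rV n : measurable_fun setT (@cons_rV n).
Proof.
apply: measurable_fun_rVP => i.
under eq_fun do rewrite mxE.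
case: unliftP => [j _|_]; last exact: measurable_fst.
exact: (measurableT_comp (measurable_rV_coord j) measurable_snd).
Qed.

Section step.
Context n (m : {sigma_finite_measure set 'rV[R]_n -> \bar R}).

Definition lebesgue_step : set 'rV[R]_n.+1 -> \bar R :=
  pushforward (@lebesgue_measure R \x m)%E (@cons_rV n).

HB.instance Definition _ := Measure.copy lebesgue_step
  (measure_function_pushforward__canonical__measure_function_Measure
    (@lebesgue_measure R \x m)%E (@measurable_cons_rV n)).

Let lebesgue_step_sigma_finite : sigma_finite setT lebesgue_step.
Proof.
pose g (x : 'rV[R]_n.+1) : R * 'rV[R]_n :=
  (x ord0 ord0, \row_j x ord0 (lift ord0 j)).
have mg : measurable_fun setT g.
  apply: measurable_fun_pair; first exact: measurable_rV_coord.
  apply: measurable_fun_rVP => i; under eq_fun do rewrite mxE.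
  exact: measurable_rV_coord.
have gK p : g (cons_rV p) = p.
  case: p => a y; rewrite /g mxE unlift_none; congr (_, _).
  by apply/rowP => j; rewrite !mxE liftK.
have /sigma_finiteP[F [TF ndF Foo]] := sigma_finiteT (@lebesgue_measure R).
have /sigma_finiteP[G [TG ndG Goo]] := sigma_finiteT m.
exists (fun k => g @^-1` (F k `*` G k)).
  rewrite -preimage_bigcup (_ : \bigcup_k _ = setT) ?preimage_setT//.
  apply/seteqP; split=> // -[a y] _.
  have [i _ Fi] : (\bigcup_k F k) a by rewrite -TF.
  have [j _ Gj] : (\bigcup_k G k) y by rewrite -TG.
  exists (maxn i j) => //; split => /=.
    by move: a Fi; exact/subsetPset/ndF/leq_maxl.
  by move: y Gj; exact/subsetPset/ndG/leq_maxr.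
move=> k; have [mF Fk] := Foo k; have [mG Gk] := Goo k; split.
  by rewrite -[X in measurable X]setTI; apply: mg => //; exact: measurableX.
rewrite /lebesgue_step /pushforward.
rewrite (_ : _ @^-1` _ = F k `*` G k).
  by rewrite product_measure1E// lte_mul_pinfty// ge0_fin_numE.
by apply/seteqP; split=> p; rewrite /preimage /mkset gK.
Qed.

HB.instance Definition _ :=
  Measure_isSigmaFinite.Build _ _ _ lebesgue_step lebesgue_step_sigma_finite.

End step.

Fixpoint lebesgue_rV n : {sigma_finite_measure set 'rV[R]_n -> \bar R} :=
  match n with
  | 0 => \d_(0 : 'rV[R]_0)
  | n'.+1 => lebesgue_step (lebesgue_rV n')
  end.

Lemma lebesgue_rV_box n (A : 'I_n -> set R) : (forall i, measurable (A i)) ->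
  lebesgue_rV n [set x | forall i, A i (x ord0 i)] =
  (\prod_(i < n) lebesgue_measure (A i))%E.
Proof.
elim: n A => [|n ih] A mA.
  rewrite big_ord0 /= diracE mem_set//; by case.
pose B := [set y : 'rV[R]_n | forall j, A (lift ord0 j) (y ord0 j)].
have mB : measurable B.
  rewrite (_ : B = \bigcap_(j in [set: 'I_n])
      (@rV_coord R n j @^-1` A (lift ord0 j))); last first.
    by apply/seteqP; split=> [y h j _|y h j]; [exact: h|exact: h j I].
  apply: fin_bigcap_measurable => [|j _]; first exact: finite_finset.
  by rewrite -[X in measurable X]setTI; exact: measurable_rV_coord.
rewrite big_ord_recl /= /lebesgue_step /pushforward.
rewrite (_ : _ @^-1` _ = A ord0 `*` B); last first.
  apply/seteqP; split=> [[a y]/= h|[a y]/= [h0 h] i].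
    split=> [|j]; first by have := h ord0; rewrite mxE unlift_none.
    by have := h (lift ord0 j); rewrite mxE liftK.
  by rewrite mxE; case: unliftP => [j ->|->].
have /= := @product_measure1E _ _ _ _ R (@lebesgue_measure R) (lebesgue_rV n)
  (A ord0) B (mA ord0) mB.
move=> ->; congr (_ * _)%E.
exact: (ih (fun j => A (lift ord0 j)) (fun j => mA _)).
Qed.

End lebesgue_rV.

Section domains.
Context (R : realType) (d : nat).
Implicit Types Omega : set 'rV[R]_d.

Definition path_connected Omega := forall x y, Omega x -> Omega y ->
  exists c : R -> 'rV[R]_d,
    [/\ {within `[0, 1], continuous c},
        (forall s, s \in `[0, 1] -> Omega (c s)), c 0 = x & c 1 = y].

Definition null_homotopic Omega (c : R -> 'rV[R]_d) :=
  exists H : R * R -> 'rV[R]_d,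
    [/\ {within `[0, 1] `*` `[0, 1], continuous H},
        (forall s t, s \in `[0, 1] -> t \in `[0, 1] -> Omega (H (s, t))),
        (forall s, s \in `[0, 1] -> H (s, 0) = c s /\ H (s, 1) = c 0) &
        (forall t, t \in `[0, 1] -> H (0, t) = c 0 /\ H (1, t) = c 0)].

Definition simply_connected Omega :=
  path_connected Omega /\
  forall c : R -> 'rV[R]_d, {within `[0, 1], continuous c} ->
    (forall s, s \in `[0, 1] -> Omega (c s)) -> c 0 = c 1 ->
    null_homotopic Omega c.

(* near each boundary point, after an orthogonal change of coordinates Q, the
   open set Omega is the strict epigraph, in the direction of the i-th axis,
   of a Lipschitz function of the d - 1 other coordinates *)
Definition lipschitz_boundary Omega :=
  forall x0, (closure Omega `\` Omega) x0 ->
  exists r : R, 0 < r /\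
  exists (Q : 'M[R]_d) (i : 'I_d) (phi : 'rV[R]_d.-1 -> R) (L : R),
    [/\ Q *m Q^T = 1%:M,
        (forall a b, `|phi a - phi b| <= L * `|a - b|) &
        forall x, ball x0 r x ->
          (Omega x <-> phi (col' i (x *m Q)) < (x *m Q) ord0 i)].

Definition lipschitz_domain Omega :=
  [/\ Omega !=set0, open Omega, bounded_set Omega, simply_connected Omega &
      lipschitz_boundary Omega].

End domains.

(* Functions on Omega are represented by total functions on R^d, of which only
   the values on Omega matter; elements of L^2-type spaces are represented by
   measurable functions, and are only determined up to a.e. equality on Omega. *)
Section spaces.
Context (R : realType) (d : nat) (Omega : set 'rV[R]_d).

Let E := 'rV[R]_d.
Let leb := @lebesgue_rV R d.

Definition L2 (v : E -> R) :=
  measurable_fun Omega v /\ leb.-integrable Omega (EFin \o (fun x => v x ^+ 2)).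

Definition normL2 (v : E -> R) : R := Num.sqrt (\int[leb]_(x in Omega) v x ^+ 2).

Definition ae_zero (W : zmodType) (v : E -> W) :=
  {ae leb, forall x, Omega x -> v x = 0}.

Definition partial (i : 'I_d) (phi : E -> R) : E -> R :=
  fun x => 'D_(delta_mx ord0 i) phi x.

Fixpoint Ck (k : nat) (phi : E -> R) : Prop :=
  match k with
  | 0 => continuous phi
  | k'.+1 => continuous phi /\ forall i : 'I_d,
      (forall x, derivable phi x (delta_mx ord0 i)) /\ Ck k' (partial i phi)
  end.

Definition test_function (phi : E -> R) :=
  let supp := closure [set x | phi x != 0] in
  [/\ forall k, Ck k phi, compact supp & supp `<=` Omega].

Definition is_weak_partial (i : 'I_d) (v g : E -> R) :=
  L2 g /\ forall phi, test_function phi ->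
    \int[leb]_(x in Omega) (v x * partial i phi x) =
    - \int[leb]_(x in Omega) (g x * phi x).

(* a choice of representative of the weak derivative, 0 if there is none *)
Definition weak_partial (i : 'I_d) (v : E -> R) : E -> R :=
  xget (fun=> 0) [set g | is_weak_partial i v g].

Definition H1 (v : E -> R) :=
  L2 v /\ forall i, exists g, is_weak_partial i v g.

Definition normH1 (v : E -> R) : R :=
  Num.sqrt (normL2 v ^+ 2 + \sum_(i < d) normL2 (weak_partial i v) ^+ 2).

Definition H10 (v : E -> R) :=
  H1 v /\ forall e, 0 < e -> exists phi, test_function phi /\ normH1 (v \- phi) < e.

Definition mxdot m n (A B : 'M[R]_(m, n)) : R := \sum_i \sum_j A i j * B i j.

Definition frobenius m n (A : 'M[R]_(m, n)) : R := Num.sqrt (mxdot A A).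

Definition L2mx m n (T : E -> 'M[R]_(m, n)) := forall i j, L2 (fun x => T x i j).

Definition normL2mx m n (T : E -> 'M[R]_(m, n)) : R :=
  normL2 (fun x => frobenius (T x)).

Definition intdot m n (S T : E -> 'M[R]_(m, n)) : R :=
  \int[leb]_(x in Omega) mxdot (S x) (T x).

Definition grad (v : E -> 'rV[R]_d) (x : E) : 'M[R]_d :=
  \matrix_(i, j) weak_partial j (fun y => v y ord0 i) x.

Definition symgrad (v : E -> 'rV[R]_d) (x : E) : 'M[R]_d :=
  2^-1 *: (grad v x + (grad v x)^T).

Definition div (v : E -> 'rV[R]_d) (x : E) : R := \tr (grad v x).

(* (u . grad) v *)
Definition convect (u v : E -> 'rV[R]_d) (x : E) : 'rV[R]_d :=
  \row_i \sum_j u x ord0 j * grad v x i j.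

Definition spV : set (E -> 'rV[R]_d) :=
  [set v | forall i, H10 (fun x => v x ord0 i)].

Definition spM : set (E -> 'M[R]_d) :=
  [set T | L2mx T /\ {ae leb, forall x, Omega x -> (T x)^T = T x}].

Definition spQ : set (E -> R) :=
  [set q | L2 q /\ \int[leb]_(x in Omega) q x = 0].

Definition normV (v : E -> 'rV[R]_d) : R := normL2mx (symgrad v).

Definition b2 (v : E -> 'rV[R]_d) (q : E -> R) : R :=
  - \int[leb]_(x in Omega) (q x * div v x).

Definition trilin (u v w : E -> 'rV[R]_d) : R :=
  2^-1 * intdot (convect u v) w - 2^-1 * intdot (convect u w) v.

(* this set of quotients is nonempty and bounded above for f in L^2 and Omega
   a bounded nonempty open set (inequalities of Poincare and Korn), so that the
   real-valued sup is the genuine supremum *)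
Definition normHm1 (f : E -> 'rV[R]_d) : R :=
  sup [set intdot f v / normV v | v in [set v | spV v /\ ~ ae_zero v]].

(* Y is (the set of all representatives in X of the elements of) a
   finite-dimensional subspace of X *)
Definition findim_subspace (W : lmodType R) (X Y : set (E -> W)) :=
  exists (n : nat) (e : 'I_n -> E -> W), (forall k, X (e k)) /\
    Y = [set v | X v /\ exists c : 'I_n -> R,
           ae_zero (fun x => v x - \sum_k c k *: e k x)].

End spaces.

Section problem.
Context (R : realType) (d : nat) (Omega : set 'rV[R]_d).

Let E := 'rV[R]_d.

Definition viscosity (mu : R -> R) (C1 : R) :=
  [/\ {within `[0, +oo[, continuous mu},
      (forall a, 0 < a -> derivable mu a 1 /\ {for a, continuous (derive1 mu)}),
      (forall a, 0 < a -> 0 < derive1 (fun s => mu s * s) a),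
      (forall a, 0 <= a -> 0 < mu a /\ mu a * a <= C1) &
      has_ubound (mu @` `[0, +oo[)].

Definition mu_max (mu : R -> R) : R := sup (mu @` `[0, +oo[).

Definition nonlin (mu : R -> R) (T : 'M[R]_d) : 'M[R]_d := mu (frobenius T) *: T.

Definition traceless_lipschitz (mu : R -> R) (Lambda : R) :=
  forall S T : 'M[R]_d, S^T = S -> T^T = T -> \tr S = 0 -> \tr T = 0 ->
    frobenius (nonlin mu T - nonlin mu S) <= Lambda * frobenius (T - S).

Definition solution_P (f : E -> 'rV[R]_d) (alpha gamma : R) (mu : R -> R)
    (T : E -> 'M[R]_d) (u : E -> 'rV[R]_d) (p : E -> R) :=
  [/\ [/\ spM Omega T, spV Omega u & spQ Omega p],
      (forall v, spV Omega v ->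
        intdot Omega (convect Omega u u) v + intdot Omega T (symgrad Omega v)
          + b2 Omega v p = intdot Omega f v),
      (forall S, spM Omega S ->
        alpha * intdot Omega T S + gamma * intdot Omega (nonlin mu \o T) S
          = intdot Omega (symgrad Omega u) S) &
      (forall q, spQ Omega q -> b2 Omega u q = 0)].

Definition solution_Ph (f : E -> 'rV[R]_d) (alpha gamma : R) (mu : R -> R)
    (Mh : set (E -> 'M[R]_d)) (Vh : set (E -> 'rV[R]_d)) (Qh : set (E -> R))
    (Th : E -> 'M[R]_d) (uh : E -> 'rV[R]_d) (ph : E -> R) :=
  [/\ [/\ Mh Th, Vh uh & Qh ph],
      (forall v, Vh v ->
        trilin Omega uh uh v + intdot Omega Th (symgrad Omega v)
          + b2 Omega v ph = intdot Omega f v),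
      (forall S, Mh S ->
        alpha * intdot Omega Th S + gamma * intdot Omega (nonlin mu \o Th) S
          = intdot Omega (symgrad Omega uh) S) &
      (forall q, Qh q -> b2 Omega uh q = 0)].

(* best approximation errors *)
Definition distM (Mh : set (E -> 'M[R]_d)) (S : E -> 'M[R]_d) : R :=
  inf [set normL2mx Omega (S \- Sh) | Sh in Mh].

Definition distV (Vh : set (E -> 'rV[R]_d)) (v : E -> 'rV[R]_d) : R :=
  inf [set normV Omega (v \- vh) | vh in Vh].

Definition distQ (Qh : set (E -> R)) (q : E -> R) : R :=
  inf [set normL2 Omega (q \- qh) | qh in Qh].

Definition approximating (Mh : R -> set (E -> 'M[R]_d))
    (Vh : R -> set (E -> 'rV[R]_d)) (Qh : R -> set (E -> R)) :=
  [/\ forall S, spM Omega S -> distM (Mh h) S @[h --> 0^'+] --> (0 : R),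
      forall v, spV Omega v -> distV (Vh h) v @[h --> 0^'+] --> (0 : R) &
      forall q, spQ Omega q -> distQ (Qh h) q @[h --> 0^'+] --> (0 : R)].

(* extended reals, so that the infimum over an empty set is +oo and the
   supremum over an empty set is -oo *)
Definition infsup (Vh : set (E -> 'rV[R]_d)) (Qh : set (E -> R)) : \bar R :=
  ereal_inf [set ereal_sup
      [set (b2 Omega v q / (normV Omega v * normL2 Omega q))%:E
        | v in [set v | Vh v /\ ~ ae_zero Omega v]]
    | q in [set q | Qh q /\ ~ ae_zero Omega q]].

Definition spVh0 (Vh : set (E -> 'rV[R]_d)) (Qh : set (E -> R)) :
    set (E -> 'rV[R]_d) :=
  [set v | Vh v /\ forall q, Qh q -> b2 Omega v q = 0].

Definition discrete_spaces (Mh : R -> set (E -> 'M[R]_d))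
    (Vh : R -> set (E -> 'rV[R]_d)) (Qh : R -> set (E -> R)) (beta : R) :=
  [/\ forall h, 0 < h ->
        [/\ findim_subspace Omega (spM Omega) (Mh h),
            findim_subspace Omega (spV Omega) (Vh h) &
            @findim_subspace R d Omega R^o (spQ Omega) (Qh h)],
      approximating Mh Vh Qh,
      0 < beta /\ (forall h, 0 < h -> (beta%:E <= infsup (Vh h) (Qh h))%E) &
      forall h, 0 < h -> forall v, spVh0 (Vh h) (Qh h) v ->
        Mh h (symgrad Omega v)].

Definition Cu (f : E -> 'rV[R]_d) (alpha gamma : R) (mu : R -> R)
    (C1 Lambda : R) : R :=
  Num.min
    (Num.min
      (alpha^-1 * (alpha + gamma * mu_max mu) ^+ 2 * normHm1 Omega f)
      (alpha * normHm1 Omega f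
        + gamma * C1 * Num.sqrt (fine (lebesgue_rV R d Omega))))
    (alpha^-1 * (alpha + gamma * Lambda) ^+ 2 * normHm1 Omega f).

End problem.

(* Main.v *)
Require Import Defs.
From HB Require Import structures.
From mathcomp Require Import all_boot all_order all_algebra.
From mathcomp Require Import all_classical all_reals all_analysis.
From mathcomp Require Import measurable_realfun.
From mathcomp Require Import ring lra.

(** Write F for the dual norm of f, D for the positive part of Dhat, N(T) for
the field mu(|T|) T, and (.,.) for the L^2 product.

Testing the two constitutive laws with the stress and with the strain bounds
both velocities by Cu ([velocity_le_Cu]): monotonicity of N gives
alpha ||T||^2 <= F ||u||, and each term of the minimum defining Cu comes from
one way of bounding ||N(T)||.

A discrete velocity v_h is first corrected to a discretely divergence-free z
with ||u - z|| <= (1 + d / beta) ||u - v_h|| ([velocity_split]).  The strain of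
w := u_h - z is then an admissible discrete stress.  Testing the constitutive
laws with it and the momentum equations with w leaves no pressure but p - q_h,
and since d(u_h; w, w) = 0,
  ||w|| <= gamma Lambda ||T - T_h|| + alpha D Cu ||w|| + approximation errors
([velocity_error]).  Monotonicity of N also gives
  ||T - T_h|| <= ||u - u_h|| / alpha + C ||T - S_h||
([stress_error]).  Inserting the second estimate in the first puts on the right
the factor gamma Lambda / alpha + alpha D Cu <= theta < 1 in front of ||w||,
which is absorbed on the left ([error_absorption]).  The pressure error follows
from the inf-sup condition ([pressure_error]), and the infima over v_h, S_h and
q_h are taken last.

Three ingredients lie below this argument.
- Stresses are not trace-free, whereas the Lipschitz bound on N is assumed for
  trace-free symmetric matrices.  As N is radial, the bound only involves two
  norms and a scalar product, and these are realised by trace-free symmetric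
  matrices as soon as d >= 2 ([lipschitz_all]).
- The convective term of the continuous problem is not skew-symmetrised.  It
  equals d(u; u, v) because div u = 0 almost everywhere ([div_free],
  [convect_trilin]): for test functions this is an integration by parts, and it
  passes to H^1_0 by density, the trilinear form being continuous through the
  embedding of H^1_0 in L^4 ([H10_L4]).  That embedding is derived from
  Ladyzhenskaya's inequalities for test functions.
- Weak derivatives are chosen representatives, hence are linear only almost
  everywhere; their uniqueness is the [fundamental_lemma]. *)

Set Implicit Arguments.
Unset Strict Implicit.
Unset Printing Implicit Defensive.

Import Order.TTheory GRing.Theory Num.Theory.
Import numFieldNormedType.Exports.

Local Open Scope classical_set_scope.
Local Open Scope ring_scope.

(** * Scalar functions in L^2 *)

(** The common source of the Cauchy-Schwarz inequalities below: it is stated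
without an inner product, since the L^2 products here are degenerate (functions
vanishing almost everywhere are not equal to 0). *)
Lemma discriminant (R : realType) (a b c : R) : 0 <= a -> 0 <= c ->
  (forall t, 0 <= a + 2 * t * b + t ^+ 2 * c) -> `|b| <= Num.sqrt a * Num.sqrt c.
Proof.
move=> a0 c0 h.
rewrite -sqrtrM// -sqrtr_sqr ler_wsqrtr//.
have [c_eq0|cn0] := eqVneq c 0.
  rewrite c_eq0 mulr0.
  have [->|bn0] := eqVneq b 0; first by rewrite expr0n.
  (* c = 0: this t makes the affine expression equal to -1 *)
  have := h (- (a + 1) / (2 * b)); rewrite c_eq0 mulr0 addr0.
  rewrite (_ : 2 * _ * _ = - (a + 1)); first lra.
  by field.
(* the minimum of the quadratic *)
have := h (- (b / c)).
have -> : a + 2 * - (b / c) * b + (- (b / c)) ^+ 2 * c = a - b ^+ 2 / c by field.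
by rewrite subr_ge0 ler_pdivrMr ?lt_neqAle ?c0 1?eq_sym ?cn0.
Qed.

Section L2_theory.
Context (R : realType) (d : nat) (Omega : set 'rV[R]_d).
Hypothesis mO : measurable Omega.
Let E := 'rV[R]_d.
Let leb := @lebesgue_rV R d.
Implicit Types f g h : E -> R.
Notation itg f := (leb.-integrable Omega (EFin \o f)).

Lemma measurable_integrable f : itg f -> measurable_fun Omega f.
Proof. by move=> /measurable_int/measurable_EFinP. Qed.

Lemma integrable_le f g : measurable_fun Omega f -> itg g ->
  (forall x, Omega x -> `|f x| <= g x) -> itg f.
Proof.
move=> mf ig fg; apply: (le_integrable mO _ _ ig); first exact/measurable_EFinP.
move=> x Ox /=; rewrite lee_fin (le_trans (fg x Ox))// ler_norm//.
Qed.

Lemma itgD f g : itg f -> itg g -> itg (fun x => f x + g x).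
Proof. by move=> i j; apply: eq_integrable (integrableD mO i j). Qed.
Lemma itgZ k f : itg f -> itg (fun x => k * f x).
Proof. by move=> i; apply: eq_integrable (integrableZl mO k i). Qed.
Lemma itg_sum I (r : seq I) (P : pred I) (F : I -> E -> R) :
  (forall i, P i -> itg (F i)) -> itg (fun x => \sum_(i <- r | P i) F i x).
Proof.
move=> h; have := @integrable_sum _ _ _ leb _ mO _ r P (fun i => EFin \o F i) h.
by apply: eq_integrable => // x _ /=; rewrite sumEFin.
Qed.

Lemma Rint_sum I (r : seq I) (P : pred I) (F : I -> E -> R) :
  (forall i, P i -> itg (F i)) ->
  \int[leb]_(x in Omega) (\sum_(i <- r | P i) F i x) =
  \sum_(i <- r | P i) \int[leb]_(x in Omega) F i x.
Proof.
move=> h; elim: r => [|i r ih].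
  under eq_Rintegral do rewrite big_nil.
  by rewrite big_nil /Rintegral integral0.
rewrite big_cons; under eq_Rintegral do rewrite big_cons.
case: ifPn => // Pi.
by rewrite RintegralD// ?ih//; [exact: h|exact: itg_sum].
Qed.

Lemma ae_eq_Rint f g : measurable_fun Omega f -> measurable_fun Omega g ->
  ae_eq leb Omega f g -> 
  \int[leb]_(x in Omega) f x = \int[leb]_(x in Omega) g x.
Proof.
move=> mf mg fg; congr fine; apply: ae_eq_integral => //.
- exact/measurable_EFinP.
- exact/measurable_EFinP.
- by apply: filterS fg => x /= fg Ox; rewrite fg.
Qed.

Lemma L2_meas f : L2 Omega f -> measurable_fun Omega f.
Proof. by case. Qed.

Lemma L2_mul f g : L2 Omega f -> L2 Omega g -> itg (fun x => f x * g x).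
Proof.
move=> [mf if2] [mg ig2].
apply: (integrable_le _ (itgD if2 ig2)); first exact: measurable_funM.
move=> x _; rewrite normrM.
have := sqr_ge0 (`|f x| - `|g x|); rewrite -(real_normK (num_real (f x))).
rewrite -(real_normK (num_real (g x))).
have := normr_ge0 (f x); have := normr_ge0 (g x); nra.
Qed.

Lemma L2D f g : L2 Omega f -> L2 Omega g -> L2 Omega (fun x => f x + g x).
Proof.
move=> hf hg; split; first by apply: measurable_funD; apply: L2_meas.
have := itgD (itgD hf.2 hg.2) (itgZ 2 (L2_mul hf hg)).
by apply: eq_integrable => // x _ /=; congr EFin; ring.
Qed.

Lemma L2Z k f : L2 Omega f -> L2 Omega (fun x => k * f x).
Proof.
move=> hf; split; first by apply: measurable_funM => //; apply: L2_meas.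
have := itgZ (k ^+ 2) hf.2.
by apply: eq_integrable => // x _ /=; congr EFin; ring.
Qed.

Lemma L2B f g : L2 Omega f -> L2 Omega g -> L2 Omega (fun x => f x - g x).
Proof.
move=> hf hg; have := L2D hf (L2Z (-1) hg).
by congr L2; apply/funext => x; ring.
Qed.

Lemma L2_0 : L2 Omega (fun=> 0).
Proof.
split => //; have := integrable0 leb Omega; apply: eq_integrable => // x _ /=.
by rewrite expr0n.
Qed.

Lemma L2_sum I (r : seq I) (P : pred I) (F : I -> E -> R) :
  (forall i, P i -> L2 Omega (F i)) ->
  L2 Omega (fun x => \sum_(i <- r | P i) F i x).
Proof.
move=> h; elim: r => [|i r ih].
  have -> : (fun x => \sum_(i <- [::] | P i) F i x) = fun=> 0.
    by apply/funext => x; rewrite big_nil.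
  exact: L2_0.
rewrite (_ : (fun x => _) =
  fun x => if P i then F i x + \sum_(j <- r | P j) F j x
           else \sum_(j <- r | P j) F j x); last first.
  by apply/funext => x; rewrite big_cons.
by case Pi: (P i) => //; apply: L2D => //; exact: h.
Qed.

Lemma L2_dominated f g : measurable_fun Omega f -> L2 Omega g ->
  (forall x, Omega x -> `|f x| <= `|g x|) -> L2 Omega f.
Proof.
move=> mf hg fg; split=> //; apply: integrable_le hg.2 _; first exact: measurable_funX.
move=> x Ox; rewrite normrX -(real_normK (num_real (g x))).
by rewrite ler_sqr ?nnegrE//; exact: fg.
Qed.

Lemma Rint_sqr_ge0 f : 0 <= \int[leb]_(x in Omega) f x ^+ 2.
Proof. by apply: Rintegral_ge0 => x _; rewrite sqr_ge0. Qed.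

Lemma normL2_ge0 f : 0 <= normL2 Omega f.
Proof. exact: sqrtr_ge0. Qed.

Lemma sqr_normL2 f : normL2 Omega f ^+ 2 = \int[leb]_(x in Omega) f x ^+ 2.
Proof. by rewrite sqr_sqrtr// Rint_sqr_ge0. Qed.

(** The quadratic polynomial in t to which [discriminant] applies. *)
Lemma L2_expand f g t : L2 Omega f -> L2 Omega g ->
  \int[leb]_(x in Omega) (f x + t * g x) ^+ 2 =
  \int[leb]_(x in Omega) f x ^+ 2 +
  2 * t * \int[leb]_(x in Omega) (f x * g x) +
  t ^+ 2 * \int[leb]_(x in Omega) g x ^+ 2.
Proof.
move=> hf hg; rewrite -RintegralZl ?(L2_mul hf hg)//.
rewrite -RintegralZl ?hg.2// -!RintegralD ?hf.2//.
- by apply: eq_Rintegral => x _; ring.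
- by apply: itgD; [exact: hf.2|exact/itgZ/L2_mul].
- exact/itgZ/hg.2.
- exact/itgZ/L2_mul.
Qed.

Lemma cauchy_schwarz f g : L2 Omega f -> L2 Omega g ->
  `|\int[leb]_(x in Omega) (f x * g x)| <= normL2 Omega f * normL2 Omega g.
Proof.
move=> hf hg; apply: discriminant; rewrite ?Rint_sqr_ge0// => t.
by rewrite -L2_expand// Rint_sqr_ge0.
Qed.

Lemma normL2D f g : L2 Omega f -> L2 Omega g ->
  normL2 Omega (fun x => f x + g x) <= normL2 Omega f + normL2 Omega g.
Proof.
move=> hf hg; rewrite -ler_sqr ?nnegrE ?addr_ge0 ?normL2_ge0// sqr_normL2.
have := L2_expand 1 hf hg; under eq_Rintegral do rewrite mul1r.
move=> ->; rewrite -!sqr_normL2.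
have := ler_norm (\int[leb]_(x in Omega) (f x * g x)).
by have := cauchy_schwarz hf hg; lra.
Qed.

Lemma normL2Z k f : L2 Omega f ->
  normL2 Omega (fun x => k * f x) = `|k| * normL2 Omega f.
Proof.
move=> hf; rewrite /normL2 -sqrtr_sqr -sqrtrM ?sqr_ge0// -RintegralZl ?hf.2//.
by congr Num.sqrt; apply: eq_Rintegral => x _; ring.
Qed.

Lemma normL2_0 : normL2 Omega (fun=> 0) = 0.
Proof.
apply/eqP; rewrite -sqrf_eq0 sqr_normL2 /Rintegral.
by under eq_integral do rewrite expr0n; rewrite integral0.
Qed.

Lemma normL2N f : L2 Omega f -> normL2 Omega (fun x => - f x) = normL2 Omega f.
Proof.
move=> hf; rewrite -[RHS]mul1r -(normrN1 R) -normL2Z//.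
by congr normL2; apply/funext => x; rewrite mulN1r.
Qed.

Lemma normL2B f g : L2 Omega f -> L2 Omega g ->
  normL2 Omega (fun x => f x - g x) <= normL2 Omega f + normL2 Omega g.
Proof.
move=> hf hg; rewrite -(normL2N hg); apply: normL2D => //.
by have := L2Z (-1) hg; congr L2; apply/funext => x; rewrite mulN1r.
Qed.

Lemma normL2_sum I (r : seq I) (P : pred I) (F : I -> E -> R) :
  (forall i, P i -> L2 Omega (F i)) ->
  normL2 Omega (fun x => \sum_(i <- r | P i) F i x) <=
  \sum_(i <- r | P i) normL2 Omega (F i).
Proof.
move=> h; elim: r => [|i r ih].
  have -> : (fun x => \sum_(i <- [::] | P i) F i x) = fun=> 0.
    by apply/funext => x; rewrite big_nil.
  by rewrite big_nil normL2_0.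
rewrite (_ : (fun x => _) =
  fun x => if P i then F i x + \sum_(j <- r | P j) F j x
           else \sum_(j <- r | P j) F j x); last first.
  by apply/funext => x; rewrite big_cons.
rewrite big_cons.
case Pi: (P i) => //; apply: (le_trans (normL2D (h i Pi) (L2_sum _ h))).
by rewrite lerD2l.
Qed.

Lemma ae_eq_normL2 f g : measurable_fun Omega f -> measurable_fun Omega g ->
  ae_eq leb Omega f g -> normL2 Omega f = normL2 Omega g.
Proof.
move=> mf mg fg; congr Num.sqrt; apply: ae_eq_Rint; try exact: measurable_funX.
by apply: filterS fg => x /= fg Ox; rewrite fg.
Qed.

Lemma normL2_le f g : L2 Omega f -> L2 Omega g ->
  (forall x, Omega x -> `|f x| <= `|g x|) -> normL2 Omega f <= normL2 Omega g.
Proof.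
move=> hf hg fg; rewrite ler_wsqrtr// le_Rintegral//; [exact: hf.2|exact: hg.2|].
move=> x Ox; rewrite -(real_normK (num_real (g x))) -(real_normK (num_real (f x))).
by rewrite ler_sqr ?nnegrE//; exact: fg.
Qed.

Lemma normL2_eq0 f : L2 Omega f -> normL2 Omega f = 0 -> ae_zero Omega f.
Proof.
move=> hf /eqP; rewrite -sqrf_eq0 sqr_normL2 => /eqP f0.
have : (\int[leb]_(x in Omega) `|(f x ^+ 2)%:E| = 0)%E.
  under eq_integral do rewrite abse_EFin ger0_norm ?sqr_ge0//.
  by rewrite -[LHS]fineK ?[fine _]f0// integrable_fin_num// hf.2.
move/ae_eq_integral_abs => /(_ mO) /= h.
have {}h := h (iffRL (measurable_EFinP _ _) (measurable_funX 2 hf.1)).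
move: h.
apply: filterS => x /= + Ox => /(_ Ox) [] /eqP.
by rewrite sqrf_eq0 => /eqP.
Qed.

End L2_theory.

(** * Matrices and matrix fields in L^2 *)

Section frobenius_theory.
Context (R : realType) (m n : nat).
Implicit Types A B C : 'M[R]_(m, n).

Lemma mxdotC A B : mxdot A B = mxdot B A.
Proof. by apply: eq_bigr => i _; apply: eq_bigr => j _; rewrite mulrC. Qed.

Lemma mxdotDl A B C : mxdot (A + B) C = mxdot A C + mxdot B C.
Proof.
rewrite -big_split; apply: eq_bigr => i _; rewrite -big_split.
by apply: eq_bigr => j _; rewrite mxE mulrDl.
Qed.

Lemma mxdotZl k A B : mxdot (k *: A) B = k * mxdot A B.
Proof.
rewrite mulr_sumr; apply: eq_bigr => i _; rewrite mulr_sumr.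
by apply: eq_bigr => j _; rewrite mxE mulrA.
Qed.

Lemma mxdotDr A B C : mxdot C (A + B) = mxdot C A + mxdot C B.
Proof. by rewrite mxdotC mxdotDl !(mxdotC C). Qed.

Lemma mxdotZr k A B : mxdot A (k *: B) = k * mxdot A B.
Proof. by rewrite mxdotC mxdotZl mxdotC. Qed.

Lemma mxdotBl A B C : mxdot (A - B) C = mxdot A C - mxdot B C.
Proof. by rewrite mxdotDl -scaleN1r mxdotZl mulN1r. Qed.

Lemma mxdotBr A B C : mxdot C (A - B) = mxdot C A - mxdot C B.
Proof. by rewrite mxdotC mxdotBl !(mxdotC C). Qed.

Lemma mxdot0l A : mxdot 0 A = 0.
Proof. by rewrite -(scale0r 0) mxdotZl mul0r. Qed.

Lemma mxdot_ge0 A : 0 <= mxdot A A.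
Proof.
by apply: sumr_ge0 => i _; apply: sumr_ge0 => j _; rewrite -expr2 sqr_ge0.
Qed.

Lemma sqr_frobenius A : frobenius A ^+ 2 = mxdot A A.
Proof. by rewrite sqr_sqrtr// mxdot_ge0. Qed.

Lemma frobenius_ge0 A : 0 <= frobenius A.
Proof. exact: sqrtr_ge0. Qed.

Lemma mxdot_cs A B : `|mxdot A B| <= frobenius A * frobenius B.
Proof.
apply: discriminant; rewrite ?mxdot_ge0// => t.
have -> : mxdot A A + 2 * t * mxdot A B + t ^+ 2 * mxdot B B =
  mxdot (A + t *: B) (A + t *: B).
  rewrite mxdotDl !mxdotDr !mxdotZl !mxdotZr (mxdotC B A); ring.
exact: mxdot_ge0.
Qed.

Lemma frobenius_entry A i j : `|A i j| <= frobenius A.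
Proof.
rewrite -ler_sqr ?nnegrE ?frobenius_ge0// sqr_frobenius real_normK ?num_real//.
rewrite /mxdot (bigD1 i)//= (bigD1 j)//= -expr2 -addrA lerDl addr_ge0//.
  by apply: sumr_ge0 => k _; rewrite -expr2 sqr_ge0.
by apply: sumr_ge0 => k _; apply: sumr_ge0 => l _; rewrite -expr2 sqr_ge0.
Qed.

Lemma frobeniusZ k A : frobenius (k *: A) = `|k| * frobenius A.
Proof.
by rewrite /frobenius mxdotZl mxdotZr mulrA -expr2 sqrtrM ?sqr_ge0// sqrtr_sqr.
Qed.

End frobenius_theory.

Section L2mx_theory.
Context (R : realType) (d : nat) (Omega : set 'rV[R]_d).
Hypothesis mO : measurable Omega.
Let E := 'rV[R]_d.
Let leb := @lebesgue_rV R d.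
Context (m n : nat).
Implicit Types S T U : E -> 'M[R]_(m, n).
Local Notation itg f := (leb.-integrable Omega (EFin \o f)).

Lemma L2mxD S T : L2mx Omega S -> L2mx Omega T ->
  L2mx Omega (fun x => S x + T x).
Proof.
move=> hS hT i j; have := L2D mO (hS i j) (hT i j).
by congr L2; apply/funext => x; rewrite mxE.
Qed.

Lemma L2mxZ k T : L2mx Omega T -> L2mx Omega (fun x => k *: T x).
Proof.
move=> hT i j; have := L2Z mO k (hT i j).
by congr L2; apply/funext => x; rewrite mxE.
Qed.

Lemma L2mxB S T : L2mx Omega S -> L2mx Omega T ->
  L2mx Omega (fun x => S x - T x).
Proof.
move=> hS hT i j; have := L2B mO (hS i j) (hT i j).
by congr L2; apply/funext => x; rewrite !mxE.
Qed.

Lemma itg_mxdot S T : L2mx Omega S -> L2mx Omega T ->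
  itg (fun x => mxdot (S x) (T x)).
Proof.
move=> hS hT; apply: itg_sum => // i _; apply: itg_sum => // j _.
exact: L2_mul.
Qed.

Lemma meas_mxdot S T : L2mx Omega S -> L2mx Omega T ->
  measurable_fun Omega (fun x => mxdot (S x) (T x)).
Proof. by move=> hS hT; exact: measurable_integrable (itg_mxdot hS hT). Qed.

Lemma intdotC S T : intdot Omega S T = intdot Omega T S.
Proof. by apply: eq_Rintegral => x _; exact: mxdotC. Qed.

Lemma intdot_sum S T : L2mx Omega S -> L2mx Omega T ->
  intdot Omega S T =
  \sum_i \sum_j \int[leb]_(x in Omega) (S x i j * T x i j).
Proof.
move=> hS hT; rewrite /intdot Rint_sum//; last first.
  by move=> i _; apply: itg_sum => // j _; apply: L2_mul.
by apply: eq_bigr => i _; rewrite Rint_sum// => j _; exact: L2_mul.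
Qed.

Lemma intdotDl S T U : L2mx Omega S -> L2mx Omega T -> L2mx Omega U ->
  intdot Omega (fun x => S x + T x) U = intdot Omega S U + intdot Omega T U.
Proof.
move=> hS hT hU; rewrite -RintegralD ?itg_mxdot//.
by apply: eq_Rintegral => x _; rewrite mxdotDl.
Qed.

Lemma intdotBl S T U : L2mx Omega S -> L2mx Omega T -> L2mx Omega U ->
  intdot Omega (fun x => S x - T x) U = intdot Omega S U - intdot Omega T U.
Proof.
move=> hS hT hU; rewrite -RintegralB ?itg_mxdot//.
by apply: eq_Rintegral => x _; rewrite mxdotBl.
Qed.

Lemma intdotZl k S T : L2mx Omega S -> L2mx Omega T ->
  intdot Omega (fun x => k *: S x) T = k * intdot Omega S T.
Proof.
move=> hS hT; rewrite -RintegralZl ?itg_mxdot//.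
by apply: eq_Rintegral => x _; rewrite mxdotZl.
Qed.

Lemma intdotBr S T U : L2mx Omega S -> L2mx Omega T -> L2mx Omega U ->
  intdot Omega U (fun x => S x - T x) = intdot Omega U S - intdot Omega U T.
Proof. by move=> hS hT hU; rewrite intdotC intdotBl// !(intdotC U). Qed.

Lemma intdotDr S T U : L2mx Omega S -> L2mx Omega T -> L2mx Omega U ->
  intdot Omega U (fun x => S x + T x) = intdot Omega U S + intdot Omega U T.
Proof. by move=> hS hT hU; rewrite intdotC intdotDl// !(intdotC U). Qed.

Lemma intdotZr k S T : L2mx Omega S -> L2mx Omega T ->
  intdot Omega S (fun x => k *: T x) = k * intdot Omega S T.
Proof. by move=> hS hT; rewrite intdotC intdotZl// intdotC. Qed.

Lemma intdot_ge0 S : 0 <= intdot Omega S S.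
Proof. by apply: Rintegral_ge0 => x _; exact: mxdot_ge0. Qed.

Lemma normL2mxE S : normL2mx Omega S = Num.sqrt (intdot Omega S S).
Proof.
by congr Num.sqrt; apply: eq_Rintegral => x _; rewrite sqr_frobenius.
Qed.

Lemma sqr_normL2mx S : normL2mx Omega S ^+ 2 = intdot Omega S S.
Proof. by rewrite normL2mxE sqr_sqrtr// intdot_ge0. Qed.

Lemma normL2mx_ge0 S : 0 <= normL2mx Omega S.
Proof. exact: normL2_ge0. Qed.

Lemma intdot_expand t S T : L2mx Omega S -> L2mx Omega T ->
  intdot Omega (fun x => S x + t *: T x) (fun x => S x + t *: T x) =
  intdot Omega S S + 2 * t * intdot Omega S T + t ^+ 2 * intdot Omega T T.
Proof.
move=> hS hT; have htT := L2mxZ t hT; have hST := L2mxD hS htT.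
rewrite intdotDl// intdotZl// !intdotDr// !intdotZr// (intdotC T S); ring.
Qed.

Lemma intdot_cs S T : L2mx Omega S -> L2mx Omega T ->
  `|intdot Omega S T| <= normL2mx Omega S * normL2mx Omega T.
Proof.
move=> hS hT; rewrite !normL2mxE.
apply: discriminant; rewrite ?intdot_ge0// => t.
by rewrite -intdot_expand// intdot_ge0.
Qed.

Lemma intdot_le S T : L2mx Omega S -> L2mx Omega T ->
  intdot Omega S T <= normL2mx Omega S * normL2mx Omega T.
Proof. by move=> hS hT; apply: le_trans (intdot_cs hS hT); exact: ler_norm. Qed.

Lemma normL2mxD S T : L2mx Omega S -> L2mx Omega T ->
  normL2mx Omega (fun x => S x + T x) <= normL2mx Omega S + normL2mx Omega T.
Proof.
move=> hS hT.
rewrite -ler_sqr ?nnegrE ?addr_ge0 ?normL2mx_ge0// sqr_normL2mx.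
have := intdot_expand 1 hS hT.
rewrite (_ : (fun x => S x + 1 *: T x) = (fun x => S x + T x)); last first.
  by apply/funext => x; rewrite scale1r.
by move=> ->; have := intdot_le hS hT; rewrite -!sqr_normL2mx; lra.
Qed.

Lemma normL2mx_triangle S T U : L2mx Omega S -> L2mx Omega T -> L2mx Omega U ->
  normL2mx Omega (fun x => S x - U x) <=
  normL2mx Omega (fun x => S x - T x) + normL2mx Omega (fun x => T x - U x).
Proof.
move=> hS hT hU.
have -> : (fun x => S x - U x) = fun x => (S x - T x) + (T x - U x).
  by apply/funext => x; rewrite addrA subrK.
by apply: normL2mxD; exact: L2mxB.
Qed.

Lemma normL2mx_subC S T : normL2mx Omega (fun x => S x - T x) =
  normL2mx Omega (fun x => T x - S x).
Proof.
congr normL2; apply/funext => x; rewrite -opprB -scaleN1r frobeniusZ.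
by rewrite normrN1 mul1r.
Qed.

Lemma ae_eq_intdot S S' T : L2mx Omega S -> L2mx Omega S' -> L2mx Omega T ->
  ae_eq leb Omega S S' -> intdot Omega S T = intdot Omega S' T.
Proof.
move=> hS hS' hT SS'; apply: ae_eq_Rint => //; try exact: meas_mxdot.
by apply: filterS SS' => x h Ox; rewrite h.
Qed.

Lemma ae_eq_normL2mx S S' : L2mx Omega S -> L2mx Omega S' ->
  ae_eq leb Omega S S' -> normL2mx Omega S = normL2mx Omega S'.
Proof.
move=> hS hS' h; rewrite !normL2mxE (ae_eq_intdot hS hS')//.
by rewrite intdotC (ae_eq_intdot hS hS').
Qed.

Lemma L2_frobenius S : L2mx Omega S -> L2 Omega (fun x => frobenius (S x)).
Proof.
move=> hS; split.
  by apply: (measurableT_comp (continuous_measurable_fun (@sqrt_continuous R)));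
    exact: meas_mxdot.
have := itg_mxdot hS hS; apply: eq_integrable => // x _ /=.
by rewrite sqr_frobenius.
Qed.

Lemma normL2_entry S i j : L2mx Omega S ->
  normL2 Omega (fun x => S x i j) <= normL2mx Omega S.
Proof.
move=> hS; apply: normL2_le => //; first exact: L2_frobenius.
by move=> x _; rewrite (ger0_norm (frobenius_ge0 _)) frobenius_entry.
Qed.

Lemma normL2mx_le k S T : L2mx Omega S -> L2mx Omega T -> 0 <= k ->
  (forall x, Omega x -> frobenius (S x) <= k * frobenius (T x)) ->
  normL2mx Omega S <= k * normL2mx Omega T.
Proof.
move=> hS hT k0 h; rewrite -(ger0_norm k0) -normL2Z//; last exact: L2_frobenius.
apply: normL2_le; [by []|exact: L2_frobenius|exact/L2Z/L2_frobenius|].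
move=> x Ox; rewrite !ger0_norm ?mulr_ge0 ?frobenius_ge0//; exact: h.
Qed.

End L2mx_theory.

(** * Borel sets, slices and Fubini in R^n *)

Section rV_topology.
Context (R : realType).

Lemma rV_coord_le n (x : 'rV[R]_n) i : `|x ord0 i| <= `|x|.
Proof.
rewrite [leRHS]/Num.Def.normr /= mx_normrE; apply/bigmax_geP; right => /=.
by exists (ord0, i).
Qed.

Lemma rV_norm_le n (x : 'rV[R]_n) e :
  0 <= e -> (forall i, `|x ord0 i| <= e) -> `|x| <= e.
Proof.
move=> e0 h; rewrite [leLHS]/Num.Def.normr /= mx_normrE; apply/bigmax_leP; split => //.
by move=> [i j] _ /=; rewrite ord1.
Qed.

Lemma ball_rVP n (x y : 'rV[R]_n) e : 0 < e ->
  ball x e y <-> forall i, `|x ord0 i - y ord0 i| < e.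
Proof.
move=> e0; split=> [[_ h] i|h]; first exact: h.
by split=> // i j; rewrite ord1; exact: h.
Qed.

(** Pairs (q, k) index a countable base of the topology: cubes with a
rational centre q and half-side 1 / (k + 1). *)
Definition rat_center n (qk : 'rV[rat]_n * nat) : 'rV[R]_n :=
  map_mx ratr qk.1.

Definition rat_box n (qk : 'rV[rat]_n * nat) : set 'rV[R]_n :=
  [set y | forall i, `|rat_center qk ord0 i - y ord0 i| < qk.2.+1%:R^-1].

(** The conclusion is about the closed cube: bumps on the open cube then have
their support in U, as [fundamental_lemma] requires. *)
Lemma rat_box_basis n (U : set 'rV[R]_n) x : open U -> U x ->
  exists qk : 'rV[rat]_n * nat, rat_box qk x /\
    forall y : 'rV[R]_n, (forall i, `|rat_center qk ord0 i - y ord0 i| <= qk.2.+1%:R^-1) ->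
    U y.
Proof.
move=> oU Ux.
have /nbhs_ballP[e /= e0 exU] : nbhs x U by exact: open_nbhs_nbhs.
have [k hk] : exists k : nat, k.+1%:R^-1 < e / 2.
  have e2 : 0 < e / 2 by rewrite divr_gt0.
  exists (Num.truncn (e / 2)^-1); rewrite invf_plt ?posrE//.
  exact: truncnS_gt.
have q_ex (i : 'I_n) : exists q : rat, `|ratr q - x ord0 i| < k.+1%:R^-1.
  have : x ord0 i - k.+1%:R^-1 < x ord0 i + k.+1%:R^-1.
    by rewrite ltrBlDr -addrA ltrDl addr_gt0.
  move=> /rat_in_itvoo[q]; rewrite in_itv/= => /andP[h1 h2].
  by exists q; rewrite ltr_distl h1 h2.
pose q : 'rV[rat]_n := \row_i sval (cid (q_ex i)).
have qP i : `|rat_center (q, k) ord0 i - x ord0 i| < k.+1%:R^-1.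
  by rewrite /rat_center !mxE; exact: (svalP (cid (q_ex i))).
exists (q, k); split; first exact: qP.
move=> y yB; apply: exU; apply/ball_rVP => // i.
rewrite (le_lt_trans (ler_distD (rat_center (q, k) ord0 i) _ _))// (splitr e).
rewrite ltrD//; first by rewrite distrC (lt_trans _ hk).
by rewrite (le_lt_trans (yB i)).
Qed.

Lemma measurable_rV_box n (A : 'I_n -> set R) : (forall i, measurable (A i)) ->
  measurable [set x : 'rV[R]_n | forall i, A i (x ord0 i)].
Proof.
move=> mA; rewrite (_ : [set x | _] = \bigcap_(i in [set: 'I_n])
    (@rV_coord R n i @^-1` A i)); last first.
  by apply/seteqP; split=> [y h i _|y h i]; [exact: h|exact: h i I].
apply: fin_bigcap_measurable => [|i _]; first exact: finite_finset.
by rewrite -[X in measurable X]setTI; apply: measurable_rV_coord => //; exact: mA.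
Qed.

Lemma measurable_rat_box n (qk : 'rV[rat]_n * nat) : measurable (rat_box qk).
Proof.
apply: (@measurable_rV_box _
  (fun i => [set t | `|rat_center qk ord0 i - t| < qk.2.+1%:R^-1])) => i.
apply: open_measurable.
rewrite (_ : [set t | _] = ball (rat_center qk ord0 i) qk.2.+1%:R^-1)//.
exact: ball_open.
Qed.

(** The sigma-algebra is generated by the coordinates, so that cubes are
measurable; an open set is a countable union of rational cubes. *)
Lemma open_rV_measurable n (U : set 'rV[R]_n) : open U -> measurable U.
Proof.
move=> oU.
pose F (qk : 'rV[rat]_n * nat) :=
  if `[< rat_box qk `<=` U >] then rat_box qk else set0.
have -> : U = \bigcup_qk F qk.
  apply/seteqP; split=> [x Ux|x [qk _]]; last first.
    by rewrite /F; case: asboolP => // BU; exact: BU.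
  have [qk [xqk qkU]] := rat_box_basis oU Ux.
  exists qk => //; rewrite /F; case: asboolP => // -[] y yB; apply: qkU => i.
  exact/ltW/yB.
apply: countable_bigcupT_measurable; first exact: countableP.
move=> qk; rewrite /F; case: asboolP => // _; exact: measurable_rat_box.
Qed.

Lemma continuous_rV_measurable n (f : 'rV[R]_n -> R) :
  continuous f -> measurable_fun setT f.
Proof.
move=> cf; apply: (measurability _ (RGenOpens.measurableE R)).
move=> _ [_ [a [b ->] <-]]; rewrite setTI; apply: open_rV_measurable.
by move/continuousP : cf; apply; exact: interval_open.
Qed.

Lemma lebesgue_rV_bounded n (A : set 'rV[R]_n) M : measurable A ->
  (forall x, A x -> `|x| <= M) -> (lebesgue_rV R n A < +oo)%E.
Proof.
move=> mA AM.
have mI : (measurable (`[- M, M]%classic : set (measurableTypeR R))) by exact: measurable_itv.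
have mbox : measurable
    [set x : 'rV[R]_n | forall i, `[- M, M]%classic (x ord0 i)].
  by apply: (@measurable_rV_box _ (fun=> `[- M, M]%classic)).
apply: (@le_lt_trans _ _ (lebesgue_rV R n
    [set x : 'rV[R]_n | forall i, `[- M, M]%classic (x ord0 i)])).
  apply: le_measure; rewrite ?inE// => x Ax i.
  by rewrite /= in_itv /= -ler_norml (le_trans (rV_coord_le _ _))// AM.
rewrite (lebesgue_rV_box (A := fun=> `[- M, M]%classic))//.
have -> : (lebesgue_measure (`[- M, M]%classic : set R)) =
    (fine (lebesgue_measure (`[- M, M]%classic : set R)))%:E.
  rewrite fineK// ge0_fin_numE// lebesgue_measure_itv/= lte_fin.
  by case: ifPn => _; rewrite ?ltry// -EFinD ltry.
by rewrite prodEFin ltry.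
Qed.

Lemma itg_continuous_compact n (f : 'rV[R]_n -> R) M : continuous f ->
  (forall x, M < `|x| -> f x = 0) ->
  (lebesgue_rV R n).-integrable setT (EFin \o f).
Proof.
move=> cf f0.
pose A := [set x : 'rV[R]_n | `|x| <= M].
have cA : closed A.
  rewrite (_ : A = (@Num.Def.normr _ _) @^-1` [set t : R | t <= M])//.
  apply: preimage_closed; last exact: closed_le.
  by move=> x _; exact: norm_continuous.
have mA : measurable A.
  by rewrite -[A]setCK; apply: measurableC; apply: open_rV_measurable; exact: closed_openC.
have compA : compact A.
  apply: bounded_closed_compact => //; exists M; split; first exact: num_real.
  by move=> x Mx y /= /le_trans; apply; exact: ltW.
have bfA : [bounded f x | x in A].
  have /compact_bounded[N [_ h]] :=
    continuous_compact (continuous_subspaceT cf) compA.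
  by exists N; split; rewrite ?num_real// => x Nx y Ay; apply: h => //; exists y.
have := measurable_bounded_integrable mA (lebesgue_rV_bounded mA (fun x h => h))
  (measurable_funTS (continuous_rV_measurable cf)) bfA.
rewrite integrable_mkcond//; apply: eq_integrable => // x _.
rewrite /= patchE; case: ifPn => // /negP; rewrite inE /A /= => /negP.
by rewrite -ltNge => /f0 ->.
Qed.

End rV_topology.

Section slices.
Context (R : realType) (n : nat).
Implicit Types (a : R) (y : 'rV[R]_n).

Lemma cons_rV0 a y : cons_rV (a, y) ord0 ord0 = a.
Proof. by rewrite mxE unlift_none. Qed.

Lemma cons_rVS a y j : cons_rV (a, y) ord0 (lift ord0 j) = y ord0 j.
Proof. by rewrite mxE liftK. Qed.

Lemma cons_rV_eq (x z : 'rV[R]_n.+1) : x ord0 ord0 = z ord0 ord0 ->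
  (forall j, x ord0 (lift ord0 j) = z ord0 (lift ord0 j)) -> x = z.
Proof.
by move=> h0 h; apply/rowP => i; case: (unliftP ord0 i) => [j ->|->].
Qed.

(** Directional difference quotients restrict to slices: this transfers partial
derivatives in both directions. *)
Lemma cons_rV_shift0 a h y :
  cons_rV (h + a, y) = h *: delta_mx ord0 ord0 + cons_rV (a, y).
Proof.
apply: cons_rV_eq => [|j]; first by rewrite !mxE !unlift_none !eqxx mulr1.
by rewrite !mxE !liftK /= mulr0 add0r.
Qed.

Lemma cons_rV_shiftS a h y i : cons_rV (a, h *: delta_mx ord0 i + y) =
  h *: delta_mx ord0 (lift ord0 i) + cons_rV (a, y).
Proof.
apply: cons_rV_eq => [|j]; first by rewrite !mxE unlift_none mulr0 add0r.
rewrite !mxE !liftK !mxE !eqxx /= (inj_eq lift_inj)//.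
Qed.

Lemma cons_rV_norm_ge1 a y : `|a| <= `|cons_rV (a, y)|.
Proof. by have := rV_coord_le (cons_rV (a, y)) ord0; rewrite cons_rV0. Qed.

Lemma cons_rV_norm_ge2 a y : `|y| <= `|cons_rV (a, y)|.
Proof.
apply: rV_norm_le => // i; rewrite -(cons_rVS a y); exact: rV_coord_le.
Qed.

Lemma cons_rV_continuous1 y : continuous (fun a => cons_rV (a, y)).
Proof.
move=> a; apply/cvg_ballP => e e0.
have h : nbhs a (ball a e) by exact: nbhsx_ballx.
apply: filterS h => b ab; apply/ball_rVP => // i.
case: (unliftP ord0 i) => [j ->|->]; first by rewrite !cons_rVS subrr normr0.
by rewrite !cons_rV0.
Qed.

Lemma cons_rV_continuous2 a : continuous (fun y => cons_rV (a, y)).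
Proof.
move=> y A /nbhs_ballP[e /= e0 eA]; apply/nbhs_ballP; exists e => // z.
move=> /(ball_rVP _ _ e0) yz; apply: eA; apply/ball_rVP => // i.
case: (unliftP ord0 i) => [j ->|->]; first by rewrite !cons_rVS.
by rewrite !cons_rV0 subrr normr0.
Qed.

Lemma measurable_comp_cons (f : 'rV[R]_n.+1 -> \bar R) :
  measurable_fun setT f -> measurable_fun setT (f \o @cons_rV R n).
Proof. by move=> mf; exact: (measurableT_comp mf (@measurable_cons_rV R n)). Qed.

Lemma ge0_integral_rVS (f : 'rV[R]_n.+1 -> \bar R) :
  measurable_fun setT f -> (forall x, 0 <= f x)%E ->
  (\int[lebesgue_rV R n.+1]_x f x =
   \int[@lebesgue_measure R]_a \int[lebesgue_rV R n]_y f (cons_rV (a, y)))%E.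
Proof.
move=> mf f0.
rewrite -(@fubini_tonelli1 _ _ _ _ _ (@lebesgue_measure R) (lebesgue_rV R n)
  (f \o @cons_rV R n)); first last.
- by move=> x; exact: f0.
- exact: measurable_comp_cons.
by rewrite [LHS](@ge0_integral_pushforward _ _ _ _ _ _ (@measurable_cons_rV R n))//.
Qed.

Lemma measurable_cons2 (f : 'rV[R]_n.+1 -> \bar R) a :
  measurable_fun setT f -> measurable_fun setT (fun y => f (cons_rV (a, y))).
Proof.
move=> mf.
have := measurable_comp_cons mf.
by move=> /(@measurableT_comp _ _ _ _ _ _ _ _ _) /(_ (pair1_measurable a)).
Qed.

Lemma ge0_fubini_rVS (f : 'rV[R]_n.+1 -> \bar R) :
  measurable_fun setT f -> (forall x, 0 <= f x)%E ->
  (\int[@lebesgue_measure R]_a \int[lebesgue_rV R n]_y f (cons_rV (a, y)) =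
   \int[lebesgue_rV R n]_y \int[@lebesgue_measure R]_a f (cons_rV (a, y)))%E.
Proof.
move=> mf f0.
apply: (@fubini_tonelli _ _ _ _ _ (@lebesgue_measure R) (lebesgue_rV R n)
  (f \o @cons_rV R n)); first exact: measurable_comp_cons.
by move=> x; exact: f0.
Qed.

(** Integration over R^(n+1) is by construction a product integration, so that
Fubini applies in both orders. *)
Lemma integral_rVS (f : 'rV[R]_n.+1 -> \bar R) :
  (lebesgue_rV R n.+1).-integrable setT f ->
  (\int[lebesgue_rV R n.+1]_x f x =
   \int[@lebesgue_measure R]_a \int[lebesgue_rV R n]_y f (cons_rV (a, y)) /\
  \int[lebesgue_rV R n.+1]_x f x =
   \int[lebesgue_rV R n]_y \int[@lebesgue_measure R]_a f (cons_rV (a, y)))%E.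
Proof.
move=> /integrableP[mf fi].
have mfc := measurable_comp_cons mf.
have fci : (@lebesgue_measure R \x lebesgue_rV R n)%E.-integrable setT
    (f \o @cons_rV R n).
  apply/integrableP; split => //.
  move: fi; rewrite [X in (X < _)%E -> _](@ge0_integral_pushforward _ _ _ _ _ _
    (@measurable_cons_rV R n))//.
  by apply: measurableT_comp.
have -> : (\int[lebesgue_rV R n.+1]_x f x =
    \int[(@lebesgue_measure R \x lebesgue_rV R n)%E]_x (f \o @cons_rV R n) x)%E.
  by rewrite [LHS](@integral_pushforward _ _ _ _ _ _ (@measurable_cons_rV R n)).
split; first by rewrite -(integral12_prod_meas1 fci).
by rewrite -(integral21_prod_meas1 fci).
Qed.

End slices.

(** * Functions with one continuous derivative and bounded support *)

Section one_dim.
Context (R : realType).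
Implicit Types (g : R -> R) (a b M : R).

Lemma derive_outside g M : (forall x, M < `|x| -> g x = 0) ->
  forall x, M < `|x| -> 'D_1 g x = 0.
Proof.
move=> g0 x Mx; rewrite (@near_eq_derive _ _ _ g (cst 0))//; first exact: derive_cst.
have oM : open [set z : R | M < `|z|].
  rewrite (_ : [set z | _] = (@Num.Def.normr _ _) @^-1` [set t : R | t > M])//.
  by apply: open_comp => [z _|]; [exact: norm_continuous|exact: open_gt].
by apply: filterS (open_nbhs_nbhs (conj oM Mx)) => z /= /g0.
Qed.

Lemma FTC_itv g a b : a < b -> (forall x, derivable g x 1) ->
  continuous ('D_1 g) ->
  (\int[@lebesgue_measure R]_(x in `[a, b]) ('D_1 g x)%:E = (g b - g a)%:E)%E.
Proof.
move=> ab dg cg.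
have cgg : continuous g.
  by move=> x; apply/differentiable_continuous/derivable1_diffP/dg.
rewrite EFinB; apply: continuous_FTC2 => //; first exact: continuous_subspaceT.
  split; first by move=> x _; exact: dg.
  - exact/cvg_at_right_filter/cgg.
  - exact/cvg_at_left_filter/cgg.
by move=> x _; rewrite derive1E.
Qed.

Lemma integral_derive_compact g M : (forall x, M < `|x| -> g x = 0) ->
  (forall x, derivable g x 1) -> continuous ('D_1 g) ->
  (\int[@lebesgue_measure R]_x ('D_1 g x)%:E = 0)%E.
Proof.
move=> g0 dg cg; pose N : R := `|M| + 1.
have N0 : 0 < N by rewrite ltr_wpDl.
have MN : M < N by rewrite (le_lt_trans (ler_norm M))// ltrDl.
transitivity (\int[@lebesgue_measure R]_(x in `[(- N)%R, N]) ('D_1 g x)%:E)%E.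
  rewrite [RHS]integral_mkcond; apply: eq_integral => x _.
  rewrite patchE; case: ifPn => // /negP; rewrite inE /= in_itv/= -ler_norml.
  by move=> /negP; rewrite -ltNge => /(lt_trans MN) /(derive_outside g0) ->.
rewrite FTC_itv//; last by rewrite gtrN.
by rewrite !g0 ?subrr// ?normrN gtr0_norm.
Qed.

Lemma norm_le_integral_derive g M : (forall x, M < `|x| -> g x = 0) ->
  (forall x, derivable g x 1) -> continuous ('D_1 g) -> forall x,
  (`|g x|%:E <= \int[@lebesgue_measure R]_x `|'D_1 g x|%:E)%E.
Proof.
move=> g0 dg cg x; pose N : R := `|M| + `|x| + 1.
have xN : - N < x.
  rewrite ltrNl (le_lt_trans (ler_norm _))// normrN /N.
  by have := normr_ge0 M; lra.
have MN : M < `|- N|.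
  rewrite normrN (lt_le_trans _ (ler_norm _))// /N.
  by have := ler_norm M; have := normr_ge0 x; lra.
have mD (D : set R) : measurable D ->
    measurable_fun D (fun z => ('D_1 g z)%:E).
  by move=> mD; apply/measurable_EFinP; apply: measurable_funTS; exact: continuous_measurable_fun.
have -> : `|g x|%:E =
    `|\int[@lebesgue_measure R]_(x in `[(- N)%R, x]) ('D_1 g x)%:E|%E.
  by rewrite FTC_itv// (g0 (- N))// subr0.
apply: (le_trans (le_abse_integral _ _ _)) => //; first exact: mD.
by apply: ge0_subset_integral => //; apply: measurableT_comp => //; exact: mD.
Qed.

(** Integrate (g^2)' = 2 g g' from outside the support; this is the
one-dimensional ingredient of the inequalities of Ladyzhenskaya. *)
Lemma sqr_le_integral_derive g M : (forall x, M < `|x| -> g x = 0) ->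
  (forall x, derivable g x 1) -> continuous ('D_1 g) -> forall x,
  ((g x ^+ 2)%:E <=
   \int[@lebesgue_measure R]_x (2 * `|g x * 'D_1 g x|)%:E)%E.
Proof.
move=> g0 dg cg x.
have cgg : continuous g.
  by move=> z; apply/differentiable_continuous/derivable1_diffP/dg.
have D2 z : 'D_1 (fun x => g x ^+ 2) z = 2 * (g z * 'D_1 g z).
  have := deriveM (dg z) (dg z).
  rewrite (_ : g * g = fun x => g x ^+ 2); last by apply/funext => t; rewrite expr2.
  by move=> ->; rewrite !/GRing.scale/=; ring.
have := @norm_le_integral_derive (fun x => g x ^+ 2) M _ _ _ x.
rewrite ger0_norm ?sqr_ge0//.
under [X in (_ <= X)%E]eq_integral do rewrite D2 normrM (ger0_norm (ler0n _ 2)).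
apply.
- by move=> z /g0 ->; rewrite expr0n.
- move=> z; have := derivableM (dg z) (dg z).
  by rewrite (_ : g * g = fun x => g x ^+ 2)//; apply/funext => t; rewrite expr2.
- under eq_fun do rewrite D2.
  move=> z; apply: cvgM; first exact: cvg_cst.
  by apply: cvgM; [exact: cgg|exact: cg].
Qed.

End one_dim.

Section compact_C1.
Context (R : realType).

(** Only one direction i is concerned, and the support is confined to a ball:
this is what slices inherit, so that inductions on the dimension go through. *)
Definition C1c n (i : 'I_n) (M : R) (phi : 'rV[R]_n -> R) :=
  [/\ continuous phi, (forall x, M < `|x| -> phi x = 0),
      (forall x, derivable phi x (delta_mx ord0 i)) &
      continuous (partial i phi)].

Lemma partial_outside n (i : 'I_n) M phi : (forall x, M < `|x| -> phi x = 0) ->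
  forall x : 'rV[R]_n, M < `|x| -> partial i phi x = 0.
Proof.
move=> phi0 x Mx; rewrite /partial (@near_eq_derive _ _ _ phi (cst 0))//.
  exact: derive_cst.
have oM : open [set z : 'rV[R]_n | M < `|z|].
  rewrite (_ : [set z | _] = (@Num.Def.normr _ _) @^-1` [set t : R | t > M])//.
  by apply: open_comp => [z _|]; [exact: norm_continuous|exact: open_gt].
by apply: filterS (open_nbhs_nbhs (conj oM Mx)) => z /= /phi0.
Qed.

Section slice.
Context n (phi : 'rV[R]_n.+1 -> R).

Lemma partial_slice0 y a :
  'D_1 (fun a => phi (cons_rV (a, y))) a = partial ord0 phi (cons_rV (a, y)).
Proof.
rewrite /partial /derive; set f1 := (fun _ : R => _); set f2 := (fun _ : R => _).
suff -> : f1 = f2 by []; apply/funext => h; rewrite /f1 /f2 /=.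
by rewrite -cons_rV_shift0 [h *: 1]mulr1.
Qed.

Lemma derivable_slice0 y a :
  derivable phi (cons_rV (a, y)) (delta_mx ord0 ord0) ->
  derivable (fun a => phi (cons_rV (a, y))) a 1.
Proof.
rewrite /derivable; set f1 := (fun _ : R => _); set f2 := (fun _ : R => _).
suff -> : f1 = f2 by []; apply/funext => h; rewrite /f1 /f2 /=.
by rewrite -cons_rV_shift0 [h *: 1]mulr1.
Qed.

Lemma partial_sliceS i a y : partial i (fun y => phi (cons_rV (a, y))) y =
  partial (lift ord0 i) phi (cons_rV (a, y)).
Proof.
rewrite /partial /derive; set f1 := (fun _ : R => _); set f2 := (fun _ : R => _).
suff -> : f1 = f2 by []; apply/funext => h; rewrite /f1 /f2 /=.
by rewrite -cons_rV_shiftS.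
Qed.

Lemma derivable_sliceS i a y :
  derivable phi (cons_rV (a, y)) (delta_mx ord0 (lift ord0 i)) ->
  derivable (fun y => phi (cons_rV (a, y))) y (delta_mx ord0 i).
Proof.
rewrite /derivable; set f1 := (fun _ : R => _); set f2 := (fun _ : R => _).
suff -> : f1 = f2 by []; apply/funext => h; rewrite /f1 /f2 /=.
by rewrite -cons_rV_shiftS.
Qed.

Lemma C1c_slice0 M y : C1c ord0 M phi ->
  let g : R -> R := fun a => phi (cons_rV (a, y)) in
  [/\ continuous g, (forall x, M < `|x| -> g x = 0),
      (forall x, derivable g x 1) & continuous ('D_1 g)].
Proof.
move=> [cphi phi0 dphi cdphi] g; split.
- move=> a; apply: continuous_comp; last exact: cphi.
  exact: cons_rV_continuous1.
- by move=> a Ma; apply: phi0; rewrite (lt_le_trans Ma)// cons_rV_norm_ge1.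
- by move=> a; exact/derivable_slice0/dphi.
- rewrite (_ : 'D_1 g = fun a => partial ord0 phi (cons_rV (a, y))).
    move=> a; apply: continuous_comp; last exact: cdphi.
    exact: cons_rV_continuous1.
  by apply/funext => a; exact: partial_slice0.
Qed.

Lemma C1c_sliceS M i a : C1c (lift ord0 i) M phi ->
  C1c i M (fun y => phi (cons_rV (a, y))).
Proof.
move=> [cphi phi0 dphi cdphi]; split.
- move=> y; apply: continuous_comp; last exact: cphi.
  exact: cons_rV_continuous2.
- by move=> y My; apply: phi0; rewrite (lt_le_trans My)// cons_rV_norm_ge2.
- by move=> y; exact/derivable_sliceS/dphi.
- rewrite (_ : partial _ _ = fun y => partial (lift ord0 i) phi (cons_rV (a, y))).
    move=> y; apply: continuous_comp; last exact: cdphi.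
    exact: cons_rV_continuous2.
  by apply/funext => y; exact: partial_sliceS.
Qed.

End slice.

Lemma itg_C1c n (i : 'I_n) M phi : C1c i M phi ->
  (lebesgue_rV R n).-integrable setT (EFin \o partial i phi).
Proof.
move=> [_ phi0 _ cd]; apply: (@itg_continuous_compact _ _ _ M) => //.
exact: partial_outside.
Qed.

(** Peeling off coordinates by Fubini, one is left with the fundamental theorem
of calculus on lines parallel to the i-th axis. *)
Lemma integral_partial n (i : 'I_n) M phi : C1c i M phi ->
  (\int[lebesgue_rV R n]_x (partial i phi x)%:E = 0)%E.
Proof.
elim: n i M phi => [[]//|n ih i M phi hphi].
have [e1 e2] := integral_rVS (itg_C1c hphi).
case: (unliftP ord0 i) => [j ij|i0]; subst i.
  rewrite [LHS]e1 -[RHS](integral0 (@lebesgue_measure R) setT).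
  apply: eq_integral => a _; rewrite -(ih j M (fun y => phi (cons_rV (a, y)))).
    by apply: eq_integral => y _; rewrite /= partial_sliceS.
  exact: C1c_sliceS.
rewrite [LHS]e2 -[RHS](integral0 (lebesgue_rV R n) setT).
apply: eq_integral => y _; have [? g0 dg cdg] := C1c_slice0 y hphi.
rewrite -(integral_derive_compact g0 dg cdg).
by apply: eq_integral => a _; rewrite /= partial_slice0.
Qed.

End compact_C1.

(** * Smooth functions, test functions and bumps *)

Section smooth_step.
Context (R : realType).
Implicit Types (p q : {poly R}) (t : R).

(** The functions p(1/t) exp(-1/t), extended by 0 to t <= 0.  The whole family is
introduced because it is stable under differentiation ([next_step]), so that one
derivability computation gives smoothness. *)
Definition smooth_step p t : R :=
  if 0 < t then p.[t^-1] * expR (- t^-1) else 0.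

Definition next_step p : {poly R} := 'X^2 * (p - p^`()).

(** From exp(s) >= s^(k+1) / (k+1)! at s = 1 / h. *)
Lemma pow_expR_decay k (h : R) : 0 < h ->
  (h^-1) ^+ k * expR (- h^-1) <= k.+1`!%:R * h.
Proof.
move=> h0; have s0 : 0 <= h^-1 by rewrite invr_ge0 ltW.
have := expR_ge1Dxn k s0; set s := h^-1 => hs.
have F0 : 0 < k.+1`!%:R :> R by rewrite ltr0n fact_gt0.
have {}hs : s ^+ k.+1 <= k.+1`!%:R * expR s.
  rewrite -ler_pdivrMl// mulrC (le_trans _ hs)// lerDr//.
rewrite -(ler_pM2r (expR_gt0 s)) -mulrA -expRD addNr expR0 mulr1.
rewrite -(ler_pM2l (x := s)) ?invr_gt0// -exprS (le_trans hs)//.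
by rewrite le_eqVlt; apply/orP; left; rewrite /s; apply/eqP; field; rewrite gt_eqF.
Qed.

Lemma smooth_step_decay p : exists C, 0 <= C /\
  forall h, `|smooth_step p h| <= C * `|h|.
Proof.
exists (\sum_(k < size p) `|p`_k| * k.+1`!%:R); split.
  by apply: sumr_ge0 => k _; rewrite mulr_ge0.
move=> h; rewrite /smooth_step; case: ifPn => [h0|_]; last first.
  by rewrite normr0 mulr_ge0// sumr_ge0// => k _; rewrite mulr_ge0.
rewrite horner_coef mulr_suml (le_trans (ler_norm_sum _ _ _))// mulr_suml.
apply: ler_sum => k _; rewrite -!mulrA normrM ler_wpM2l//.
rewrite (gtr0_norm h0) ger0_norm; first exact: pow_expR_decay.
by rewrite mulr_ge0 ?expR_ge0// exprn_ge0// invr_ge0 ltW.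
Qed.

(** At the origin the difference quotient of the function attached to p is the
function attached to X p, which tends to 0 by [smooth_step_decay]. *)
Lemma is_derive_smooth_step p t :
  is_derive t 1 (smooth_step p) (smooth_step (next_step p) t).
Proof.
have [t0|t0|t0] := ltrgtP t 0.
- have -> : smooth_step (next_step p) t = 0.
    by rewrite /smooth_step ltNge (ltW t0).
  apply: (near_eq_is_derive (f := cst 0)).
  have := lt_nbhsl t0; apply: filterS => z z0.
  by rewrite /smooth_step /= ltNge (ltW z0).
- pose g := (fun y : R => y^-1).
  have dg : is_derive t 1 g (- t ^- 2).
    apply: DeriveDef; first by apply: (@derivableV _ _ id); rewrite ?gt_eqF.
    rewrite (@deriveV _ _ id) ?gt_eqF// derive_id.
    by rewrite /GRing.scale /= mulr1.
  have d1 : is_derive t 1 (horner p \o g) (p^`().[g t] * (- t ^- 2)).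
    exact: is_derive1_comp.
  have dNg : is_derive t 1 (- g) (- - t ^- 2) by exact: is_deriveN.
  have d2 : is_derive t 1 (expR \o (- g)) (expR ((- g) t) * (- - t ^- 2)).
    exact: is_derive1_comp.
  have d3 := is_deriveM d1 d2.
  apply: (near_eq_is_derive (f := (horner p \o g) * (expR \o (- g)))).
    have := lt_nbhsr t0; apply: filterS => z z0.
    by rewrite /smooth_step z0.
  apply: (is_derive_eq d3); rewrite /smooth_step t0 /next_step.
  rewrite hornerM hornerXn hornerD hornerN /GRing.scale /= !fctE /g exprVn.
  ring.
- have -> : smooth_step (next_step p) t = 0 by rewrite /smooth_step t0 ltxx.
  rewrite t0.
  have [C [C0 hC]] := smooth_step_decay ('X * p).
  have S0 : smooth_step p 0 = 0 by rewrite /smooth_step ltxx.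
  have lim0 : (fun h : R => h^-1 *: ((smooth_step p \o shift 0) (h *: 1) -
      smooth_step p 0)) @ 0^' --> (0 : R).
    rewrite S0; apply/cvgrPdist_lt => e e0.
    have e1 : 0 < e / (C + 1) by rewrite divr_gt0// ltr_wpDl.
    have : nbhs (0 : R) (ball 0 (e / (C + 1))) by exact: nbhsx_ballx.
    move=> /nbhs_dnbhs; apply: filterS => h /= hb.
    rewrite sub0r normrN subr0 addr0 [h *: 1]mulr1.
    have -> : h^-1 *: smooth_step p h = smooth_step ('X * p) h.
      rewrite /smooth_step; case: ifPn => h0; last by rewrite scaler0.
      by rewrite hornerM hornerX /GRing.scale /=; ring.
    apply: (le_lt_trans (hC h)).
    move: hb; rewrite /ball /= sub0r normrN ltr_pdivlMr ?ltr_wpDl// => hb.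
    apply: le_lt_trans hb; rewrite mulrC ler_wpM2l// lerDl//.
  apply: DeriveDef; first by apply/cvg_ex; exists 0.
  exact: cvg_lim.
Qed.

Lemma smooth_step_continuous p : continuous (smooth_step p).
Proof.
move=> t; apply/differentiable_continuous/derivable1_diffP.
by have [] := is_derive_smooth_step p t.
Qed.

End smooth_step.

Section Ck_theory.
Context (R : realType) (d : nat).
Implicit Types phi psi : 'rV[R]_d -> R.

Lemma CkS k phi : Ck k.+1 phi -> Ck k phi.
Proof.
elim: k phi => [|k ih] phi; first by case.
move=> [cphi h]; split => // i; have [dphi h'] := h i; split => //.
exact: ih.
Qed.

Lemma partialD i phi psi : (forall x, derivable phi x (delta_mx ord0 i)) ->
  (forall x, derivable psi x (delta_mx ord0 i)) ->
  partial i (fun x => phi x + psi x) = fun x => partial i phi x + partial i psi x.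
Proof.
move=> dphi dpsi; apply/funext => x.
exact: (deriveD (dphi x) (dpsi x)).
Qed.

Lemma partialZ i c phi : (forall x, derivable phi x (delta_mx ord0 i)) ->
  partial i (fun x => c * phi x) = fun x => c * partial i phi x.
Proof. by move=> dphi; apply/funext => x; exact: (deriveZ c (dphi x)). Qed.

Lemma partialM i phi psi : (forall x, derivable phi x (delta_mx ord0 i)) ->
  (forall x, derivable psi x (delta_mx ord0 i)) ->
  partial i (fun x => phi x * psi x) =
  fun x => phi x * partial i psi x + psi x * partial i phi x.
Proof.
move=> dphi dpsi; apply/funext => x.
exact: (deriveM (dphi x) (dpsi x)).
Qed.

Lemma CkD k phi psi : Ck k phi -> Ck k psi -> Ck k (fun x => phi x + psi x).
Proof.
elim: k phi psi => [|k ih] phi psi.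
  by move=> cphi cpsi x; exact: (cvgD (cphi x) (cpsi x)).
move=> [cphi hphi] [cpsi hpsi]; split.
  by move=> x; exact: (cvgD (cphi x) (cpsi x)).
move=> i; have [dphi h1] := hphi i; have [dpsi h2] := hpsi i; split.
  by move=> x; exact: (derivableD (dphi x) (dpsi x)).
by rewrite partialD//; exact: ih.
Qed.

Lemma CkZ k c phi : Ck k phi -> Ck k (fun x => c * phi x).
Proof.
elim: k phi => [|k ih] phi.
  by move=> cphi x; exact: (cvgM (cvg_cst c) (cphi x)).
move=> [cphi hphi]; split.
  by move=> x; exact: (cvgM (cvg_cst c) (cphi x)).
move=> i; have [dphi h1] := hphi i; split.
  by move=> x; exact: (@derivableZ _ _ _ phi c x _ (dphi x)).
by rewrite partialZ//; exact: ih.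
Qed.

Lemma CkM k phi psi : Ck k phi -> Ck k psi -> Ck k (fun x => phi x * psi x).
Proof.
elim: k phi psi => [|k ih] phi psi.
  by move=> cphi cpsi x; exact: (cvgM (cphi x) (cpsi x)).
move=> hphi' hpsi'; have [cphi hphi] := hphi'; have [cpsi hpsi] := hpsi'; split.
  by move=> x; exact: (cvgM (cphi x) (cpsi x)).
move=> i; have [dphi h1] := hphi i; have [dpsi h2] := hpsi i; split.
  by move=> x; exact: (derivableM (dphi x) (dpsi x)).
rewrite partialM//; apply: CkD; apply: ih.
- exact: (CkS hphi').
- exact: h2.
- exact: (CkS hpsi').
- exact: h1.
Qed.

Lemma Ck_cst k (c : R) : Ck k (fun _ : 'rV[R]_d => c).
Proof.
elim: k c => [|k ih] c; first exact: cst_continuous.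
split; first exact: cst_continuous.
move=> i; split; first by move=> x; exact: derivable_cst.
rewrite (_ : partial i _ = fun=> 0); first exact: ih.
by apply/funext => x; exact: derive_cst.
Qed.

Lemma Ck_prod k I (r : seq I) (F : I -> 'rV[R]_d -> R) :
  (forall i, Ck k (F i)) -> Ck k (fun x => \prod_(i <- r) F i x).
Proof.
move=> h; elim: r => [|i r ih].
  have -> : (fun x => \prod_(i <- [::]) F i x) = fun=> 1.
    by apply/funext => x; rewrite big_nil.
  exact: Ck_cst.
have -> : (fun x => \prod_(j <- i :: r) F j x) =
    fun x => F i x * \prod_(j <- r) F j x.
  by apply/funext => x; rewrite big_cons.
exact: CkM.
Qed.

(** A function of a single coordinate moves only in that direction.  This
reduces partial derivatives of bumps to one-variable ones. *)
Lemma is_derive_ridge (g : R -> R) (c e : R) (i j : 'I_d) (x : 'rV[R]_d) df :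
  is_derive (c * x ord0 i + e) 1 g df ->
  is_derive x (delta_mx ord0 j) (fun x => g (c * x ord0 i + e))
    (c * (i == j)%:R * df).
Proof.
move=> dg; set c' := c * (i == j)%:R.
pose l : R -> R := fun h => c' * h + (c * x ord0 i + e).
have dl : is_derive (0 : R) 1 l c'.
  have -> : l = (c' \*: @idfun R) + cst (c * x ord0 i + e).
    by apply/funext => h.
  apply: is_derive_eq; rewrite addr0 /GRing.scale /=; ring.
have dg' : is_derive (l 0) 1 g df by rewrite /l mulr0 add0r.
have := is_derive1_comp dg' dl; rewrite mulrC.
have key h : (fun x : 'rV[R]_d => g (c * x ord0 i + e)) (h *: delta_mx ord0 j + x) =
    (g \o l) h.
  rewrite /l /c' /= !mxE eqxx /= eq_sym; congr g.
  by case: (i == j); rewrite ?mulr1 ?mulr0 /=; ring.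
have qeq : (fun h : R => h^-1 *: (((fun x : 'rV[R]_d => g (c * x ord0 i + e)) \o shift x)
      (h *: delta_mx ord0 j) - (fun x : 'rV[R]_d => g (c * x ord0 i + e)) x)) =
    (fun h => h^-1 *: (((g \o l) \o shift 0) (h *: 1) - (g \o l) 0)).
  apply/funext => h /=; rewrite key addr0 [h *: 1]mulr1.
  by congr (_ *: (_ - _)); rewrite /= /l mulr0 add0r.
move=> [dc dv]; apply: DeriveDef.
  by rewrite /derivable qeq.
by rewrite /derive qeq.
Qed.

Lemma Ck_smooth_step k p c e i :
  Ck k (fun x : 'rV[R]_d => smooth_step p (c * x ord0 i + e)).
Proof.
have cont q : continuous (fun x : 'rV[R]_d => smooth_step q (c * x ord0 i + e)).
  move=> x; apply: (@continuous_comp _ _ _ (fun x : 'rV[R]_d => c * x ord0 i + e)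
    (smooth_step q)); last exact: smooth_step_continuous.
  exact: (cvgD (cvgM (cvg_cst c) (@coord_continuous _ _ _ ord0 i x)) (cvg_cst e)).
elim: k p => [|k ih] p; first exact: cont.
split; first exact: cont.
move=> j; split.
  by move=> x; have [] := is_derive_ridge j (is_derive_smooth_step p (c * x ord0 i + e)).
rewrite (_ : partial j _ = fun x =>
    c * (i == j)%:R * smooth_step (next_step p) (c * x ord0 i + e)).
  exact: CkZ.
apply/funext => x.
by have [] := is_derive_ridge j (is_derive_smooth_step p (c * x ord0 i + e)).
Qed.

End Ck_theory.

Section test_functions.
Context (R : realType) (d : nat) (Omega : set 'rV[R]_d).
Implicit Types phi psi : 'rV[R]_d -> R.

(** Some compact set off which phi vanishes, instead of the closure of the
non-zero set: this form is stable under sums, products and derivatives. *)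
Lemma test_functionP phi : test_function Omega phi <->
  (forall k, Ck k phi) /\ exists K, [/\ compact K, K `<=` Omega &
    forall x, ~ K x -> phi x = 0].
Proof.
split=> [[Cphi cK KO]|[Cphi [K [cK KO K0]]]].
  split => //; exists (closure [set x | phi x != 0]); split => // x nK.
  apply/eqP; apply: contra_notT nK => phix; exact: subset_closure.
have sK : closure [set x | phi x != 0] `<=` K.
  rewrite [X in _ `<=` X](closure_id K).1; last first.
    by apply: compact_closed => //; exact: norm_hausdorff.
  apply: closureS => x /= phix; apply: contrapT => /K0 phi0.
  by rewrite phi0 eqxx in phix.
split => //; last exact: subset_trans KO.
exact: subclosed_compact (@closed_closure _ _) cK sK.
Qed.

Lemma test_functionD phi psi : test_function Omega phi ->
  test_function Omega psi -> test_function Omega (fun x => phi x + psi x).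
Proof.
move=> /test_functionP[C1 [K1 [c1 s1 z1]]] /test_functionP[C2 [K2 [c2 s2 z2]]].
apply/test_functionP; split=> [k|]; first exact: CkD.
exists (K1 `|` K2); split; first exact: compactU.
  by rewrite subUset.
by move=> x /not_orP[n1 n2]; rewrite z1// z2// addr0.
Qed.

Lemma test_functionZ c phi : test_function Omega phi ->
  test_function Omega (fun x => c * phi x).
Proof.
move=> /test_functionP[C1 [K1 [c1 s1 z1]]].
apply/test_functionP; split=> [k|]; first exact: CkZ.
by exists K1; split => // x /z1 ->; rewrite mulr0.
Qed.

Lemma test_functionM phi psi : (forall k, Ck k phi) ->
  test_function Omega psi -> test_function Omega (fun x => phi x * psi x).
Proof.
move=> C1 /test_functionP[C2 [K2 [c2 s2 z2]]].
apply/test_functionP; split=> [k|]; first exact: CkM.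
by exists K2; split => // x /z2 ->; rewrite mulr0.
Qed.

Lemma test_function0 : test_function Omega (fun=> 0).
Proof.
apply/test_functionP; split=> [k|]; first exact: Ck_cst.
exists set0; split => //; exact: compact0.
Qed.

Lemma test_function_Ck k phi : test_function Omega phi -> Ck k phi.
Proof. by case. Qed.

Lemma test_function_outside phi x : test_function Omega phi -> ~ Omega x ->
  phi x = 0.
Proof. by move=> /test_functionP[_ [K [_ KO K0]]] nO; apply: K0 => /KO. Qed.

Lemma test_function_partial i phi : test_function Omega phi ->
  test_function Omega (partial i phi).
Proof.
move=> /test_functionP[C1 [K [c1 s1 z1]]].
apply/test_functionP; split=> [k|]; first by have [_ /(_ i)[]] := C1 k.+1.
exists K; split => // x nKx.
rewrite /partial (@near_eq_derive _ _ _ phi (cst 0)); first exact: derive_cst.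
have oK : open (~` K).
  by apply: closed_openC; apply: compact_closed c1; exact: norm_hausdorff.
by apply: filterS (open_nbhs_nbhs (conj oK nKx)) => z /= /z1.
Qed.

Lemma test_function_C1c phi : test_function Omega phi ->
  exists M, forall i, C1c i M phi.
Proof.
move=> /test_functionP[C1 [K [c1 s1 z1]]].
have [M [_ hM]] := compact_bounded c1.
have [cphi h] := C1 1%N.
exists (M + 1) => i; have [dphi cd] := h i; split => // x Mx.
apply: z1 => Kx; have M1 : M < M + 1 by rewrite ltrDl.
by have := hM _ M1 x Kx; rewrite /= leNgt Mx.
Qed.

Lemma test_function_derivable phi i x : test_function Omega phi ->
  derivable phi x (delta_mx ord0 i).
Proof. by move=> [C1 _ _]; have [_ /(_ i)[]] := C1 1%N. Qed.

Lemma itg_test phi : test_function Omega phi ->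
  (lebesgue_rV R d).-integrable setT (EFin \o phi).
Proof.
move=> tphi; have [cphi _] := test_function_Ck 1 tphi.
have /test_functionP[_ [K [cK _ K0]]] := tphi.
have [M [_ hM]] := compact_bounded cK.
apply: (@itg_continuous_compact _ _ _ (M + 1)) => // x Mx.
apply: K0 => Kx; have M1 : M < M + 1 by rewrite ltrDl.
by have := hM _ M1 x Kx; rewrite /= leNgt Mx.
Qed.

Lemma integral_testT phi : test_function Omega phi ->
  (\int[lebesgue_rV R d]_(x in Omega) (phi x)%:E =
   \int[lebesgue_rV R d]_x (phi x)%:E)%E.
Proof.
move=> tphi; rewrite [LHS]integral_mkcond; apply: eq_integral => x _.
rewrite patchE; case: ifPn => // /negP; rewrite inE => nO.
by rewrite (test_function_outside tphi nO).
Qed.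

Lemma integral_partial_test phi i : test_function Omega phi ->
  \int[lebesgue_rV R d]_(x in Omega) partial i phi x = 0.
Proof.
move=> tphi; have [M /(_ i) C1] := test_function_C1c tphi.
rewrite /Rintegral integral_testT; last exact: test_function_partial.
by rewrite (integral_partial C1).
Qed.

Hypothesis mO : measurable Omega.

Lemma L2_test phi : test_function Omega phi -> L2 Omega phi.
Proof.
move=> tphi; have [cphi _] := test_function_Ck 1 tphi; split.
  by apply: measurable_funTS; exact: continuous_rV_measurable.
apply: (@integrableS _ _ _ _ setT) => //.
have := itg_test (test_functionM (fun k => test_function_Ck k tphi) tphi).
by apply: eq_integrable => // x _ /=; rewrite expr2.
Qed.

Lemma test_weak_partial i phi : test_function Omega phi ->
  is_weak_partial Omega i phi (partial i phi).
Proof.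
move=> tphi; have tdphi := test_function_partial i tphi.
split; first exact: L2_test.
move=> psi tpsi; have tdpsi := test_function_partial i tpsi.
have i1 := L2_mul mO (L2_test tphi) (L2_test tdpsi).
have i2 := L2_mul mO (L2_test tdphi) (L2_test tpsi).
apply/eqP; rewrite -addr_eq0 -RintegralD//; apply/eqP.
rewrite -[RHS](integral_partial_test i
  (test_functionM (fun k => test_function_Ck k tphi) tpsi)).
rewrite partialM; [|by move=> x; exact: test_function_derivable..].
by apply: eq_Rintegral => x _; rewrite [partial i phi x * _]mulrC.
Qed.

End test_functions.

Section bump.
Context (R : realType) (d : nat).
Implicit Types (a b : 'I_d -> R) (x : 'rV[R]_d).

Definition open_box a b : set 'rV[R]_d :=
  [set x | forall i, `]a i, b i[%classic (x ord0 i)].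

Definition closed_box a b : set 'rV[R]_d :=
  [set x | forall i, `[a i, b i]%classic (x ord0 i)].

(** As m grows these functions converge to the indicator of the open box, while
their supports stay in the closed one. *)
Definition bump a b (m : nat) x : R :=
  \prod_(i < d) (smooth_step 1 (m.+1%:R * x ord0 i + - (m.+1%:R * a i)) *
                 smooth_step 1 (- m.+1%:R * x ord0 i + m.+1%:R * b i)).

Lemma smooth_step1_ge0 t : 0 <= smooth_step 1 t :> R.
Proof.
by rewrite /smooth_step; case: ifPn => // _; rewrite hornerC mul1r expR_ge0.
Qed.

Lemma smooth_step1_le1 t : smooth_step 1 t <= 1 :> R.
Proof.
rewrite /smooth_step; case: ifPn => // t0; rewrite hornerC mul1r.
by rewrite -expR0 ler_expR oppr_le0 invr_ge0 ltW.
Qed.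

Lemma smooth_step1_cvg (s : R) : 0 < s ->
  (fun m => smooth_step 1 (m.+1%:R * s)) @ \oo --> (1 : R).
Proof.
move=> s0.
rewrite (_ : (fun m : nat => _) = expR \o (fun m : nat => - (s^-1 * harmonic m))).
  rewrite -[X in _ --> X]expR0; apply: (@cvg_comp _ _ _ _ expR); last exact: continuous_expR.
  rewrite -oppr0; apply: cvgN; rewrite -(mulr0 s^-1).
  by apply: cvgM; [exact: (cvg_cst _)|exact: cvg_harmonic].
apply/funext => m; rewrite /smooth_step mulr_gt0//= hornerC mul1r.
by rewrite invfM mulrC.
Qed.

Lemma bump_ge0 a b m x : 0 <= bump a b m x.
Proof. by apply: prodr_ge0 => i _; rewrite mulr_ge0 ?smooth_step1_ge0. Qed.

Lemma bump_le1 a b m x : bump a b m x <= 1.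
Proof.
apply: prodr_ile1 => i _; rewrite mulr_ge0 ?smooth_step1_ge0//=.
by apply: mulr_ile1; rewrite ?smooth_step1_ge0 ?smooth_step1_le1.
Qed.

Lemma bump_outside a b m x : ~ open_box a b x -> bump a b m x = 0.
Proof.
move=> /existsNP[i xi]; rewrite /bump (bigD1 i)//=; apply/eqP.
rewrite mulf_eq0; apply/orP; left; rewrite mulf_eq0 /smooth_step.
rewrite -mulrBr (_ : - _ * _ + _ = m.+1%:R * (b i - x ord0 i)); last by ring.
rewrite !pmulr_rgt0// !subr_gt0.
case: ifPn => h1; last by rewrite eqxx.
by case: ifPn => h2; rewrite ?eqxx ?orbT//; exfalso; apply: xi; rewrite /= in_itv/= h1 h2.
Qed.

Lemma bump_cvg a b x : open_box a b x -> bump a b ^~ x @ \oo --> (1 : R).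
Proof.
move=> xab; rewrite /bump.
elim: (index_enum _) => [|i r ih].
  rewrite (_ : (fun m : nat => _) = fun=> 1); first exact: (cvg_cst _).
  by apply/funext => m; rewrite big_nil.
have := xab i; rewrite /= in_itv/= => /andP[h1 h2].
have c1 : (fun m => smooth_step 1 (m.+1%:R * x ord0 i + - (m.+1%:R * a i))) @ \oo
    --> (1 : R).
  under eq_fun do rewrite -mulrBr.
  by apply: smooth_step1_cvg; rewrite subr_gt0.
have c2 : (fun m => smooth_step 1 (- m.+1%:R * x ord0 i + m.+1%:R * b i)) @ \oo
    --> (1 : R).
  under eq_fun do rewrite mulNr addrC -mulrBr.
  by apply: smooth_step1_cvg; rewrite subr_gt0.
have := cvgM (cvgM c1 c2) ih; rewrite !mulr1.
suff E : forall u v : R^nat, u = v -> u @ \oo --> (1 : R) -> v @ \oo --> (1 : R).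
  by move=> h; apply: (E _ _ _ (h _ _)); apply/funext => m; rewrite big_cons.
by move=> u v ->.
Qed.

Lemma test_bump (Omega : set 'rV[R]_d) a b m : closed_box a b `<=` Omega ->
  test_function Omega (bump a b m).
Proof.
move=> sub; apply/test_functionP; split.
  by move=> k; apply: Ck_prod => i; apply: CkM; exact: Ck_smooth_step.
exists (closed_box a b); split => //.
  apply: (@rV_compact _ _ (fun i => `[a i, b i]%classic)) => i.
  exact: segment_compact.
move=> x nx; apply: bump_outside => xab; apply: nx => i.
exact/subset_itv_oo_cc/xab.
Qed.

Definition open_boxes : set (set 'rV[R]_d) :=
  [set A | exists ab, A = open_box ab.1 ab.2].

Lemma open_boxI a b a' b' : open_box a b `&` open_box a' b' =
  open_box (fun i => Num.max (a i) (a' i)) (fun i => Num.min (b i) (b' i)).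
Proof.
apply/seteqP; split => [x [h h'] i|x h].
  have := h i; have := h' i; rewrite /= !in_itv/= gt_max lt_min.
  by move=> /andP[-> ->] /andP[-> ->].
by split => i; have := h i; rewrite /= !in_itv/= gt_max lt_min;
  case/andP => /andP[? ?] /andP[? ?]; apply/andP.
Qed.

Lemma open_boxes_setI : setI_closed open_boxes.
Proof.
move=> _ _ [[a b] ->] [[a' b'] ->]; rewrite open_boxI.
by eexists (_, _).
Qed.

Lemma measurable_open_box a b : measurable (open_box a b).
Proof.
by apply: (@measurable_rV_box _ _ (fun i => `]a i, b i[%classic)) => i.
Qed.

(** Open boxes are stable under intersection, so that Dynkin's lemma reduces
statements about Borel sets to them. *)
Lemma measurable_open_boxesE :
  @measurable _ 'rV[R]_d = <<s open_boxes >>.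
Proof.
apply/seteqP; split; last first.
  apply: smallest_sub; first exact: sigma_algebra_measurable.
  by move=> _ [[a b] ->]; exact: measurable_open_box.
pose T := g_sigma_algebraType open_boxes.
suff mid : measurable_fun [set: T] (idfun : T -> 'rV[R]_d).
  by move=> A mA; have := mid measurableT A mA; rewrite setTI.
apply: measurable_fun_rVP => i.
apply: (measurability _ (RGenOpens.measurableE R)).
move=> _ [_ [l [r ->] <-]]; rewrite setTI.
rewrite (_ : _ @^-1` _ = \bigcup_N open_box
    (fun j => if j == i then l else - N%:R) (fun j => if j == i then r else N%:R)).
  apply: (@bigcup_measurable _ T) => N _; apply: sub_sigma_algebra.
  by eexists (_, _).
apply/seteqP; split => [x /= xlr|x [N _] /(_ i)]; last by rewrite eqxx.
exists (Num.truncn `|x|).+1 => // j; case: eqP => [->//|_].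
rewrite /= in_itv/= -ltr_norml (le_lt_trans (rV_coord_le _ _))//.
exact: truncnS_gt.
Qed.

End bump.

(** * The fundamental lemma of the calculus of variations *)

Section fundamental_lemma.
Context (R : realType) (d : nat) (Omega : set 'rV[R]_d).
Hypothesis mO : measurable Omega.
Hypothesis fO : (lebesgue_rV R d Omega < +oo)%E.
Let leb := @lebesgue_rV R d.

Lemma L2_cst (c : R) : L2 Omega (fun=> c).
Proof.
split => //; apply: measurable_bounded_integrable => //.
by exists (c ^+ 2); split; [exact: num_real|move=> y hy x _ /=; rewrite ger0_norm ?sqr_ge0// ltW].
Qed.

Lemma itg_L2 f : L2 Omega f -> leb.-integrable Omega (EFin \o f).
Proof.
move=> hf; have := L2_mul mO hf (L2_cst 1).
by apply: eq_integrable => // x _ /=; rewrite mulr1.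
Qed.

(** Dominated convergence along the bumps. *)
Lemma integral_box0 f a b : L2 Omega f -> closed_box a b `<=` Omega ->
  (forall phi, test_function Omega phi ->
     \int[leb]_(x in Omega) (f x * phi x) = 0) ->
  (\int[leb]_(x in open_box a b) (f x)%:E = 0)%E.
Proof.
move=> hf sub f0; have mf := hf.1.
have tb m := test_bump m sub.
have ioc : open_box a b `<=` closed_box a b.
  by move=> x h i; exact/subset_itv_oo_cc/h.
have -> : open_box a b = Omega `&` open_box a b.
  by rewrite setIC; apply/esym/setIidPl; exact: subset_trans sub.
rewrite integral_mkcondr.
have [||||| _ _] := @dominated_convergence _ _ _ leb Omega mO
  (fun m x => (f x * bump a b m x)%:E) ((EFin \o f) \_ (open_box a b))
  (EFin \o (fun x => `|f x|)).
- move=> m; apply/measurable_EFinP; apply: measurable_funM => //.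
  exact: (L2_test mO (tb m)).1.
- apply/measurable_restrict => //; first exact: measurable_open_box.
  by apply: (measurable_funS mO) => //; exact/measurable_EFinP.
- apply: aeW => x Ox; rewrite patchE; case: ifPn; rewrite ?inE ?notin_setE => xab.
    apply: cvg_EFin; first exact: nearW.
    have := cvgM (cvg_cst (f x)) (bump_cvg xab); rewrite mulr1; exact.
  under eq_fun do rewrite bump_outside// mulr0.
  exact: (cvg_cst _).
- exact: integrable_norm (itg_L2 hf).
- apply: aeW => x m Ox /=; rewrite lee_fin normrM ler_piMr//.
  by rewrite ger0_norm ?bump_ge0// bump_le1.
rewrite [X in X @ _ --> _](_ : _ = fun=> 0%E); last first.
  apply/funext => m /=; rewrite -[LHS]fineK; first by rewrite [fine _](f0 _ (tb m)).
  exact: integrable_fin_num (L2_mul mO hf (L2_test mO (tb m))).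
move=> h; apply/esym; apply: cvg_unique h => //; exact: (cvg_cst _).
Qed.

(** On a cube whose closure is in Omega, the integral of f vanishes on open boxes,
hence on all Borel subsets by Dynkin's lemma, so that f = 0 almost everywhere on
the cube; countably many such cubes cover Omega. *)
Lemma fundamental_lemma f : open Omega -> L2 Omega f ->
  (forall phi, test_function Omega phi ->
     \int[leb]_(x in Omega) (f x * phi x) = 0) ->
  ae_zero Omega f.
Proof.
move=> oO hf f0; have mf := hf.1.
have itf := itg_L2 hf.
pose lo (qk : 'rV[rat]_d * nat) i := @rat_center R d qk ord0 i - qk.2.+1%:R^-1.
pose hi (qk : 'rV[rat]_d * nat) i := @rat_center R d qk ord0 i + qk.2.+1%:R^-1.
have boxE qk : @rat_box R d qk = open_box (lo qk) (hi qk).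
  apply/seteqP; split=> x h i; have := h i;
  by rewrite /= in_itv/= ltr_distlC.
have local0 qk : closed_box (lo qk) (hi qk) `<=` Omega ->
    {ae leb, forall x, @rat_box R d qk x -> f x = 0}.
  move=> sub; rewrite boxE.
  set B := open_box _ _.
  have mB : measurable B by exact: measurable_open_box.
  have BO : B `<=` Omega.
    by apply: subset_trans sub => x h i; exact/subset_itv_oo_cc/h.
  have itB : leb.-integrable B (EFin \o f) by exact: integrableS itf.
  suff H : ae_eq leb B (EFin \o f) (cst 0%E).
    by apply: filterS H => x /= h /h [].
  apply: integral_ae_eq => // A AB mA; rewrite integral0.
  suff : (\int[leb]_(x in A `&` B) (f x)%:E = 0)%E by have -> : A `&` B = A by exact/setIidPl.
  have : <<s @open_boxes R d >> A by rewrite -measurable_open_boxesE.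
  have itSB S : measurable S -> leb.-integrable (S `&` B) (EFin \o f).
    by move=> mS; apply: integrableS itB => //; exact: measurableI.
  move: A {AB mA}.
  apply: (@dynkin_induction _ 'rV[R]_d _
    (fun A => \int[leb]_(x in A `&` B) (f x)%:E = 0)%E).
  - exact: measurable_open_boxesE.
  - exact: open_boxes_setI.
  - by rewrite setTI; exact: integral_box0.
  - move=> _ [[a b] ->]; rewrite open_boxI; apply: integral_box0 => //.
    apply: subset_trans sub => x h i; have := h i.
    by rewrite /= !in_itv/= ge_max le_min => /andP[/andP[_ ->] /andP[_ ->]].
  - move=> S mS iS.
    have := @integral_setU_EFin _ _ _ leb (S `&` B) (~` S `&` B) f.
    rewrite -setIUl setUv setTI iS add0e => <-//.
    + exact: integral_box0.
    + exact: measurableI.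
    + by apply: measurableI => //; exact: measurableC.
    + exact: (measurable_funS mO).
    + by apply/disj_set2P; rewrite setIACA setICr set0I.
  - move=> F mF tF F0; rewrite setI_bigcupl integral_bigcup.
    + by apply: eseries0 => i _ _; exact: F0.
    + exact: trivIset_setIr.
    + by move=> k; exact: measurableI.
    + by rewrite -setI_bigcupl; apply: itSB; exact: bigcup_measurable.
pose P (qk : 'rV[rat]_d * nat) x :=
  closed_box (lo qk) (hi qk) `<=` Omega -> @rat_box R d qk x -> f x = 0.
have aeP : {ae leb, forall x, forall n : nat,
    if unpickle n is Some qk then P qk x else True}.
  apply: ae_foralln => n; case: unpickle => [qk|]; last exact: aeW.
  have [sub|nsub] := pselect (closed_box (lo qk) (hi qk) `<=` Omega).
    by apply: filterS (local0 _ sub) => x h _.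
  by apply: aeW => x /nsub.
apply: filterS aeP => x h Ox.
have [qk [xqk qkO]] := rat_box_basis oO Ox.
have := h (pickle qk); rewrite pickleK; apply => //.
move=> y yqk; apply: qkO => i; have := yqk i.
by rewrite /= in_itv/= ler_distlC.
Qed.

End fundamental_lemma.

(** * Weak derivatives, H^1_0 and the inequality of Poincare *)

Lemma sum_sqr_le (R : realType) I (r : seq I) (b : I -> R) :
  (forall k, 0 <= b k) ->
  \sum_(k <- r) b k ^+ 2 <= (\sum_(k <- r) b k) ^+ 2.
Proof.
move=> b0; elim: r => [|k r ih]; first by rewrite !big_nil expr0n.
have s0 : 0 <= \sum_(j <- r) b j by apply: sumr_ge0.
rewrite !big_cons; move: ih s0 (b0 k).
set s := \sum_(j <- r) b j; set t := \sum_(j <- r) _; nra.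
Qed.

Section weak_derivatives.
Context (R : realType) (d : nat) (Omega : set 'rV[R]_d) (M : R).
Hypothesis oO : open Omega.
Hypothesis bO : forall x, Omega x -> `|x| <= M.
Let E := 'rV[R]_d.
Let leb := @lebesgue_rV R d.
Implicit Types (u v w g phi : E -> R) (i : 'I_d).

Let mO : measurable Omega. Proof. exact: open_rV_measurable. Qed.
Let fO : (leb Omega < +oo)%E. Proof. exact: lebesgue_rV_bounded mO bO. Qed.

(** What makes the chosen representative [weak_partial] computable, up to
almost everywhere equality. *)
Lemma weak_partial_unique i v g g' : is_weak_partial Omega i v g ->
  is_weak_partial Omega i v g' -> ae_eq leb Omega g g'.
Proof.
move=> [hg eg] [hg' eg'].
have hB := L2B mO hg hg'.
have : ae_zero Omega (fun x => g x - g' x).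
  apply: (fundamental_lemma mO fO oO hB) => phi tphi.
  have tL := L2_test mO tphi.
  have -> : \int[leb]_(x in Omega) ((g x - g' x) * phi x) =
      \int[leb]_(x in Omega) (g x * phi x - g' x * phi x).
    by apply: eq_Rintegral => x _; rewrite mulrBl.
  rewrite RintegralB ?(L2_mul mO)//.
  by apply/eqP; rewrite subr_eq0 -eqr_opp -eg// -eg'.
by apply: filterS => x h Ox; apply/eqP; rewrite -subr_eq0; apply/eqP/h.
Qed.

Lemma weak_partialP i v : H1 Omega v ->
  is_weak_partial Omega i v (weak_partial Omega i v).
Proof. by move=> [_ /(_ i) h]; exact: (xgetPex (fun=> 0) h). Qed.

Lemma is_weak_partial_lin i u v g g' c : L2 Omega u -> L2 Omega v ->
  is_weak_partial Omega i u g -> is_weak_partial Omega i v g' ->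
  is_weak_partial Omega i (fun x => u x + c * v x) (fun x => g x + c * g' x).
Proof.
move=> hu hv [hg eg] [hg' eg']; split; first exact/(L2D mO hg)/L2Z.
move=> phi tphi.
have tL := L2_test mO tphi.
have tdL := L2_test mO (test_function_partial i tphi).
have -> : \int[leb]_(x in Omega) ((u x + c * v x) * partial i phi x) =
    \int[leb]_(x in Omega) (u x * partial i phi x + c * (v x * partial i phi x)).
  by apply: eq_Rintegral => x _; ring.
have -> : \int[leb]_(x in Omega) ((g x + c * g' x) * phi x) =
    \int[leb]_(x in Omega) (g x * phi x + c * (g' x * phi x)).
  by apply: eq_Rintegral => x _; ring.
have i1 := L2_mul mO hu tdL; have i2 := L2_mul mO hv tdL.
have i3 := L2_mul mO hg tL; have i4 := L2_mul mO hg' tL.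
rewrite !RintegralD//; [|exact: (itgZ mO)..].
by rewrite !RintegralZl// eg// eg'//; ring.
Qed.

Lemma L2_weak_partial i v : H1 Omega v -> L2 Omega (weak_partial Omega i v).
Proof. by move=> /(weak_partialP i)[]. Qed.

Lemma H1_lin u v c : H1 Omega u -> H1 Omega v -> H1 Omega (fun x => u x + c * v x).
Proof.
move=> hu hv; split; first exact/(L2D mO hu.1)/(L2Z mO)/hv.1.
move=> i; eexists; apply: is_weak_partial_lin; [exact: hu.1|exact: hv.1| |].
- exact: weak_partialP.
- exact: weak_partialP.
Qed.

Lemma weak_partial_lin i u v c : H1 Omega u -> H1 Omega v ->
  ae_eq leb Omega (weak_partial Omega i (fun x => u x + c * v x))
    (fun x => weak_partial Omega i u x + c * weak_partial Omega i v x).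
Proof.
move=> hu hv; apply: (@weak_partial_unique i (fun x => u x + c * v x)).
  exact/weak_partialP/H1_lin.
by apply: is_weak_partial_lin; [exact: hu.1|exact: hv.1|exact: weak_partialP..].
Qed.

Lemma H1_test phi : test_function Omega phi -> H1 Omega phi.
Proof.
move=> tphi; split; first exact: L2_test.
by move=> i; eexists; exact: test_weak_partial.
Qed.

Lemma weak_partial_test i phi : test_function Omega phi ->
  ae_eq leb Omega (weak_partial Omega i phi) (partial i phi).
Proof.
move=> tphi; apply: weak_partial_unique; first exact/weak_partialP/H1_test.
exact: test_weak_partial.
Qed.

Lemma normL2_le_normH1 v : normL2 Omega v <= normH1 Omega v.
Proof.
rewrite -(ger0_norm (normL2_ge0 _ v)) -sqrtr_sqr ler_wsqrtr// lerDl.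
by apply: sumr_ge0 => i _; exact: sqr_ge0.
Qed.

Lemma normL2_partial_le_normH1 i v :
  normL2 Omega (weak_partial Omega i v) <= normH1 Omega v.
Proof.
rewrite -(ger0_norm (normL2_ge0 _ (weak_partial Omega i v))) -sqrtr_sqr.
rewrite ler_wsqrtr// (bigD1 i)//= addrCA lerDl addr_ge0 ?sqr_ge0//.
by apply: sumr_ge0 => j _; exact: sqr_ge0.
Qed.

Lemma normH1_le_sum v : normH1 Omega v <=
  normL2 Omega v + \sum_(i < d) normL2 Omega (weak_partial Omega i v).
Proof.
have S0 : 0 <= \sum_(i < d) normL2 Omega (weak_partial Omega i v).
  by apply: sumr_ge0 => i _; exact: normL2_ge0.
rewrite -[leRHS]ger0_norm ?addr_ge0 ?normL2_ge0// -sqrtr_sqr ler_wsqrtr//.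
have := @sum_sqr_le R _ (index_enum 'I_d)
  (fun i => normL2 Omega (weak_partial Omega i v)) (fun i => normL2_ge0 _ _).
by have := normL2_ge0 Omega v; nra.
Qed.

Lemma weak_partial_sub_test i v phi : H1 Omega v -> test_function Omega phi ->
  normL2 Omega (weak_partial Omega i (v \- phi)) =
  normL2 Omega (fun x => weak_partial Omega i v x - partial i phi x).
Proof.
move=> hv tphi; have hphi := H1_test tphi.
have e : v \- phi = fun x => v x + -1 * phi x.
  by apply/funext => x /=; rewrite mulN1r.
rewrite e; apply: (ae_eq_normL2 mO).
- exact: (L2_weak_partial i (H1_lin (-1) hv hphi)).1.
- exact: (L2B mO (L2_weak_partial i hv) (L2_test mO (test_function_partial i tphi))).1.
- apply: filterS2 (weak_partial_lin i (-1) hv hphi) (weak_partial_test i tphi).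
  by move=> x h1 h2 Ox; rewrite h1// h2// mulN1r.
Qed.

(** Approximation is restated with the classical derivatives of the test
functions, the only ones that can be computed with. *)
Lemma H10P v : H10 Omega v <-> H1 Omega v /\ forall e, 0 < e ->
  exists phi, [/\ test_function Omega phi,
    normL2 Omega (fun x => v x - phi x) < e &
    forall i, normL2 Omega (fun x => weak_partial Omega i v x - partial i phi x) < e].
Proof.
split=> [[hv h]|[hv h]]; split => // e e0.
  have [phi [tphi phie]] := h e e0; exists phi; split => //.
    exact: le_lt_trans (normL2_le_normH1 _) phie.
  move=> i; rewrite -weak_partial_sub_test//.
  exact: le_lt_trans (normL2_partial_le_normH1 _ _) phie.
have e1 : 0 < e / d.+1%:R by rewrite divr_gt0.
have [phi [tphi h1 h2]] := h _ e1; exists phi; split => //.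
apply: (le_lt_trans (normH1_le_sum _)).
have -> : e = e / d.+1%:R + \sum_(i < d) (e / d.+1%:R).
  by rewrite sumr_const card_ord -mulrS -[RHS]mulr_natr divfK.
apply: ltr_leD => //; apply: ler_sum => i _.
by rewrite weak_partial_sub_test//; exact/ltW/h2.
Qed.

Lemma H10_H1 v : H10 Omega v -> H1 Omega v. Proof. by case. Qed.

Lemma H10_test phi : test_function Omega phi -> H10 Omega phi.
Proof.
move=> tphi; apply/H10P; split; first exact: H1_test.
move=> e e0; exists phi; split => //.
  have -> : (fun x => phi x - phi x) = fun=> 0 by apply/funext => x; rewrite subrr.
  by rewrite normL2_0.
move=> i; rewrite -weak_partial_sub_test//; last exact: H1_test.
have t0 : test_function Omega (phi \- phi).
  have -> : phi \- phi = fun=> 0 by apply/funext => x /=; rewrite subrr.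
  exact: test_function0.
have -> : normL2 Omega (weak_partial Omega i (phi \- phi)) = 0; last by [].
rewrite weak_partial_sub_test//; last exact: H1_test.
rewrite -(normL2_0 Omega); apply: (ae_eq_normL2 mO) => //.
  apply: (L2B mO _ _).1; last exact: (L2_test mO (test_function_partial i tphi)).
  exact/L2_weak_partial/H1_test.
apply: filterS (weak_partial_test i tphi) => x h Ox.
by rewrite h// subrr.
Qed.

Lemma H10_lin u v c : H10 Omega u -> H10 Omega v ->
  H10 Omega (fun x => u x + c * v x).
Proof.
move=> /H10P[hu u_] /H10P[hv v_]; apply/H10P; split; first exact: H1_lin.
move=> e e0.
have e1 : 0 < e / (1 + `|c|) by rewrite divr_gt0// ltr_pwDl.
have [phi [tphi p1 p2]] := u_ _ e1; have [psi [tpsi q1 q2]] := v_ _ e1.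
have eE : e = e / (1 + `|c|) + `|c| * (e / (1 + `|c|)).
  by field; rewrite gt_eqF// ltr_pwDl.
exists (fun x => phi x + c * psi x); split.
- exact/test_functionD/test_functionZ.
- have -> : (fun x => u x + c * v x - (phi x + c * psi x)) =
      fun x => (u x - phi x) + c * (v x - psi x) by apply/funext => x; ring.
  have L1 := L2B mO hu.1 (L2_test mO tphi); have L2' := L2B mO hv.1 (L2_test mO tpsi).
  apply: (le_lt_trans (normL2D mO L1 (L2Z mO c L2'))).
  by rewrite (normL2Z mO)// eE ltr_leD// ler_wpM2l// ltW.
- move=> i.
  have dphi := test_function_partial i tphi.
  have dpsi := test_function_partial i tpsi.
  have L1 := L2B mO (L2_weak_partial i hu) (L2_test mO dphi).
  have L2' := L2B mO (L2_weak_partial i hv) (L2_test mO dpsi).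
  have L3 := L2D mO L1 (L2Z mO c L2').
  have -> : normL2 Omega (fun x => weak_partial Omega i (fun x0 => u x0 + c * v x0) x -
        partial i (fun x0 => phi x0 + c * psi x0) x) =
      normL2 Omega (fun x => (weak_partial Omega i u x - partial i phi x) +
        c * (weak_partial Omega i v x - partial i psi x)).
    have tt := test_functionD tphi (test_functionZ c tpsi).
    apply: (ae_eq_normL2 mO); [|exact: L3.1|].
      apply: (L2B mO _ _).1; first exact/L2_weak_partial/H1_lin.
      exact/(L2_test mO)/test_function_partial.
    apply: filterS (weak_partial_lin i c hu hv) => x h Ox; rewrite h//.
    rewrite partialD; [|by move=> y; exact: test_function_derivable tphi|
      by move=> y; exact: test_function_derivable (test_functionZ c tpsi)].
    by rewrite partialZ; [ring|move=> y; exact: test_function_derivable tpsi].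
  apply: (le_lt_trans (normL2D mO L1 (L2Z mO c L2'))).
  by rewrite (normL2Z mO)// eE ltr_leD// ler_wpM2l// ltW.
Qed.

Lemma H10_0 : H10 Omega (fun=> 0).
Proof. exact/H10_test/test_function0. Qed.

(** True for test functions, and both sides are continuous for the H^1 norm as
Omega is bounded. *)
Lemma integral_weak_partial i v : H10 Omega v ->
  \int[leb]_(x in Omega) weak_partial Omega i v x = 0.
Proof.
move=> /H10P[hv v_].
have hL := L2_weak_partial i hv.
pose K := normL2 Omega (fun=> 1).
apply/eqP; rewrite -normr_eq0 eq_le normr_ge0 andbT.
apply/ler_addgt0Pl => e e0; rewrite addr0.
have K0 : 0 < K + 1 by rewrite ltr_wpDl ?normL2_ge0.
have e1 : 0 < e / (K + 1) by rewrite divr_gt0.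
have [phi [tphi _ /(_ i) h]] := v_ _ e1.
have dphi := test_function_partial i tphi.
have LB := L2B mO hL (L2_test mO dphi).
have -> : \int[leb]_(x in Omega) weak_partial Omega i v x =
    \int[leb]_(x in Omega) ((weak_partial Omega i v x - partial i phi x) * 1).
  rewrite -[LHS]subr0 -(integral_partial_test i tphi) -RintegralB//.
  - by apply: eq_Rintegral => x _; rewrite mulr1.
  - exact: itg_L2.
  - by apply: (itg_L2 mO fO); exact: L2_test.
apply: (le_trans (cauchy_schwarz mO LB (L2_cst mO fO 1))).
apply: (@le_trans _ _ (e / (K + 1) * K)).
  by rewrite ler_wpM2r ?normL2_ge0// ltW.
by rewrite mulrAC ler_pdivrMr// ler_pM2l// lerDl.
Qed.

Lemma Ck_coord k i : Ck k (fun x : E => x ord0 i).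
Proof.
have d1 j (x : E) : is_derive x (delta_mx ord0 j) (fun x : E => x ord0 i)
    ((i == j)%:R).
  have := @is_derive_ridge R d idfun 1 0 i j x 1 (is_derive_id _ _).
  rewrite mul1r mulr1; congr is_derive; apply/funext => y.
  by rewrite /= mul1r addr0.
case: k => [|k]; first by move=> x; exact: coord_continuous.
split; first by move=> x; exact: coord_continuous.
move=> j; split; first by move=> x; have [] := d1 j x.
have -> : partial j (fun x : E => x ord0 i) = fun=> (i == j)%:R.
  by apply/funext => x; have [] := d1 j x.
exact: Ck_cst.
Qed.

(** The integral of the i-th derivative of x_i phi^2 vanishes, so that
||phi||^2 = -2 (x_i phi, partial_i phi), and |x_i| <= M on Omega. *)
Lemma poincare_test i phi : test_function Omega phi ->
  normL2 Omega phi <= 2 * M * normL2 Omega (partial i phi).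
Proof.
move=> tphi; have dphi := test_function_partial i tphi.
have CL k := test_function_Ck k tphi.
have pL := L2_test mO tphi; have dL := L2_test mO dphi.
have xphi : test_function Omega (fun x => x ord0 i * phi x).
  exact: test_functionM (fun k => Ck_coord k i) tphi.
have xL := L2_test mO xphi.
have xpp : test_function Omega (fun x => x ord0 i * phi x * phi x).
  by apply: test_functionM => // k; exact: test_function_Ck xphi.
have key : normL2 Omega phi ^+ 2 =
    - (2 * \int[leb]_(x in Omega) ((x ord0 i * phi x) * partial i phi x)).
  rewrite sqr_normL2; apply/eqP; rewrite -addr_eq0; apply/eqP.
  rewrite -RintegralZl ?(L2_mul mO)// -RintegralD//; first last.
  - exact/(itgZ mO)/(L2_mul mO).
  - exact: pL.2.
  rewrite -[RHS](integral_partial_test i xpp); apply: eq_Rintegral => x _.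
  rewrite partialM; first last.
  - by move=> y; exact: test_function_derivable tphi.
  - by move=> y; exact: test_function_derivable xphi.
  rewrite partialM; first last.
  - by move=> y; exact: test_function_derivable tphi.
  - by move=> y; have [_ /(_ i)[]] := Ck_coord 1 i.
  have -> : partial i (fun x : E => x ord0 i) x = 1.
    have := @is_derive_ridge R d idfun 1 0 i i x 1 (is_derive_id _ _).
    rewrite eqxx !mul1r => -[_]; rewrite /partial => <-.
    by congr derive; apply/funext => y; rewrite /= mul1r addr0.
  ring.
have M_xL : normL2 Omega (fun x => x ord0 i * phi x) <= `|M| * normL2 Omega phi.
  rewrite -[`|M|]normr_id -(normL2Z mO)//; apply: (normL2_le mO) => //.
    exact: (L2Z mO).
  move=> x Ox; rewrite !normrM normr_id ler_wpM2r// (le_trans (rV_coord_le _ _))//.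
  by rewrite (le_trans (bO Ox))// ler_norm.
case: (eqVneq Omega set0) => [Om0| /set0P].
  have z g : normL2 Omega g = 0.
    by rewrite /normL2 /Rintegral Om0 integral_set0 sqrtr0.
  by rewrite !z mulr0.
move=> [x0 Ox0]; have M0 : 0 <= M by rewrite (le_trans _ (bO Ox0)).
have := cauchy_schwarz mO xL dL.
set I := \int[leb]_(x in Omega) _ in key *.
rewrite (ger0_norm M0) in M_xL => cs.
have hI : - I <= `|I| by rewrite -normrN ler_norm.
have n1 := normL2_ge0 Omega phi; have n2 := normL2_ge0 Omega (partial i phi).
have h2 : normL2 Omega phi ^+ 2 <=
    normL2 Omega phi * (2 * M * normL2 Omega (partial i phi)).
  have := ler_wpM2r n2 M_xL; move: key cs hI; lra.
have [p0|p0] := eqVneq (normL2 Omega phi) 0.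
  by rewrite p0 !mulr_ge0.
by rewrite -(ler_pM2l (x := normL2 Omega phi)) ?lt_neqAle ?n1 1?eq_sym ?p0// -expr2.
Qed.

Lemma poincare i v : H10 Omega v ->
  normL2 Omega v <= 2 * `|M| * normL2 Omega (weak_partial Omega i v).
Proof.
move=> /H10P[hv v_]; have hL := L2_weak_partial i hv.
apply/ler_addgt0Pl => e e0.
have K0 : 0 < 1 + 2 * `|M| by rewrite ltr_pwDl// mulr_ge0.
have e1 : 0 < e / (1 + 2 * `|M|) by rewrite divr_gt0.
have [phi [tphi h1 /(_ i) h2]] := v_ _ e1.
have dphi := test_function_partial i tphi.
have pL := L2_test mO tphi; have dL := L2_test mO dphi.
have n1 : normL2 Omega v <= normL2 Omega (fun x => v x - phi x) + normL2 Omega phi.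
  have := normL2D mO (L2B mO hv.1 pL) pL.
  by under [X in normL2 _ X <= _ -> _]eq_fun do rewrite subrK.
have n2 : normL2 Omega (partial i phi) <=
    normL2 Omega (fun x => weak_partial Omega i v x - partial i phi x) +
    normL2 Omega (weak_partial Omega i v).
  have := normL2B mO hL (L2B mO hL dL).
  under [X in normL2 _ X <= _ -> _]eq_fun do rewrite subKr.
  by rewrite addrC.
have n3 := poincare_test i tphi.
have eE : e / (1 + 2 * `|M|) * (1 + 2 * `|M|) = e by rewrite divfK// gt_eqF.
have MM : 2 * M * normL2 Omega (partial i phi) <=
    2 * `|M| * normL2 Omega (partial i phi).
  by rewrite ler_wpM2r ?normL2_ge0// ler_wpM2l// ler_norm.
have M0 := normr_ge0 M.
move: h1 h2 n1 n2 n3 eE MM; set e' := e / _; set a := normL2 _ _; set b := normL2 _ _.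
move=> *; nra.
Qed.

End weak_derivatives.

(** * Ladyzhenskaya's inequalities and the embedding in L^4 *)

Section slice_measurability.
Context (R : realType) (n : nat).

Lemma measurable_integral_slice1 (f : 'rV[R]_n.+1 -> \bar R) :
  measurable_fun setT f -> (forall x, 0 <= f x)%E ->
  measurable_fun setT
    (fun y => \int[@lebesgue_measure R]_a f (cons_rV (a, y)))%E.
Proof.
move=> mf f0.
apply: (@measurable_fun_fubini_tonelli_G _ _ _ _ _ (@lebesgue_measure R)
  (f \o @cons_rV R n)); first exact: measurable_comp_cons.
by move=> x; exact: f0.
Qed.

Lemma measurable_integral_slice2 (f : 'rV[R]_n.+1 -> \bar R) :
  measurable_fun setT f -> (forall x, 0 <= f x)%E ->
  measurable_fun setT
    (fun a : measurableTypeR R => \int[lebesgue_rV R n]_y f (cons_rV (a, y)))%E.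
Proof.
move=> mf f0.
apply: (@measurable_fun_fubini_tonelli_F _ _ _ _ _ (lebesgue_rV R n)
  (f \o @cons_rV R n)); first exact: measurable_comp_cons.
by move=> x; exact: f0.
Qed.

End slice_measurability.

Section full_space.
Context (R : realType).

Lemma L2_C1c n (i : 'I_n) M phi : C1c i M phi ->
  L2 [set: 'rV[R]_n] phi /\ L2 [set: 'rV[R]_n] (partial i phi).
Proof.
move=> [c z dz cd]; split; split.
- exact: continuous_rV_measurable.
- apply: (@itg_continuous_compact _ _ (fun x => phi x ^+ 2) M).
    by move=> x; apply: (cvgM (c x) (c x)).
  by move=> x /z ->; rewrite expr0n.
- exact: continuous_rV_measurable.
- apply: (@itg_continuous_compact _ _ (fun x => partial i phi x ^+ 2) M).
    by move=> x; apply: (cvgM (cd x) (cd x)).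
  by move=> x /(partial_outside i z) ->; rewrite expr0n.
Qed.

(** The derivative of phi^2 in absolute value, whose line integrals dominate
phi^2. *)
Definition grad_integrand n (i : 'I_n) (phi : 'rV[R]_n -> R) x : R :=
  2 * `|phi x * partial i phi x|.

Lemma measurable_grad_integrand n (i : 'I_n) M phi : C1c i M phi ->
  measurable_fun setT (fun x => (grad_integrand i phi x)%:E).
Proof.
move=> [c _ _ cd]; apply/measurable_EFinP; apply: measurable_funM => //.
apply: measurableT_comp => //; apply: measurable_funM;
  exact: continuous_rV_measurable.
Qed.

Lemma grad_integrand_ge0 n (i : 'I_n) phi x :
  (0 <= (grad_integrand i phi x)%:E)%E.
Proof. by rewrite lee_fin mulr_ge0. Qed.

Lemma ereal_normL2 n (f : 'rV[R]_n -> R) : L2 setT f ->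
  (\int[lebesgue_rV R n]_x (f x ^+ 2)%:E = (normL2 setT f ^+ 2)%:E)%E.
Proof.
by move=> hf; rewrite sqr_normL2 fineK//; exact: integrable_fin_num hf.2.
Qed.

Lemma L2_norm n (D : set 'rV[R]_n) f : measurable D -> L2 D f -> L2 D (fun x => `|f x|).
Proof.
move=> mD [mf hf]; split; first exact: measurableT_comp.
by apply: eq_integrable hf => // x _ /=; rewrite real_normK ?num_real.
Qed.

Lemma normL2_norm n (D : set 'rV[R]_n) f :
  normL2 D (fun x => `|f x|) = normL2 D f.
Proof.
congr Num.sqrt; apply: eq_Rintegral => x _.
by rewrite real_normK ?num_real.
Qed.

Lemma integral_grad_integrand n (i : 'I_n) M phi : C1c i M phi ->
  (\int[lebesgue_rV R n]_x (grad_integrand i phi x)%:E <=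
   (2 * (normL2 setT phi * normL2 setT (partial i phi)))%:E)%E.
Proof.
move=> hphi; have [h1 h2] := L2_C1c hphi.
have i1 := L2_mul measurableT (L2_norm measurableT h1) (L2_norm measurableT h2).
have := cauchy_schwarz measurableT (L2_norm measurableT h1) (L2_norm measurableT h2).
rewrite !normL2_norm => cs.
have i2 := itgZ measurableT 2 i1.
have -> : (\int[lebesgue_rV R n]_x (grad_integrand i phi x)%:E =
    \int[lebesgue_rV R n]_x (2 * (`|phi x| * `|partial i phi x|))%:E)%E.
  by apply: eq_integral => x _; rewrite /grad_integrand normrM.
rewrite -[leLHS]fineK; last exact: integrable_fin_num i2.
rewrite lee_fin [leLHS](RintegralZl 2 measurableT i1).
rewrite ler_pM2l// (le_trans _ cs)// ler_norm//.
Qed.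

Lemma sqr_le_slice0 n M (phi : 'rV[R]_n.+1 -> R) a y : C1c ord0 M phi ->
  ((phi (cons_rV (a, y)) ^+ 2)%:E <=
   \int[@lebesgue_measure R]_b (grad_integrand ord0 phi (cons_rV (b, y)))%:E)%E.
Proof.
move=> hphi; have [_ g0 dg cg] := C1c_slice0 y hphi.
have := sqr_le_integral_derive g0 dg cg a.
by under eq_integral do rewrite partial_slice0.
Qed.

(** Dimension 1 is the base of the recursive definition of the measure, over the
Dirac mass in dimension 0. *)
Lemma integral_rV1 (f : 'rV[R]_1 -> \bar R) :
  measurable_fun setT f -> (forall x, 0 <= f x)%E ->
  (\int[lebesgue_rV R 1]_x f x =
   \int[@lebesgue_measure R]_a f (cons_rV (a, 0%R)))%E.
Proof.
move=> mf f0; rewrite ge0_integral_rVS//; apply: eq_integral => a _.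
have := @integral_dirac _ _ (0 : 'rV[R]_0) R setT measurableT
  (fun y => f (cons_rV (a, y))) (measurable_cons2 a mf).
by rewrite diracT mul1e.
Qed.

Lemma sqr_le_rV1 M (psi : 'rV[R]_1 -> R) y : C1c ord0 M psi ->
  ((psi y ^+ 2)%:E <=
   \int[lebesgue_rV R 1]_x (grad_integrand ord0 psi x)%:E)%E.
Proof.
move=> hpsi; rewrite integral_rV1; last first.
- by move=> x; exact: grad_integrand_ge0.
- exact: measurable_grad_integrand hpsi.
have -> : y = cons_rV (y ord0 ord0, 0).
  by apply: cons_rV_eq => [|[]//]; rewrite cons_rV0.
exact: sqr_le_slice0 hpsi.
Qed.

(** Of the two factors of phi^4 = phi^2 phi^2, one is dominated by an integral
along the first axis, depending on y only, and the other by an integral along the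
second axis, depending on a only: the double integral of the product splits. *)
Lemma ladyzhenskaya2_prod M (phi : 'rV[R]_2 -> R) : (forall i, C1c i M phi) ->
  (\int[lebesgue_rV R 2]_x (phi x ^+ 4)%:E <=
   (\int[lebesgue_rV R 2]_x (grad_integrand ord0 phi x)%:E) *
   (\int[lebesgue_rV R 2]_x (grad_integrand (lift ord0 ord0) phi x)%:E))%E.
Proof.
move=> hphi; pose i1 : 'I_2 := lift ord0 ord0.
have [cphi _ _ _] := hphi ord0.
have m0 := measurable_grad_integrand (hphi ord0).
have m1 := measurable_grad_integrand (hphi i1).
have p0 := grad_integrand_ge0 ord0 phi.
have p1 := grad_integrand_ge0 i1 phi.
have m4 : measurable_fun setT (fun x => (phi x ^+ 4)%:E).
  by apply/measurable_EFinP; apply: measurable_funX; exact: continuous_rV_measurable.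
have p4 x : (0 <= (phi x ^+ 4)%:E)%E by rewrite lee_fin exprn_even_ge0.
rewrite (ge0_integral_rVS m4 p4).
pose P y := (\int[@lebesgue_measure R]_b
  (grad_integrand ord0 phi (cons_rV (b, y : 'rV[R]_1)))%:E)%E.
pose Q a := (\int[lebesgue_rV R 1]_y
  (grad_integrand i1 phi (cons_rV (a, y)))%:E)%E.
have mP : measurable_fun setT P by exact: (measurable_integral_slice1 m0 p0).
have mQ : measurable_fun setT (Q : measurableTypeR R -> _).
  exact: (measurable_integral_slice2 m1 p1).
have P0 y : (0 <= P y)%E by apply: integral_ge0 => b _; exact: p0.
have Q0 a : (0 <= Q a)%E by apply: integral_ge0 => b _; exact: p1.
have -> : (\int[lebesgue_rV R 2]_x (grad_integrand ord0 phi x)%:E =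
    \int[lebesgue_rV R 1]_y P y)%E.
  by rewrite (ge0_integral_rVS m0 p0) (ge0_fubini_rVS m0 p0).
rewrite (ge0_integral_rVS m1 p1) -/(Q _).
have key a y : ((phi (cons_rV (a, y)) ^+ 4)%:E <= Q a * P y)%E.
  have -> : phi (cons_rV (a, y)) ^+ 4 =
      phi (cons_rV (a, y)) ^+ 2 * phi (cons_rV (a, y)) ^+ 2 by ring.
  rewrite EFinM; apply: lee_pmul; rewrite ?lee_fin ?sqr_ge0//.
    have := sqr_le_rV1 y (C1c_sliceS a (hphi i1)).
    by under eq_integral do rewrite /grad_integrand partial_sliceS.
  exact: sqr_le_slice0 (hphi ord0).
apply: (@le_trans _ _ (\int[@lebesgue_measure R]_a
    (Q a * \int[lebesgue_rV R 1]_y P y))%E).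
  apply: ge0_le_integral => //.
  - by move=> a _; apply: integral_ge0 => y _; exact: p4.
  - exact: (measurable_integral_slice2 m4 p4).
  - by apply: emeasurable_funM.
  - move=> a _; rewrite -ge0_integralZl//.
    apply: ge0_le_integral => //.
    + exact: (measurable_cons2 _ m4).
    + exact: measurable_funeM.
rewrite ge0_integralZr//; first by rewrite muleC.
by apply: integral_ge0 => y _; exact: P0.
Qed.

Lemma ladyzhenskaya2 M (phi : 'rV[R]_2 -> R) : (forall i, C1c i M phi) ->
  (\int[lebesgue_rV R 2]_x (phi x ^+ 4)%:E <=
   (2 * normL2 setT phi ^+ 2 *
    \sum_i normL2 setT (partial i phi) ^+ 2)%:E)%E.
Proof.
move=> hphi; apply: (le_trans (ladyzhenskaya2_prod hphi)).
have h0 := integral_grad_integrand (hphi ord0).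
have h1 := integral_grad_integrand (hphi (lift ord0 ord0)).
have -> : \sum_i normL2 setT (partial i phi) ^+ 2 =
    normL2 setT (partial ord0 phi) ^+ 2 +
    normL2 setT (partial (lift ord0 ord0) phi) ^+ 2.
  by rewrite big_ord_recl big_ord1.
move: h0 h1.
move: (normL2 _ phi) (normL2 _ (partial ord0 phi))
  (normL2 _ (partial (lift ord0 ord0) phi)) => a b c h0 h1.
apply: (le_trans (lee_pmul _ _ h0 h1)).
- by apply: integral_ge0 => x _; exact: grad_integrand_ge0.
- by apply: integral_ge0 => x _; exact: grad_integrand_ge0.
rewrite -EFinM lee_fin.
rewrite -subr_ge0 (_ : _ - _ = 2 * (a * (b - c)) ^+ 2); last by ring.
by rewrite mulr_ge0// sqr_ge0.
Qed.

(** Apply the two-dimensional inequality on each slice x_0 = a; the L^2 norm of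
the slice is bounded uniformly in a by integrating along the first axis. *)
Lemma ladyzhenskaya3 M (phi : 'rV[R]_3 -> R) : (forall i, C1c i M phi) ->
  (\int[lebesgue_rV R 3]_x (phi x ^+ 4)%:E <=
   (4 * (normL2 setT phi * normL2 setT (partial ord0 phi)) *
    \sum_i normL2 setT (partial (lift ord0 i) phi) ^+ 2)%:E)%E.
Proof.
move=> hphi.
have [cphi _ _ _] := hphi ord0.
have m0 := measurable_grad_integrand (hphi ord0).
have p0 := grad_integrand_ge0 ord0 phi.
have m4 : measurable_fun setT (fun x => (phi x ^+ 4)%:E).
  by apply/measurable_EFinP; apply: measurable_funX; exact: continuous_rV_measurable.
have p4 x : (0 <= (phi x ^+ 4)%:E)%E by rewrite lee_fin exprn_even_ge0.
pose K := 2 * (normL2 setT phi * normL2 setT (partial ord0 phi)).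
have K0 : 0 <= K by rewrite !mulr_ge0 ?normL2_ge0.
have hK : (\int[lebesgue_rV R 3]_x (grad_integrand ord0 phi x)%:E <= K%:E)%E.
  exact: integral_grad_integrand (hphi ord0).
pose D i x : \bar R := (partial (lift ord0 i) phi x ^+ 2)%:E.
have mD i : measurable_fun setT (D i).
  have [_ _ _ cd] := hphi (lift ord0 i).
  by apply/measurable_EFinP; apply: measurable_funX; exact: continuous_rV_measurable.
have D0 i x : (0 <= D i x)%E by rewrite lee_fin sqr_ge0.
pose S a := (\sum_(i < 2) \int[lebesgue_rV R 2]_y D i (cons_rV (a, y)))%E.
have S0 a : (0 <= S a)%E.
  by apply: sume_ge0 => i _; apply: integral_ge0 => y _; exact: D0.
have mS : measurable_fun setT (S : measurableTypeR R -> _).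
  by apply: emeasurable_sum => i; exact: (measurable_integral_slice2 (mD i) (D0 i)).
have iS : (\int[@lebesgue_measure R]_a S a =
    (\sum_i normL2 setT (partial (lift ord0 i) phi) ^+ 2)%:E)%E.
  rewrite ge0_integral_sum//.
  - rewrite -sumEFin; apply: eq_bigr => i _.
    rewrite -(ge0_integral_rVS (mD i) (D0 i)) ereal_normL2//.
    by have [] := L2_C1c (hphi (lift ord0 i)).
  - by move=> i; exact: (measurable_integral_slice2 (mD i) (D0 i)).
  - by move=> i a _; apply: integral_ge0 => y _; exact: D0.
rewrite (ge0_integral_rVS m4 p4).
apply: (@le_trans _ _ (\int[@lebesgue_measure R]_a ((2 * K)%:E * S a))%E).
  apply: ge0_le_integral => //.
  - by move=> a _; apply: integral_ge0 => y _; exact: p4.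
  - exact: (measurable_integral_slice2 m4 p4).
  - exact: measurable_funeM.
  - move=> a _.
    have ha i := C1c_sliceS a (hphi (lift ord0 i)).
    apply: (le_trans (ladyzhenskaya2 ha)).
    have [La _] := L2_C1c (ha ord0).
    have NK : normL2 setT (fun y => phi (cons_rV (a, y))) ^+ 2 <= K.
      rewrite -lee_fin -ereal_normL2//; apply: le_trans hK.
      rewrite (ge0_integral_rVS m0 p0) (ge0_fubini_rVS m0 p0).
      apply: ge0_le_integral => //.
      + by move=> y _; rewrite lee_fin sqr_ge0.
      + by apply/measurable_EFinP; apply: measurable_funX; exact: La.1.
      + exact: (measurable_integral_slice1 m0 p0).
      + by move=> y _; exact: sqr_le_slice0 (hphi ord0).
    have -> : S a = (\sum_i normL2 setT
        (partial i (fun y => phi (cons_rV (a, y)))) ^+ 2)%:E.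
      rewrite -sumEFin; apply: eq_bigr => i _.
      rewrite -ereal_normL2; last by have [] := L2_C1c (ha i).
      by apply: eq_integral => y _; rewrite partial_sliceS.
    rewrite -EFinM lee_fin ler_wpM2r//.
      by apply: sumr_ge0 => i _; exact: sqr_ge0.
    by rewrite ler_pM2l.
rewrite ge0_integralZl//; last by rewrite lee_fin mulr_ge0.
rewrite iS -EFinM lee_fin /K ler_wpM2r//.
  by apply: sumr_ge0 => i _; exact: sqr_ge0.
by rewrite mulrA -natrM.
Qed.

End full_space.

Lemma normL2_testT (R : realType) d (Omega : set 'rV[R]_d) phi :
  test_function Omega phi -> normL2 Omega phi = normL2 setT phi.
Proof.
move=> tphi; congr (Num.sqrt (fine _)).
rewrite [LHS]integral_mkcond; apply: eq_integral => x _.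
rewrite patchE; case: ifPn => // /negP; rewrite inE => nO.
by rewrite (test_function_outside tphi nO) expr0n.
Qed.

(** A homogeneous form common to both dimensions, by the inequality between
arithmetic and geometric means. *)
Lemma ladyzhenskaya_test (R : realType) d (Omega : set 'rV[R]_d) phi :
  d = 2%N \/ d = 3%N -> test_function Omega phi ->
  normL2 Omega (fun x => phi x ^+ 2) ^+ 2 <=
  2 * (normL2 Omega phi ^+ 2 + \sum_i normL2 Omega (partial i phi) ^+ 2) ^+ 2.
Proof.
move=> hd tphi.
have [M hM] := test_function_C1c tphi.
have t2 : test_function Omega (fun x => phi x ^+ 2).
  have := test_functionM (fun k => test_function_Ck k tphi) tphi.
  by congr test_function; apply/funext => x; rewrite expr2.
have t4 : test_function Omega (fun x => phi x ^+ 4).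
  have := test_functionM (fun k => test_function_Ck k t2) t2.
  by congr test_function; apply/funext => x; ring.
rewrite (normL2_testT t2) (normL2_testT tphi).
under eq_bigr do rewrite (normL2_testT (test_function_partial _ tphi)).
have -> : normL2 setT (fun x => phi x ^+ 2) ^+ 2 =
    \int[lebesgue_rV R d]_x (phi x ^+ 4).
  by rewrite sqr_normL2; apply: eq_Rintegral => x _; ring.
rewrite -lee_fin fineK; last exact: integrable_fin_num (itg_test t4).
have pos I (F : I -> R) (r : seq I) : 0 <= \sum_(i <- r) F i ^+ 2.
  by apply: sumr_ge0 => i _; exact: sqr_ge0.
case: hd => hd; subst d.
  apply: (le_trans (ladyzhenskaya2 hM)); rewrite lee_fin.
  set a := normL2 _ _; set S := \sum_i _.
  have S0 : 0 <= S by exact: pos.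
  by have := sqr_ge0 a; have := sqr_ge0 (a ^+ 2 - S); nra.
apply: (le_trans (ladyzhenskaya3 hM)); rewrite lee_fin [X in _ <= 2 * (_ + X) ^+ 2]big_ord_recl.
set a := normL2 _ _; set b := normL2 _ _; set S := \sum_i _.
have S0 : 0 <= S by exact: pos.
have a0 : 0 <= a by exact: normL2_ge0.
have b0 : 0 <= b by exact: normL2_ge0.
have h1 : 2 * (a * b) <= a ^+ 2 + b ^+ 2 by have := sqr_ge0 (a - b); lra.
apply: (@le_trans _ _ (2 * (a ^+ 2 + b ^+ 2) * S)).
  by rewrite ler_wpM2r//; lra.
by have := sqr_ge0 a; have := sqr_ge0 b; nra.
Qed.

Section L4.
Context (R : realType) (d : nat) (Omega : set 'rV[R]_d) (M : R).
Hypothesis oO : open Omega.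
Hypothesis bO : forall x, Omega x -> `|x| <= M.
Hypothesis hd : d = 2%N \/ d = 3%N.
Let E := 'rV[R]_d.
Let leb := @lebesgue_rV R d.
Let mO : measurable Omega. Proof. exact: open_rV_measurable. Qed.
Let fO : (leb Omega < +oo)%E. Proof. exact: lebesgue_rV_bounded mO bO. Qed.
Implicit Types (v w f : E -> R).

(** If 2 H bounds the norms of a test function and of its d derivatives,
[ladyzhenskaya_test] bounds the square by 2 ((d + 1) 4 H^2)^2 <= (8 (d + 1) H^2)^2. *)
Definition cL4 : R := 8 * d.+1%:R.

Lemma cL4_ge0 : 0 <= cL4. Proof. by rewrite mulr_ge0. Qed.

(** The truncation puts v^2 in L^2, which is what one wants to prove of v^2
itself, so that its norm is finite and can be divided by. *)
Definition truncsq v (k : nat) x : R := Num.min (v x ^+ 2) k%:R.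

Lemma truncsq_ge0 v k x : 0 <= truncsq v k x.
Proof. by rewrite le_min sqr_ge0 ler0n. Qed.

Lemma truncsq_le v k x : truncsq v k x <= v x ^+ 2.
Proof. by rewrite ge_min lexx. Qed.

Lemma truncsq_lek v k x : truncsq v k x <= k%:R.
Proof. by rewrite ge_min lexx orbT. Qed.

Lemma meas_truncsq v k : measurable_fun Omega v ->
  measurable_fun Omega (truncsq v k).
Proof. by move=> mv; apply: measurable_minr => //; exact: measurable_funX. Qed.

Lemma L2_truncsq v k : measurable_fun Omega v -> L2 Omega (truncsq v k).
Proof.
move=> mv; apply: (L2_dominated mO (meas_truncsq k mv) (L2_cst mO fO k%:R)).
by move=> x _; rewrite !ger0_norm ?truncsq_ge0// truncsq_lek.
Qed.

(** With t the truncation and phi a test function close to v,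
||t||^2 <= (t, v^2) = (t, phi^2) + (t (v - phi), v + phi); the first term is at
most ||t|| times the bound of [ladyzhenskaya_test], and the second tends to 0
with v - phi because t <= k.  Dividing by ||t|| leaves a bound free of k. *)
Lemma normL2_truncsq v k H : H10 Omega v -> 0 < H -> normL2 Omega v <= H ->
  (forall i, normL2 Omega (weak_partial Omega i v) <= H) ->
  normL2 Omega (truncsq v k) <= cL4 * H ^+ 2.
Proof.
move=> /(H10P oO bO)[hv v_] H0 vH dvH.
have mv := hv.1.1.
have tL := L2_truncsq k mv.
have iv2 : leb.-integrable Omega (EFin \o (fun x => truncsq v k x * v x ^+ 2)).
  apply: (integrable_le mO _ (itgZ mO k%:R hv.1.2)).
    by apply: measurable_funM; [exact: meas_truncsq|exact: measurable_funX].
  move=> x _; rewrite ger0_norm; last first.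
    by apply: mulr_ge0; [exact: truncsq_ge0|exact: sqr_ge0].
  by rewrite ler_wpM2r ?sqr_ge0// truncsq_lek.
have le1 : normL2 Omega (truncsq v k) ^+ 2 <=
    \int[leb]_(x in Omega) (truncsq v k x * v x ^+ 2).
  rewrite sqr_normL2; apply: le_Rintegral => //; first exact: tL.2.
  by move=> x _; rewrite expr2 ler_wpM2l ?truncsq_ge0 ?truncsq_le.
have key e : 0 < e -> e <= H ->
    normL2 Omega (truncsq v k) ^+ 2 <=
    normL2 Omega (truncsq v k) * (cL4 * H ^+ 2) + k%:R * (3 * H) * e.
  move=> e0 eH; have [phi [tphi h1 h2]] := v_ e e0.
  have pL := L2_test mO tphi.
  have t2 : test_function Omega (fun x => phi x ^+ 2).
    have := test_functionM (fun k => test_function_Ck k tphi) tphi.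
    by congr test_function; apply/funext => x; rewrite expr2.
  have p2L := L2_test mO t2.
  have dL := L2B mO hv.1 pL.
  have sL := L2D mO hv.1 pL.
  have n1 : normL2 Omega phi <= 2 * H.
    have := normL2B mO hv.1 dL.
    rewrite (_ : (fun x => v x - (v x - phi x)) = phi); last first.
      by apply/funext => x; rewrite subKr.
    by lra.
  have n2 i : normL2 Omega (partial i phi) <= 2 * H.
    have wL := L2_weak_partial i hv.
    have := normL2B mO wL (L2B mO wL (L2_test mO (test_function_partial i tphi))).
    rewrite (_ : (fun x => _ - (_ - _)) = partial i phi); last first.
      by apply/funext => x; rewrite subKr.
    by have := h2 i; have := dvH i; lra.
  have n3 : normL2 Omega (fun x => phi x ^+ 2) <= cL4 * H ^+ 2.
    have H2 : 0 <= H ^+ 2 by exact: sqr_ge0.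
    have cH : 0 <= cL4 * H ^+ 2 by exact: mulr_ge0 cL4_ge0 H2.
    rewrite -ler_sqr ?nnegrE ?normL2_ge0//.
    apply: (le_trans (ladyzhenskaya_test hd tphi)).
    set A := normL2 _ _ ^+ 2 + _.
    have A0 : 0 <= A by rewrite addr_ge0 ?sqr_ge0 ?sumr_ge0// => i _; rewrite sqr_ge0.
    have A1 : A <= d.+1%:R * (4 * H ^+ 2).
      have sq (y : R) : 0 <= y -> y <= 2 * H -> y ^+ 2 <= 4 * H ^+ 2.
        by move=> y0 yH; have := H0; nra.
      rewrite /A -natr1 mulrDl mul1r addrC lerD//; last first.
        by apply: sq => //; exact: normL2_ge0.
      rewrite mulr_natl -[X in _ <= _ *+ X]card_ord -sumr_const.
      by apply: ler_sum => i _; apply: sq => //; exact: normL2_ge0.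
    have : A ^+ 2 <= (d.+1%:R * (4 * H ^+ 2)) ^+ 2.
      have h4 : 0 <= d.+1%:R * (4 * H ^+ 2).
        by rewrite mulr_ge0// mulr_ge0.
      by rewrite ler_sqr ?nnegrE.
    rewrite /cL4; have := sqr_ge0 (d.+1%:R * (4 * H ^+ 2)); set s := d.+1%:R.
    rewrite (_ : (8 * s * H ^+ 2) ^+ 2 = 4 * (s * (4 * H ^+ 2)) ^+ 2); [lra|ring].
  have i1 := L2_mul mO tL p2L.
  have mul : L2 Omega (fun x => truncsq v k x * (v x - phi x)).
    apply: (L2_dominated mO _ (L2Z mO k%:R dL)).
      by apply: measurable_funM; [exact: tL.1|exact: dL.1].
    move=> x _; rewrite !normrM ler_wpM2r// !ger0_norm ?truncsq_ge0//.
    exact: truncsq_lek.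
  have n4 : normL2 Omega (fun x => truncsq v k x * (v x - phi x)) <= k%:R * e.
    apply: (@le_trans _ _ (normL2 Omega (fun x => k%:R * (v x - phi x)))).
      apply: (normL2_le mO) => //; first exact: (L2Z mO).
      move=> x _; rewrite !normrM ler_wpM2r// !ger0_norm ?truncsq_ge0//.
      exact: truncsq_lek.
    by rewrite (normL2Z mO)// ger0_norm// ler_wpM2l// ltW.
  have i2 := L2_mul mO mul sL.
  apply: (le_trans le1).
  have -> : \int[leb]_(x in Omega) (truncsq v k x * v x ^+ 2) =
      \int[leb]_(x in Omega) (truncsq v k x * phi x ^+ 2) +
      \int[leb]_(x in Omega) ((truncsq v k x * (v x - phi x)) * (v x + phi x)).
    by rewrite -RintegralD//; apply: eq_Rintegral => x _; ring.
  apply: lerD.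
    apply: (le_trans (ler_norm _)); apply: (le_trans (cauchy_schwarz mO tL p2L)).
    by rewrite ler_wpM2l ?normL2_ge0.
  apply: (le_trans (ler_norm _)); apply: (le_trans (cauchy_schwarz mO mul sL)).
  rewrite mulrAC; apply: ler_pM; rewrite ?normL2_ge0//.
  by have := normL2D mO hv.1 pL; lra.
have t0 := normL2_ge0 Omega (truncsq v k).
have sq : normL2 Omega (truncsq v k) ^+ 2 <=
    normL2 Omega (truncsq v k) * (cL4 * H ^+ 2).
  apply/ler_addgt0Pl => e e0.
  have C0 : 0 < k%:R * (3 * H) + 1 by rewrite ltr_wpDl// !mulr_ge0// ltW.
  have m0 : 0 < Num.min H (e / (k%:R * (3 * H) + 1)) by rewrite lt_min H0 divr_gt0.
  have mH : Num.min H (e / (k%:R * (3 * H) + 1)) <= H by rewrite ge_min lexx.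
  have := key _ m0 mH.
  have : Num.min H (e / (k%:R * (3 * H) + 1)) <= e / (k%:R * (3 * H) + 1).
    by rewrite ge_min lexx orbT.
  rewrite ler_pdivlMr//; set m := Num.min _ _.
  have := m0; rewrite -/m; lra.
have [->|tn0] := eqVneq (normL2 Omega (truncsq v k)) 0.
  exact: mulr_ge0 cL4_ge0 (sqr_ge0 _).
rewrite -(ler_pM2l (x := normL2 Omega (truncsq v k))) -?expr2//.
by rewrite lt_neqAle eq_sym tn0.
Qed.

(** The embedding of H^1_0 in L^4 in dimensions 2 and 3, by monotone convergence
of the truncations.  A bound H > 0 of the norms replaces the norms themselves, so
that functions of norm 0 need no separate treatment. *)
Lemma H10_L4 v H : H10 Omega v -> 0 < H -> normL2 Omega v <= H ->
  (forall i, normL2 Omega (weak_partial Omega i v) <= H) ->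
  L2 Omega (fun x => v x ^+ 2) /\
  normL2 Omega (fun x => v x ^+ 2) <= cL4 * H ^+ 2.
Proof.
move=> hv H0 vH dvH.
have mv := hv.1.1.1.
pose B := cL4 * H ^+ 2.
have B0 : 0 <= B by exact: mulr_ge0 cL4_ge0 (sqr_ge0 _).
have tB k : (\int[leb]_(x in Omega) (truncsq v k x ^+ 2)%:E <= (B ^+ 2)%:E)%E.
  rewrite -[leLHS]fineK; last exact: integrable_fin_num (L2_truncsq k mv).2.
  rewrite lee_fin -[leLHS]sqr_normL2 ler_sqr ?nnegrE ?normL2_ge0//.
  exact: normL2_truncsq.
have mt k : measurable_fun Omega (fun x => (truncsq v k x ^+ 2)%:E).
  by apply/measurable_EFinP; apply: measurable_funX; exact: meas_truncsq.
have cv := @cvg_monotone_convergence _ _ _ leb Omega mO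
  (fun k x => (truncsq v k x ^+ 2)%:E) mt.
have lim x : limn (fun k => (truncsq v k x ^+ 2)%:E) = ((v x ^+ 2) ^+ 2)%:E.
  apply: cvg_lim => //; apply: cvg_near_cst.
  exists (Num.truncn (v x ^+ 2)).+1 => // k /= hk.
  congr (_ ^+ 2)%:E; apply/min_idPl.
  by rewrite (le_trans (ltW (truncnS_gt _)))// ler_nat.
have iB : (\int[leb]_(x in Omega) ((v x ^+ 2) ^+ 2)%:E <= (B ^+ 2)%:E)%E.
  under eq_integral do rewrite -lim.
  have {}cv := cv _ _.
  rewrite -(cvg_lim _ (cv _ _))//; first last.
  - move=> x _ j k jk; rewrite lee_fin ler_sqr ?nnegrE ?truncsq_ge0//.
    by rewrite le_min ge_min lexx/= ge_min (ler_nat _ j k) jk orbT.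
  - by move=> k x _; rewrite lee_fin sqr_ge0.
  apply: lime_le; last by apply: nearW => k; exact: tB.
  apply: cvgP; apply: cv.
  - by move=> k x _; rewrite lee_fin sqr_ge0.
  - move=> x _ j k jk; rewrite lee_fin ler_sqr ?nnegrE ?truncsq_ge0//.
    by rewrite le_min ge_min lexx/= ge_min (ler_nat _ j k) jk orbT.
have m2 : measurable_fun Omega (fun x => v x ^+ 2) by exact: measurable_funX.
have i4 : leb.-integrable Omega (EFin \o (fun x => (v x ^+ 2) ^+ 2)).
  apply/integrableP; split; first by apply/measurable_EFinP; exact: measurable_funX.
  under eq_integral do rewrite abse_EFin ger0_norm ?sqr_ge0//.
  by apply: (le_lt_trans iB); rewrite ltry.
split; first by split.
rewrite -ler_sqr ?nnegrE ?normL2_ge0// sqr_normL2 -lee_fin fineK//.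
exact: integrable_fin_num i4.
Qed.

End L4.

(** * The convective term *)

Section velocity.
Context (R : realType) (d : nat) (Omega : set 'rV[R]_d) (M : R).
Hypothesis oO : open Omega.
Hypothesis bO : forall x, Omega x -> `|x| <= M.
Hypothesis hd : d = 2%N \/ d = 3%N.
Let E := 'rV[R]_d.
Let leb := @lebesgue_rV R d.
Let mO : measurable Omega. Proof. exact: open_rV_measurable. Qed.
Implicit Types (a b : E -> R) (u v w : E -> 'rV[R]_d).

Local Notation comp u i := (fun x => u x ord0 i).
Local Notation wp i v := (weak_partial Omega i v).

Lemma ae_forall (T : finType) (P : T -> E -> Prop) :
  (forall i, {ae leb, forall x, P i x}) -> {ae leb, forall x, forall i, P i x}.
Proof. exact: filter_forall. Qed.

Lemma H10_mul a b Ha Hb : H10 Omega a -> H10 Omega b -> 0 < Ha -> 0 < Hb ->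
  normH1 Omega a <= Ha -> normH1 Omega b <= Hb ->
  L2 Omega (fun x => a x * b x) /\
  normL2 Omega (fun x => a x * b x) <= cL4 R d * Ha * Hb.
Proof.
move=> ha hb Ha0 Hb0 aH bH.
have [a1 a2] := H10_L4 oO bO hd ha Ha0 (le_trans (normL2_le_normH1 _ _) aH)
  (fun i => le_trans (normL2_partial_le_normH1 _ i _) aH).
have [b1 b2] := H10_L4 oO bO hd hb Hb0 (le_trans (normL2_le_normH1 _ _) bH)
  (fun i => le_trans (normL2_partial_le_normH1 _ i _) bH).
have iab := L2_mul mO a1 b1.
have eqab x : a x ^+ 2 * b x ^+ 2 = (a x * b x) ^+ 2 by ring.
have hab : L2 Omega (fun x => a x * b x).
  split; first by apply: measurable_funM; [exact: ha.1.1.1|exact: hb.1.1.1].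
  by apply: eq_integrable iab => // x _ /=; rewrite eqab.
split => //; have cs := cauchy_schwarz mO a1 b1.
have c0 := cL4_ge0 R d.
have k0 : 0 <= cL4 R d * Ha * Hb by rewrite !mulr_ge0// ltW.
rewrite -ler_sqr ?nnegrE ?normL2_ge0// sqr_normL2.
have -> : \int[leb]_(x in Omega) (a x * b x) ^+ 2 =
    \int[leb]_(x in Omega) (a x ^+ 2 * b x ^+ 2).
  by apply: eq_Rintegral => x _; rewrite eqab.
apply: (le_trans (ler_norm _)); apply: (le_trans cs).
have -> : (cL4 R d * Ha * Hb) ^+ 2 = (cL4 R d * Ha ^+ 2) * (cL4 R d * Hb ^+ 2) by ring.
by apply: ler_pM; rewrite ?normL2_ge0.
Qed.

Lemma normH1_ge0 a : 0 <= normH1 Omega a. Proof. exact: sqrtr_ge0. Qed.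

Lemma L2_H10_mul a b : H10 Omega a -> H10 Omega b -> L2 Omega (fun x => a x * b x).
Proof.
move=> ha hb; have p (r : R) : 0 <= r -> 0 < r + 1 by move=> ?; rewrite ltr_wpDl.
have q (r : R) : r <= r + 1 by rewrite lerDl.
by have [] := H10_mul ha hb (p _ (normH1_ge0 a)) (p _ (normH1_ge0 b)) (q _) (q _).
Qed.

(** The scalar form behind the convective term; the derivative is a separate
argument g because only its class in L^2 matters. *)
Definition tri a (g : E -> R) b : R := \int[leb]_(x in Omega) (a x * b x * g x).

Lemma itg_tri a g b : H10 Omega a -> L2 Omega g -> H10 Omega b ->
  leb.-integrable Omega (EFin \o (fun x => a x * b x * g x)).
Proof. by move=> ha hg hb; exact: (L2_mul mO (L2_H10_mul ha hb) hg). Qed.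

Lemma tri_lin1 a a' c g b : H10 Omega a -> H10 Omega a' -> L2 Omega g ->
  H10 Omega b -> tri (fun x => a x + c * a' x) g b = tri a g b + c * tri a' g b.
Proof.
move=> ha ha' hg hb; have i1 := itg_tri ha hg hb; have i2 := itg_tri ha' hg hb.
rewrite /tri -RintegralZl// -RintegralD//; last exact: itgZ.
by apply: eq_Rintegral => x _; ring.
Qed.

Lemma tri_lin3 a c g b b' : H10 Omega a -> H10 Omega b -> L2 Omega g ->
  H10 Omega b' -> tri a g (fun x => b x + c * b' x) = tri a g b + c * tri a g b'.
Proof.
move=> ha hb hg hb'; have i1 := itg_tri ha hg hb; have i2 := itg_tri ha hg hb'.
rewrite /tri -RintegralZl// -RintegralD//; last exact: itgZ.
by apply: eq_Rintegral => x _; ring.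
Qed.

Lemma tri_lin2 a c j (v v' : E -> R) b : H10 Omega a -> H1 Omega v -> H1 Omega v' ->
  H10 Omega b -> tri a (wp j (fun x => v x + c * v' x)) b =
  tri a (wp j v) b + c * tri a (wp j v') b.
Proof.
move=> ha hv hv' hb.
have L1 := L2_weak_partial j hv; have L1' := L2_weak_partial j hv'.
have L3 := L2_weak_partial j (H1_lin oO c hv hv').
have i1 := itg_tri ha L1 hb; have i2 := itg_tri ha L1' hb.
have i3 := itg_tri ha L3 hb.
rewrite /tri -RintegralZl// -RintegralD//; last exact: itgZ.
apply: (ae_eq_Rint mO).
- exact: measurable_integrable i3.
- exact: measurable_integrable (itgD mO i1 (itgZ mO c i2)).
- apply: filterS (weak_partial_lin oO bO j c hv hv') => x h Ox.
  by rewrite h//; ring.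
Qed.

Lemma tri_bound a g b Ha Hb : H10 Omega a -> H10 Omega b -> L2 Omega g ->
  0 < Ha -> 0 < Hb -> normH1 Omega a <= Ha -> normH1 Omega b <= Hb ->
  `|tri a g b| <= cL4 R d * Ha * Hb * normL2 Omega g.
Proof.
move=> ha hb hg Ha0 Hb0 aH bH; have [L n] := H10_mul ha hb Ha0 Hb0 aH bH.
by apply: (le_trans (cauchy_schwarz mO L hg)); rewrite ler_wpM2r ?normL2_ge0.
Qed.

Local Opaque tri weak_partial.

Section skew.
Variable u : E -> 'rV[R]_d.
Hypothesis hu : spV Omega u.
Hypothesis divu : ae_zero Omega (div Omega u).

Let I a b := \sum_j (tri (comp u j) (wp j a) b + tri (comp u j) (wp j b) a).

Let I_sym a b : I a b = I b a.
Proof. by apply: eq_bigr => j _; exact: addrC. Qed.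

Let I_lin a b b' c : H10 Omega a -> H10 Omega b -> H10 Omega b' ->
  I a (fun x => b x + c * b' x) = I a b + c * I a b'.
Proof.
move=> ha hb hb'; rewrite mulr_sumr -big_split /=; apply: eq_bigr => j _.
rewrite (tri_lin3 c (hu j) hb (L2_weak_partial j (H10_H1 ha)) hb').
rewrite (tri_lin2 c j (hu j) (H10_H1 hb) (H10_H1 hb') ha).
by rewrite mulrDr addrACA.
Qed.

Let I_test phi psi : test_function Omega phi -> test_function Omega psi ->
  I phi psi = 0.
Proof.
move=> tphi tpsi.
have tpp := test_functionM (fun k => test_function_Ck k tphi) tpsi.
have hphi := H10_test oO bO tphi; have hpsi := H10_test oO bO tpsi.
have ppL := L2_test mO tpp.
have step j : tri (comp u j) (wp j phi) psi + tri (comp u j) (wp j psi) phi =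
    - \int[leb]_(x in Omega) (wp j (comp u j) x * (phi x * psi x)).
  have [_ <-//] := weak_partialP j (H10_H1 (hu j)).
  have i1 := itg_tri (hu j) (L2_weak_partial j (H10_H1 hphi)) hpsi.
  have i2 := itg_tri (hu j) (L2_weak_partial j (H10_H1 hpsi)) hphi.
  rewrite -RintegralD//; apply: (ae_eq_Rint mO).
  - exact: measurable_integrable (itgD mO i1 i2).
  - apply: measurable_funM; first exact: (hu j).1.1.1.
    exact: (L2_test mO (test_function_partial j tpp)).1.
  - apply: filterS2 (weak_partial_test oO bO j tphi) (weak_partial_test oO bO j tpsi).
    move=> x h1 h2 Ox; rewrite h1// h2//.
    rewrite partialM; [ring|by move=> y; exact: test_function_derivable tphi|].
    by move=> y; exact: test_function_derivable tpsi.
rewrite /I; under eq_bigr do rewrite step.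
rewrite sumrN -Rint_sum//; last first.
  by move=> j _; apply: (L2_mul mO) => //; exact: L2_weak_partial (H10_H1 (hu j)).
apply/eqP; rewrite oppr_eq0; apply/eqP.
rewrite (@ae_eq_Rint _ _ _ mO _ (fun=> 0)) //.
- by rewrite /Rintegral integral0.
- apply: measurable_integrable; apply: (itg_sum mO) => j _.
  by apply: (L2_mul mO) => //; exact: L2_weak_partial (H10_H1 (hu j)).
- apply: filterS divu => x h Ox.
  rewrite -mulr_suml (_ : \sum_j _ = div Omega u x); first by rewrite h// mul0r.
  by apply: eq_bigr => j _; rewrite mxE.
Qed.

Let I_density a b : H10 Omega a -> H10 Omega b ->
  (forall psi, test_function Omega psi -> I a psi = 0) -> I a b = 0.
Proof.
move=> ha hb h; apply/eqP; rewrite -normr_eq0 eq_le normr_ge0 andbT.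
pose Ha := normH1 Omega a + 1.
pose Hu := (\sum_j normH1 Omega (comp u j)) + 1.
have Ha0 : 0 < Ha by rewrite ltr_wpDl ?normH1_ge0.
have Hu0 : 0 < Hu by rewrite ltr_wpDl// sumr_ge0// => j _; exact: normH1_ge0.
have HuP j : normH1 Omega (comp u j) <= Hu.
  rewrite /Hu (bigD1 j)//= -addrA lerDl addr_ge0// sumr_ge0// => k _.
  exact: normH1_ge0.
have aHa : normH1 Omega a <= Ha by rewrite lerDl.
pose K := d%:R * (2 * cL4 R d * Hu * Ha).
have K0 : 0 <= K.
  apply: mulr_ge0 => //; apply: mulr_ge0; last exact: ltW.
  by apply: mulr_ge0; [apply: mulr_ge0 => //; exact: cL4_ge0|exact: ltW].
apply/ler_addgt0Pl => e e0; rewrite addr0.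
have e1 : 0 < e / (K + 1) by rewrite divr_gt0// ltr_wpDl.
have [psi [tpsi /ltW hpsi]] := hb.2 _ e1.
have hps := H10_test oO bO tpsi.
have hdiff : H10 Omega (b \- psi).
  have := H10_lin oO bO (-1) hb hps; congr H10; apply/funext => x /=.
  by rewrite mulN1r.
have -> : I a b = I a (b \- psi).
  have be : b = fun x => (b \- psi) x + 1 * psi x.
    by apply/funext => x /=; rewrite mul1r subrK.
  by rewrite [in LHS]be (I_lin 1 ha hdiff hps) (h psi tpsi) mulr0 addr0.
apply: (@le_trans _ _ (K * (e / (K + 1)))); last first.
  by rewrite mulrA ler_pdivrMr ?ltr_wpDl// mulrC ler_pM2l// lerDl.
apply: (le_trans (ler_norm_sum _ _ _)).
rewrite {1}/K -mulrA mulr_natl -[X in _ <= _ *+ X]card_ord -sumr_const.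
apply: ler_sum => j _; apply: (le_trans (ler_normD _ _)).
have b1 := tri_bound (hu j) hdiff (L2_weak_partial j (H10_H1 ha)) Hu0 e1 (HuP j) hpsi.
have b2 := tri_bound (hu j) ha (L2_weak_partial j (H10_H1 hdiff)) Hu0 Ha0 (HuP j) aHa.
have n1 := le_trans (normL2_partial_le_normH1 Omega j a) aHa.
have n2 := le_trans (normL2_partial_le_normH1 Omega j (b \- psi)) hpsi.
have c0 := cL4_ge0 R d.
have p1 : 0 <= cL4 R d * Hu * (e / (K + 1)).
  exact: mulr_ge0 (mulr_ge0 c0 (ltW Hu0)) (ltW e1).
have p2 : 0 <= cL4 R d * Hu * Ha.
  exact: mulr_ge0 (mulr_ge0 c0 (ltW Hu0)) (ltW Ha0).
apply: le_trans (lerD (le_trans b1 (ler_wpM2l p1 n1)) (le_trans b2 (ler_wpM2l p2 n2))) _.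
have arith (c y z t : R) : c * y * t * z + c * y * z * t <= 2 * c * y * z * t.
  by rewrite le_eqVlt; apply/orP; left; apply/eqP; ring.
exact: arith.
Qed.

(** For test functions a and b the sum is minus the integral of a b div u.  It
vanishes for all a and b by density in each argument in turn. *)
Lemma tri_skew a b : H10 Omega a -> H10 Omega b ->
  \sum_j (tri (comp u j) (wp j a) b + tri (comp u j) (wp j b) a) = 0.
Proof.
move=> ha hb; apply: (I_density ha hb) => psi tpsi.
transitivity (I psi a); first exact: I_sym.
apply: (I_density (H10_test oO bO tpsi) ha) => phi tphi.
exact: (I_test tpsi tphi).
Qed.

End skew.

Lemma intdot_convect u v w : spV Omega u -> spV Omega v -> spV Omega w ->
  intdot Omega (convect Omega u v) w =
  \sum_i \sum_j tri (comp u j) (wp j (comp v i)) (comp w i).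
Proof.
move=> hu hv hw.
have it i j := itg_tri (hu j) (L2_weak_partial j (H10_H1 (hv i))) (hw i).
transitivity (\int[leb]_(x in Omega)
    \sum_i \sum_j (u x ord0 j * w x ord0 i * wp j (comp v i) x)).
  apply: eq_Rintegral => x _; rewrite /mxdot big_ord1; apply: eq_bigr => i _.
  rewrite mxE mulr_suml; apply: eq_bigr => j _; rewrite mxE; ring.
rewrite Rint_sum//; last by move=> i _; exact: (itg_sum mO).
by apply: eq_bigr => i _; rewrite Rint_sum.
Qed.

Lemma spV_lin u v c : spV Omega u -> spV Omega v ->
  spV Omega (fun x => u x + c *: v x).
Proof.
move=> hu hv i; have := H10_lin oO bO c (hu i) (hv i).
by congr H10; apply/funext => x; rewrite !mxE.
Qed.

Lemma spV_sub u v : spV Omega u -> spV Omega v -> spV Omega (u \- v).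
Proof.
move=> hu hv; have := spV_lin (-1) hu hv.
by congr (spV Omega _); apply/funext => x; rewrite scaleN1r.
Qed.

Let comp_lin u v c i : (fun x => (u x + c *: v x) ord0 i) =
  (fun x => u x ord0 i + c * v x ord0 i).
Proof. by apply/funext => x; rewrite !mxE. Qed.

Lemma convect_lin1 u u' c v w : spV Omega u -> spV Omega u' -> spV Omega v ->
  spV Omega w -> intdot Omega (convect Omega (fun x => u x + c *: u' x) v) w =
  intdot Omega (convect Omega u v) w + c * intdot Omega (convect Omega u' v) w.
Proof.
move=> hu hu' hv hw; rewrite (intdot_convect (spV_lin c hu hu') hv hw)
  (intdot_convect hu hv hw) (intdot_convect hu' hv hw).
rewrite mulr_sumr -big_split; apply: eq_bigr => i _.
rewrite mulr_sumr -big_split; apply: eq_bigr => j _ /=.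
rewrite -(tri_lin1 c (hu j) (hu' j) (L2_weak_partial j (H10_H1 (hv i))) (hw i)).
by rewrite comp_lin.
Qed.

Lemma convect_lin2 u v v' c w : spV Omega u -> spV Omega v -> spV Omega v' ->
  spV Omega w -> intdot Omega (convect Omega u (fun x => v x + c *: v' x)) w =
  intdot Omega (convect Omega u v) w + c * intdot Omega (convect Omega u v') w.
Proof.
move=> hu hv hv' hw; rewrite (intdot_convect hu (spV_lin c hv hv') hw)
  (intdot_convect hu hv hw) (intdot_convect hu hv' hw).
rewrite mulr_sumr -big_split; apply: eq_bigr => i _.
rewrite mulr_sumr -big_split; apply: eq_bigr => j _ /=.
rewrite -(tri_lin2 c j (hu j) (H10_H1 (hv i)) (H10_H1 (hv' i)) (hw i)).
by rewrite comp_lin.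
Qed.

Lemma convect_lin3 u v w w' c : spV Omega u -> spV Omega v -> spV Omega w ->
  spV Omega w' -> intdot Omega (convect Omega u v) (fun x => w x + c *: w' x) =
  intdot Omega (convect Omega u v) w + c * intdot Omega (convect Omega u v) w'.
Proof.
move=> hu hv hw hw'; rewrite (intdot_convect hu hv (spV_lin c hw hw'))
  (intdot_convect hu hv hw) (intdot_convect hu hv hw').
rewrite mulr_sumr -big_split; apply: eq_bigr => i _.
rewrite mulr_sumr -big_split; apply: eq_bigr => j _ /=.
rewrite -(tri_lin3 c (hu j) (hw i) (L2_weak_partial j (H10_H1 (hv i))) (hw' i)).
by rewrite comp_lin.
Qed.

Local Opaque intdot convect.

Lemma sub_lin u v : u \- v = (fun x => u x + -1 *: v x).
Proof. by apply/funext => x; rewrite scaleN1r. Qed.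

Lemma trilinB1 u u' v w : spV Omega u -> spV Omega u' -> spV Omega v ->
  spV Omega w ->
  trilin Omega (u \- u') v w = trilin Omega u v w - trilin Omega u' v w.
Proof.
move=> hu hu' hv hw; rewrite /trilin sub_lin (convect_lin1 (-1) hu hu' hv hw).
rewrite (convect_lin1 (-1) hu hu' hw hv).
move: (intdot _ _ _) (intdot _ _ _) (intdot _ _ _) (intdot _ _ _) => *; ring.
Qed.

Lemma trilinB2 u v v' w : spV Omega u -> spV Omega v -> spV Omega v' ->
  spV Omega w ->
  trilin Omega u (v \- v') w = trilin Omega u v w - trilin Omega u v' w.
Proof.
move=> hu hv hv' hw; rewrite /trilin sub_lin (convect_lin2 (-1) hu hv hv' hw).
rewrite (convect_lin3 (-1) hu hw hv hv').
move: (intdot _ _ _) (intdot _ _ _) (intdot _ _ _) (intdot _ _ _) => *; ring.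
Qed.

Lemma trilin0 u w : trilin Omega u w w = 0.
Proof. by rewrite /trilin subrr. Qed.

(** Half of the vanishing sum of [tri_skew] separates the two forms of the
convective term. *)
Lemma convect_trilin u w : spV Omega u -> ae_zero Omega (div Omega u) ->
  spV Omega w -> intdot Omega (convect Omega u u) w = trilin Omega u u w.
Proof.
move=> hu divu hw; rewrite /trilin.
suff : intdot Omega (convect Omega u u) w + intdot Omega (convect Omega u w) u = 0.
  by move: (intdot _ _ _) (intdot _ _ _) => *; lra.
rewrite (intdot_convect hu hu hw) (intdot_convect hu hw hu) -big_split big1// => i _.
rewrite -big_split; exact: tri_skew.
Qed.

End velocity.

(** * Strain, divergence and forces *)

Section strain.
Context (R : realType) (d : nat) (Omega : set 'rV[R]_d) (M : R).
Hypothesis oO : open Omega.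
Hypothesis bO : forall x, Omega x -> `|x| <= M.
Let E := 'rV[R]_d.
Let leb := @lebesgue_rV R d.
Let mO : measurable Omega. Proof. exact: open_rV_measurable. Qed.
Let fO : (leb Omega < +oo)%E. Proof. exact: lebesgue_rV_bounded mO bO. Qed.
Implicit Types (u v w : E -> 'rV[R]_d) (S : E -> 'M[R]_d) (p q : E -> R).

Local Opaque weak_partial.

Lemma L2mx_grad v : spV Omega v -> L2mx Omega (grad Omega v).
Proof.
move=> hv i j; have := L2_weak_partial j (H10_H1 (hv i)).
by congr L2; apply/funext => x; rewrite mxE.
Qed.

Lemma L2mx_symgrad v : spV Omega v -> L2mx Omega (symgrad Omega v).
Proof.
move=> hv i j; have hg := L2mx_grad hv.
have := L2Z mO 2^-1 (L2D mO (hg i j) (hg j i)).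
by congr L2; apply/funext => x; rewrite !mxE.
Qed.

Lemma symgrad_tr v x : (symgrad Omega v x)^T = symgrad Omega v x.
Proof. by rewrite /symgrad linearZ linearD /= trmxK addrC. Qed.

Lemma spM_symgrad v : spV Omega v -> spM Omega (symgrad Omega v).
Proof.
move=> hv; split; first exact: L2mx_symgrad.
by apply: aeW => x _; exact: symgrad_tr.
Qed.

Lemma grad_lin u v c : spV Omega u -> spV Omega v ->
  ae_eq leb Omega (grad Omega (fun x => u x + c *: v x))
    (fun x => grad Omega u x + c *: grad Omega v x).
Proof.
move=> hu hv.
have h : {ae leb, forall x, forall ij : 'I_d * 'I_d, Omega x ->
    grad Omega (fun x => u x + c *: v x) x ij.1 ij.2 =
    grad Omega u x ij.1 ij.2 + c * grad Omega v x ij.1 ij.2}.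
  apply: ae_forall => -[i j] /=.
  have := weak_partial_lin oO bO j c (H10_H1 (hu i)) (H10_H1 (hv i)).
  apply: filterS => x /[apply] h; rewrite !mxE -h.
  by congr (weak_partial _ _ _ _); apply/funext => y; rewrite !mxE.
apply: filterS h => x h Ox; apply/matrixP => i j.
by have /= -> := h (i, j) Ox; rewrite [RHS]mxE [X in _ = _ + X]mxE.
Qed.

Lemma symgrad_lin u v c : spV Omega u -> spV Omega v ->
  ae_eq leb Omega (symgrad Omega (fun x => u x + c *: v x))
    (fun x => symgrad Omega u x + c *: symgrad Omega v x).
Proof.
move=> hu hv; apply: filterS (grad_lin c hu hv) => x h Ox.
rewrite /symgrad h//; move: (grad Omega u x) (grad Omega v x) => A B.
have -> : (A + c *: B)^T = A^T + c *: B^T by rewrite linearD linearZ.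
have -> : A + c *: B + (A^T + c *: B^T) = (A + A^T) + c *: (B + B^T).
  by rewrite scalerDr addrACA.
by rewrite (scalerDr 2^-1) !scalerA (mulrC c).
Qed.

Lemma symgrad_sub u v : spV Omega u -> spV Omega v ->
  ae_eq leb Omega (symgrad Omega (u \- v))
    (fun x => symgrad Omega u x - symgrad Omega v x).
Proof.
move=> hu hv; rewrite sub_lin; apply: filterS (symgrad_lin (-1) hu hv) => x h Ox.
by rewrite h// scaleN1r.
Qed.

Lemma intdot_symgrad_lin S u v c : spV Omega u -> spV Omega v -> L2mx Omega S ->
  intdot Omega S (symgrad Omega (fun x => u x + c *: v x)) =
  intdot Omega S (symgrad Omega u) + c * intdot Omega S (symgrad Omega v).
Proof.
move=> hu hv hS; have hDu := L2mx_symgrad hu; have hDv := L2mx_symgrad hv.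
rewrite -(intdotZr mO c hS hDv) -(intdotDr mO hDu (L2mxZ mO c hDv) hS).
rewrite (intdotC _ S) [RHS]intdotC.
exact: (ae_eq_intdot mO (L2mx_symgrad (spV_lin oO bO c hu hv))
  (L2mxD mO hDu (L2mxZ mO c hDv)) hS (symgrad_lin c hu hv)).
Qed.

Lemma normV_sub u v : spV Omega u -> spV Omega v -> normV Omega (u \- v) =
  normL2mx Omega (fun x => symgrad Omega u x - symgrad Omega v x).
Proof.
move=> hu hv; apply: (ae_eq_normL2mx mO).
- exact: (L2mx_symgrad (spV_sub oO bO hu hv)).
- exact: (L2mxB mO (L2mx_symgrad hu) (L2mx_symgrad hv)).
- exact: symgrad_sub.
Qed.

Lemma intdot_symgrad_sub S u v : spV Omega u -> spV Omega v -> L2mx Omega S ->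
  intdot Omega S (symgrad Omega (u \- v)) =
  intdot Omega S (symgrad Omega u) - intdot Omega S (symgrad Omega v).
Proof.
by move=> hu hv hS; rewrite sub_lin (intdot_symgrad_lin (-1) hu hv hS) mulN1r.
Qed.

Lemma normV_ge0 v : 0 <= normV Omega v. Proof. exact: normL2mx_ge0. Qed.

Lemma normV_subC u v : spV Omega u -> spV Omega v ->
  normV Omega (u \- v) = normV Omega (v \- u).
Proof.
by move=> hu hv; rewrite (normV_sub hu hv) (normV_sub hv hu); exact: normL2mx_subC.
Qed.

Lemma normV_triangle u v w : spV Omega u -> spV Omega v -> spV Omega w ->
  normV Omega (u \- w) <= normV Omega (u \- v) + normV Omega (v \- w).
Proof.
move=> hu hv hw.
rewrite (normV_sub hu hv) (normV_sub hv hw) (normV_sub hu hw).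
have hDu := L2mx_symgrad hu; have hDv := L2mx_symgrad hv.
have hDw := L2mx_symgrad hw.
exact: (normL2mx_triangle mO hDu hDv hDw).
Qed.

(** Through this identity the norm of V controls the divergence. *)
Lemma divE v x : div Omega v x = \sum_i symgrad Omega v x i i.
Proof.
apply: eq_bigr => i _; rewrite !mxE; move: (weak_partial _ _ _ _) => t; lra.
Qed.

Lemma L2_div v : spV Omega v -> L2 Omega (div Omega v).
Proof.
move=> hv; have -> : div Omega v = fun x => \sum_i symgrad Omega v x i i.
  by apply/funext => x; rewrite divE.
by apply: (L2_sum mO) => i _; exact: L2mx_symgrad.
Qed.

Lemma normL2_div v : spV Omega v ->
  normL2 Omega (div Omega v) <= d%:R * normV Omega v.
Proof.
move=> hv; have hD := L2mx_symgrad hv.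
have -> : div Omega v = fun x => \sum_i symgrad Omega v x i i.
  by apply/funext => x; rewrite divE.
apply: (le_trans (normL2_sum mO _ _)); first by move=> i _; exact: hD.
rewrite mulr_natl -[X in _ *+ X]card_ord -sumr_const.
by apply: ler_sum => i _; exact: (normL2_entry mO).
Qed.

Lemma b2_bound v q : spV Omega v -> L2 Omega q ->
  `|b2 Omega v q| <= d%:R * normV Omega v * normL2 Omega q.
Proof.
move=> hv hq; rewrite normrN.
apply: (le_trans (cauchy_schwarz mO hq (L2_div hv))).
by rewrite mulrC ler_wpM2r ?normL2_ge0// normL2_div.
Qed.

Lemma b2_le v q : spV Omega v -> L2 Omega q ->
  b2 Omega v q <= d%:R * normV Omega v * normL2 Omega q.
Proof. by move=> hv hq; apply: le_trans (ler_norm _) (b2_bound hv hq). Qed.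

Lemma b2_subr v p q : spV Omega v -> L2 Omega p -> L2 Omega q ->
  b2 Omega v (p \- q) = b2 Omega v p - b2 Omega v q.
Proof.
move=> hv hp hq; have hd := L2_div hv.
rewrite /b2 -opprD; congr (- _).
rewrite -(RintegralB mO (L2_mul mO hp hd) (L2_mul mO hq hd)).
by apply: eq_Rintegral => x _ /=; rewrite mulrBl.
Qed.

Lemma div_lin u v c : spV Omega u -> spV Omega v ->
  ae_eq leb Omega (div Omega (fun x => u x + c *: v x))
    (fun x => div Omega u x + c * div Omega v x).
Proof.
move=> hu hv; apply: filterS (grad_lin c hu hv) => x h Ox.
by rewrite /div h// linearD linearZ.
Qed.

Lemma b2_linl u v c q : spV Omega u -> spV Omega v -> L2 Omega q ->
  b2 Omega (fun x => u x + c *: v x) q = b2 Omega u q + c * b2 Omega v q.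
Proof.
move=> hu hv hq; have h1 := L2_div hu; have h2 := L2_div hv.
have i1 := L2_mul mO hq h1; have i2 := L2_mul mO hq h2.
rewrite /b2 mulrN -opprD; congr (- _).
rewrite -(RintegralZl c mO i2) -(RintegralD mO i1 (itgZ mO c i2)).
have m1 := L2_mul mO hq (L2_div (spV_lin oO bO c hu hv)).
have m2 := itgD mO i1 (itgZ mO c i2).
apply: (ae_eq_Rint mO) (measurable_integrable m1) (measurable_integrable m2) _.
apply: filterS (div_lin c hu hv) => x h Ox; rewrite h//.
by rewrite mulrDr mulrCA.
Qed.

Lemma b2_linr v p q c : spV Omega v -> L2 Omega p -> L2 Omega q ->
  b2 Omega v (fun x => p x + c * q x) = b2 Omega v p + c * b2 Omega v q.
Proof.
move=> hv hp hq; have hd := L2_div hv.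
have i1 := L2_mul mO hp hd; have i2 := L2_mul mO hq hd.
rewrite /b2 mulrN -opprD; congr (- _).
rewrite -(RintegralZl c mO i2) -(RintegralD mO i1 (itgZ mO c i2)).
by apply: eq_Rintegral => x _; rewrite mulrDl mulrA.
Qed.

Lemma b2_subl u v q : spV Omega u -> spV Omega v -> L2 Omega q ->
  b2 Omega (u \- v) q = b2 Omega u q - b2 Omega v q.
Proof. by move=> hu hv hq; rewrite sub_lin b2_linl// mulN1r. Qed.

Lemma b2_aer v p q : spV Omega v -> L2 Omega p -> L2 Omega q ->
  ae_eq leb Omega p q -> b2 Omega v p = b2 Omega v q.
Proof.
move=> hv hp hq pq; have hd := L2_div hv; congr (- _); apply: (ae_eq_Rint mO).
- exact: measurable_integrable (L2_mul mO hp hd).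
- exact: measurable_integrable (L2_mul mO hq hd).
- by apply: filterS pq => x h Ox; rewrite h.
Qed.

(** The divergence has mean zero as v vanishes on the boundary, so that it is an
admissible test pressure. *)
Lemma div_free u : spV Omega u -> (forall q, spQ Omega q -> b2 Omega u q = 0) ->
  ae_zero Omega (div Omega u).
Proof.
move=> hu h; have hdu := L2_div hu; apply: (normL2_eq0 mO hdu).
have wL i := L2_weak_partial i (H10_H1 (hu i)).
have Q : spQ Omega (div Omega u).
  split => //.
  have -> : \int[leb]_(x in Omega) div Omega u x =
      \int[leb]_(x in Omega)
        \sum_i weak_partial Omega i (fun y => u y ord0 i) x.
    by apply: eq_Rintegral => x _; apply: eq_bigr => i _; rewrite mxE.
  rewrite Rint_sum//; last by move=> i _; apply: (itg_L2 mO fO).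
  by apply: big1 => i _; exact: (integral_weak_partial oO bO i (hu i)).
apply/eqP; rewrite -sqrf_eq0 sqr_normL2; apply/eqP.
have /eqP := h _ Q; rewrite oppr_eq0 => /eqP <-.
by apply: eq_Rintegral => x _; rewrite expr2.
Qed.

(** The i-th diagonal entry of the strain is the derivative of v_i in the i-th
direction, to which [poincare] applies. *)
Lemma poincare_strain v i : spV Omega v ->
  normL2 Omega (fun x => v x ord0 i) <= 2 * `|M| * normV Omega v.
Proof.
move=> hv; apply: (le_trans (poincare oO bO i (hv i))).
rewrite ler_wpM2l ?mulr_ge0//.
have := normL2_entry mO i i (L2mx_symgrad hv).
congr (normL2 _ _ <= _); apply/funext => x; rewrite !mxE.
by move: (weak_partial _ _ _ _) => t; lra.
Qed.

Lemma normV_eq0 v : spV Omega v -> normV Omega v = 0 -> ae_zero Omega v.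
Proof.
move=> hv v0.
have h i : ae_zero Omega (fun x => v x ord0 i).
  apply: (normL2_eq0 mO (hv i).1.1); apply/eqP.
  by rewrite eq_le normL2_ge0 andbT -(mulr0 (2 * `|M|)) -v0 poincare_strain.
apply: filterS (ae_forall h) => x hx Ox; apply/rowP => i.
by rewrite mxE hx.
Qed.

Lemma L2mx_V v : spV Omega v -> L2mx Omega v.
Proof. by move=> hv i j; rewrite ord1; exact: (hv j).1.1. Qed.

(** Bounds the quotients of which [normHm1] is the supremum. *)
Lemma intdot_force f v : L2mx Omega f -> spV Omega v ->
  `|intdot Omega f v| <=
  (\sum_i normL2 Omega (fun x => f x ord0 i)) * (2 * `|M|) * normV Omega v.
Proof.
move=> hf hv; rewrite (intdot_sum mO hf (L2mx_V hv)) big_ord1.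
apply: (le_trans (ler_norm_sum _ _ _)); rewrite -mulrA mulr_suml.
apply: ler_sum => i _.
apply: (le_trans (cauchy_schwarz mO (hf ord0 i) (hv i).1.1)).
by rewrite ler_wpM2l ?normL2_ge0// poincare_strain.
Qed.

Lemma normV_ae0 v : spV Omega v -> ae_zero Omega v -> normV Omega v = 0.
Proof.
move=> hv z.
have z' : ae_eq leb Omega (symgrad Omega v) (fun=> 0).
  have : ae_eq leb Omega (grad Omega v) (fun=> 0).
    have h : {ae leb, forall x, forall ij : 'I_d * 'I_d, Omega x ->
        grad Omega v x ij.1 ij.2 = 0}.
      apply: ae_forall => -[i j] /=.
      have w1 := weak_partialP j (H10_H1 (hv i)).
      have w0 : is_weak_partial Omega j (fun x => v x ord0 i) (fun=> 0).
        split; first exact: L2_0.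
        move=> phi tphi; rewrite [X in - X](_ : _ = 0) ?oppr0; last first.
          by rewrite /Rintegral; under eq_integral do rewrite mul0r;
             rewrite integral0.
        rewrite (@ae_eq_Rint _ _ _ mO _ (fun=> 0))//.
        - by rewrite /Rintegral integral0.
        - apply: measurable_funM; first exact: (hv i).1.1.1.
          exact: (L2_test mO (test_function_partial j tphi)).1.
        - by apply: filterS z => x h Ox; rewrite h// mxE mul0r.
      apply: filterS (weak_partial_unique oO bO w1 w0) => x h Ox.
      by rewrite mxE h.
    by apply: filterS h => x h Ox; apply/matrixP => i j; have /= -> := h (i, j) Ox; rewrite mxE.
  apply: filterS => x h Ox; rewrite /symgrad h//.
  by rewrite trmx0 addr0 scaler0.
have L0 : L2mx Omega (fun=> 0 : 'M[R]_d).
  by move=> i j; have := L2_0 mO; congr L2; apply/funext => x; rewrite mxE.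
rewrite /normV (ae_eq_normL2mx mO (L2mx_symgrad hv) L0 z').
rewrite normL2mxE /intdot /Rintegral; under eq_integral do rewrite mxdot0l.
by rewrite integral0 sqrtr0.
Qed.

(** Quotients are taken over velocities that are not almost everywhere zero, while
division needs a non-zero norm: [normV_eq0] and [normV_ae0] reconcile the two. *)
Lemma normHm1P f v : L2mx Omega f -> spV Omega v ->
  intdot Omega f v <= normHm1 Omega f * normV Omega v.
Proof.
move=> hf hv.
have [v0|vn0] := eqVneq (normV Omega v) 0.
  by have := intdot_force hf hv; rewrite v0 !mulr0; exact: le_trans (ler_norm _).
have vgt0 : 0 < normV Omega v by rewrite lt_neqAle eq_sym vn0 normV_ge0.
rewrite -ler_pdivrMr//; apply: ub_le_sup; last first.
  by exists v => //; split => // z; move: vn0; rewrite (normV_ae0 hv z) eqxx.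
exists ((\sum_i normL2 Omega (fun x => f x ord0 i)) * (2 * `|M|)).
move=> _ [w [hw wn] <-].
have [w0|w0] := eqVneq (normV Omega w) 0.
  by case: wn; exact: normV_eq0.
rewrite ler_pdivrMr; last by rewrite lt_neqAle eq_sym w0 normV_ge0.
exact: le_trans (ler_norm _) (intdot_force hf hw).
Qed.

End strain.

(** * The constitutive law *)

Section two_plane.
Context (R : realType) (n : nat).

Lemma mxdot_delta m k (i : 'I_m) (j : 'I_k) (B : 'M[R]_(m, k)) :
  mxdot (delta_mx i j) B = B i j.
Proof.
rewrite /mxdot (bigD1 i)//= (bigD1 j)//= mxE !eqxx mul1r.
rewrite !big1 ?addr0// => [k' /negPf k'i|k' /negPf k'j].
  by apply: big1 => l _; rewrite mxE k'i mul0r.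
by rewrite mxE k'j andbF mul0r.
Qed.

Let i0 : 'I_n.+2 := ord0.
Let i1 : 'I_n.+2 := lift ord0 ord0.

(** With [plane2], two orthogonal matrices of equal norm among the trace-free
symmetric ones. *)
Definition plane1 : 'M[R]_n.+2 := delta_mx i0 i0 - delta_mx i1 i1.
Definition plane2 : 'M[R]_n.+2 := delta_mx i0 i1 + delta_mx i1 i0.

Lemma mxtrace_delta (i j : 'I_n.+2) : \tr (delta_mx i j : 'M[R]_n.+2) = (i == j)%:R.
Proof.
rewrite /mxtrace (bigD1 i)//= mxE eqxx big1 ?addr0// => k /negPf ki.
by rewrite mxE ki.
Qed.

Lemma plane1_sym : plane1^T = plane1.
Proof. by rewrite /plane1 linearB /= !trmx_delta. Qed.

Lemma plane2_sym : plane2^T = plane2.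
Proof. by rewrite /plane2 linearD /= !trmx_delta addrC. Qed.

Lemma plane1_tr : \tr plane1 = 0.
Proof. by rewrite /plane1 linearB /= !mxtrace_delta !eqxx subrr. Qed.

Lemma plane2_tr : \tr plane2 = 0.
Proof. by rewrite /plane2 linearD /= !mxtrace_delta addr0. Qed.

Lemma plane11 : mxdot plane1 plane1 = 2.
Proof. by rewrite {1}/plane1 mxdotBl !mxdot_delta !mxE /= subr0 sub0r opprK. Qed.

Lemma plane12 : mxdot plane1 plane2 = 0.
Proof. by rewrite {1}/plane1 mxdotBl !mxdot_delta !mxE /= addr0 subr0. Qed.

Lemma plane22 : mxdot plane2 plane2 = 2.
Proof. by rewrite {1}/plane2 mxdotDl !mxdot_delta !mxE /= addr0 add0r. Qed.

(** Any Gram matrix of two vectors can be realised in a Euclidean plane, here the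
one spanned by [plane1] and [plane2]. *)
Lemma plane_gram (t s p : R) : 0 <= t -> 0 <= s -> `|p| <= t * s ->
  exists T S : 'M[R]_n.+2, [/\ T^T = T /\ \tr T = 0, S^T = S /\ \tr S = 0,
    mxdot T T = t ^+ 2, mxdot S S = s ^+ 2 & mxdot T S = p].
Proof.
move=> t0 s0 pts.
have [x [y [tx xy]]] : exists x y, t * x = p /\ x ^+ 2 + y ^+ 2 = s ^+ 2.
  have [tz|tn] := eqVneq t 0.
    exists s, 0; rewrite expr0n addr0 tz mul0r; split => //.
    by move: pts; rewrite tz mul0r normr_le0 => /eqP ->.
  have tgt0 : 0 < t by rewrite lt_neqAle eq_sym tn.
  exists (p / t), (Num.sqrt (s ^+ 2 - (p / t) ^+ 2)).
  split; first by rewrite mulrC divfK.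
  rewrite sqr_sqrtr; first by rewrite addrC subrK.
  rewrite subr_ge0 -(ger0_norm s0) -[_ ^+ 2]real_normK ?num_real//.
  rewrite ler_sqr ?nnegrE// normrM normfV (gtr0_norm tgt0).
  by rewrite ler_pdivrMr// (ger0_norm s0) mulrC.
pose c : R := (Num.sqrt 2)^-1.
have c2 : c ^+ 2 * 2 = 1.
  by rewrite /c exprVn sqr_sqrtr ?ler0n// mulVf// pnatr_eq0.
exists ((t * c) *: plane1), ((x * c) *: plane1 + (y * c) *: plane2); split.
- split; first by rewrite linearZ /= plane1_sym.
  by rewrite linearZ /= plane1_tr mulr0.
- split; first by rewrite linearD /= !linearZ /= plane1_sym plane2_sym.
  by rewrite linearD /= !linearZ /= plane1_tr plane2_tr !mulr0 addr0.
- rewrite mxdotZl mxdotZr plane11.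
  by transitivity (t ^+ 2 * (c ^+ 2 * 2)); [ring|rewrite c2 mulr1].
- rewrite mxdotDl !mxdotDr !mxdotZl !mxdotZr (mxdotC plane2 plane1).
  rewrite plane11 plane12 plane22 -xy.
  by transitivity ((x ^+ 2 + y ^+ 2) * (c ^+ 2 * 2)); [ring|rewrite c2 mulr1].
- rewrite mxdotDr !mxdotZl !mxdotZr plane11 plane12 -tx.
  by transitivity (t * x * (c ^+ 2 * 2)); [ring|rewrite c2 mulr1].
Qed.

End two_plane.

Section nonlinearity.
Context (R : realType) (d : nat) (mu : R -> R).
Implicit Types S T : 'M[R]_d.

Let m T := mu (frobenius T).

Lemma mxdot_nonlin_sub S T :
  mxdot (nonlin mu T - nonlin mu S) (nonlin mu T - nonlin mu S) =
  m T ^+ 2 * mxdot T T - 2 * (m T * m S) * mxdot T S + m S ^+ 2 * mxdot S S.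
Proof.
rewrite /nonlin mxdotBl !mxdotBr !mxdotZl !mxdotZr (mxdotC S T) -/(m T) -/(m S).
ring.
Qed.

Lemma mxdot_sub S T :
  mxdot (T - S) (T - S) = mxdot T T - 2 * mxdot T S + mxdot S S.
Proof. rewrite mxdotBl !mxdotBr (mxdotC S T); ring. Qed.

(** The map is radial, so that both sides depend only on |S|, |T| and S : T, which
trace-free symmetric matrices realise by [plane_gram]. *)
Lemma lipschitz_all Lambda : (2 <= d)%N -> @traceless_lipschitz R d mu Lambda ->
  forall S T, frobenius (nonlin mu T - nonlin mu S) <= Lambda * frobenius (T - S).
Proof.
move=> d2 lip S T; have pts := mxdot_cs T S.
have [T' [S' [[sT tT] [sS tS] TT SS TS]]] :
    exists T' S' : 'M[R]_d, [/\ T'^T = T' /\ \tr T' = 0, S'^T = S' /\ \tr S' = 0,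
    mxdot T' T' = frobenius T ^+ 2, mxdot S' S' = frobenius S ^+ 2 &
    mxdot T' S' = mxdot T S].
  move: (frobenius_ge0 T) (frobenius_ge0 S) pts.
  move: (frobenius T) (frobenius S) (mxdot T S) => t s p t0 s0 pts.
  clear - d2 t0 s0 pts; case: d d2 => [|[|n]]// _.
  exact: plane_gram.
have fT : frobenius T' = frobenius T.
  by rewrite /frobenius TT sqr_frobenius.
have fS : frobenius S' = frobenius S.
  by rewrite /frobenius SS sqr_frobenius.
have := lip S' T' sS sT tS tT.
rewrite /frobenius !mxdot_nonlin_sub !mxdot_sub /m fT fS TT SS TS.
by rewrite !sqr_frobenius.
Qed.

Context (C1 : R).
Hypothesis visc : viscosity mu C1.

Lemma mu_mul_le a b : 0 < a -> a <= b -> mu a * a <= mu b * b.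
Proof.
case: visc => _ dmu dpos _ _ a0; rewrite le_eqVlt => /predU1P[->//|ab].
have df x : x \in `]0, (b + 1)[ -> derivable (fun s => mu s * s) x 1.
  rewrite in_itv/= => /andP[x0 _]; have [h _] := dmu x x0.
  exact: (derivableM h (@derivable_id _ _ x 1)).
apply: ltW; apply: (@gtr0_derive1_lt_oo R (fun s => mu s * s) 0 (b + 1) df) => //.
- by move=> x; rewrite in_itv/= => /andP[x0 _]; exact: dpos.
- move=> x; rewrite inE => xb.
  by apply/differentiable_continuous/derivable1_diffP; exact: df.
- by rewrite in_itv/=; apply/andP; split; lra.
- by rewrite in_itv/=; apply/andP; split; lra.
Qed.

Lemma mu_ge0 a : 0 <= a -> 0 <= mu a.
Proof. by case: visc => _ _ _ + _ a0 => /(_ a a0)[/ltW]. Qed.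

(** With t = |T| and s = |S|, Cauchy-Schwarz bounds the product from below by
(mu(t) t - mu(s) s) (t - s). *)
Lemma nonlin_monotone S T : 0 <= mxdot (nonlin mu T - nonlin mu S) (T - S).
Proof.
pose t := frobenius T; pose s := frobenius S.
have t0 : 0 <= t by exact: frobenius_ge0.
have s0 : 0 <= s by exact: frobenius_ge0.
have mt0 := mu_ge0 t0; have ms0 := mu_ge0 s0.
have -> : mxdot (nonlin mu T - nonlin mu S) (T - S) =
    mu t * t ^+ 2 + mu s * s ^+ 2 - (mu t + mu s) * mxdot T S.
  rewrite /nonlin mxdotBl !mxdotBr !mxdotZl (mxdotC S T) /t /s !sqr_frobenius.
  ring.
have cs : mxdot T S <= t * s by apply: le_trans (mxdot_cs T S); exact: ler_norm.
apply: (@le_trans _ _ ((mu t * t - mu s * s) * (t - s))); last first.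
  have := ler_wpM2l (addr_ge0 mt0 ms0) cs; lra.
have key a b : 0 <= a -> a <= b -> 0 <= (mu a * a - mu b * b) * (a - b).
  rewrite le_eqVlt => /predU1P[<-|a0] ab.
    by rewrite mulr0 !sub0r mulrNN !mulr_ge0 ?mu_ge0.
  by apply: mulr_le0; rewrite subr_le0// mu_mul_le.
case: (leP t s) => [ts|/ltW st]; first exact: key.
by rewrite -mulrNN !opprB; exact: key.
Qed.

Lemma nonlin0 : nonlin mu (0 : 'M[R]_d) = 0.
Proof. by rewrite /nonlin scaler0. Qed.

Lemma frobenius_nonlin T : frobenius (nonlin mu T) = mu (frobenius T) * frobenius T.
Proof. by rewrite frobeniusZ ger0_norm// mu_ge0// frobenius_ge0. Qed.

Lemma nonlin_le_C1 T : frobenius (nonlin mu T) <= C1.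
Proof.
rewrite frobenius_nonlin; case: visc => _ _ _ h _.
by have [] := h _ (frobenius_ge0 T).
Qed.

Lemma mu_le_max a : 0 <= a -> mu a <= mu_max mu.
Proof.
case: visc => _ _ _ _ hb a0; apply: ub_le_sup => //; exists a => //.
by rewrite /= in_itv/= a0.
Qed.

Lemma nonlin_le_max T : frobenius (nonlin mu T) <= mu_max mu * frobenius T.
Proof.
by rewrite frobenius_nonlin ler_wpM2r ?frobenius_ge0// mu_le_max// frobenius_ge0.
Qed.

Lemma mu_max_ge0 : 0 <= mu_max mu.
Proof. exact: le_trans (mu_ge0 (lexx 0)) (mu_le_max (lexx 0)). Qed.

(** The viscosity is continuous on [0, +oo[, where the norms take their values,
and bounded by its supremum. *)
Lemma L2mx_nonlin (Omega : set 'rV[R]_d) (T : 'rV[R]_d -> 'M[R]_d) :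
  measurable Omega -> L2mx Omega T -> L2mx Omega (nonlin mu \o T).
Proof.
move=> mO hT i j.
have fL := L2_frobenius mO hT.
have mmu : measurable_fun Omega (fun x => mu (frobenius (T x))).
  apply: (@measurable_comp _ _ _ _ _ _ (`[0%R, +oo[%classic : set R) mu) => //.
  - by move=> _ [x _ <-]; rewrite /= in_itv/= frobenius_ge0.
  - case: visc => cmu _ _ _ _; apply: subspace_continuous_measurable_fun => //.
  - exact: fL.1.
apply: (L2_dominated mO _ (L2Z mO (mu_max mu) fL)).
  rewrite (_ : (fun x => _) = fun x => mu (frobenius (T x)) * T x i j).
    by apply: measurable_funM => //; exact: (hT i j).1.
  by apply/funext => x; rewrite /= mxE.
move=> x _; apply: (le_trans (frobenius_entry _ _ _)).
by apply: (le_trans (nonlin_le_max _)); exact: ler_norm.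
Qed.

End nonlinearity.

(** * Finite-dimensional spaces and the inf-sup condition *)

Section findim.
Context (R : realType) (d : nat) (Omega : set 'rV[R]_d).
Let E := 'rV[R]_d.
Context (W : lmodType R).
Implicit Types (X Y : set (E -> W)).

Definition comb n (e : 'I_n -> E -> W) (x : 'rV[R]_n) : E -> W :=
  fun y => \sum_k x ord0 k *: e k y.

Definition lin_closed X := forall u v c, X u -> X v -> X (fun x => u x + c *: v x).

Lemma lin_closed_sum X n (e : 'I_n -> E -> W) (x : 'rV[R]_n) (r : seq 'I_n) :
  lin_closed X -> X (fun=> 0) -> (forall k, X (e k)) ->
  X (fun y => \sum_(k <- r) x ord0 k *: e k y).
Proof.
move=> hX X0 he; elim: r => [|k r ih].
  by move: X0; congr X; apply/funext => y; rewrite big_nil.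
have := hX _ _ (x ord0 k) ih (he k); congr X; apply/funext => y.
by rewrite big_cons addrC.
Qed.

Lemma comb_functional X n (e : 'I_n -> E -> W) (x : 'rV[R]_n)
    (F : (E -> W) -> R) : lin_closed X -> X (fun=> 0) -> (forall k, X (e k)) ->
  (forall u v c, X u -> X v -> F (fun x => u x + c *: v x) = F u + c * F v) ->
  F (comb e x) = \sum_k x ord0 k * F (e k).
Proof.
move=> hX X0 he hF.
have F0 : F (fun=> 0) = 0.
  have := hF _ _ (-1) X0 X0.
  have -> : (fun x : E => 0 + -1 *: 0) = (fun=> 0 : W).
    by apply/funext => y; rewrite scaler0 addr0.
  by rewrite mulN1r subrr.
rewrite /comb; elim: (index_enum _) => [|k r ih].
  have -> : (fun y : E => \sum_(k <- [::]) x ord0 k *: e k y) = fun=> 0.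
    by apply/funext => y; rewrite big_nil.
  by rewrite big_nil.
have -> : (fun y : E => \sum_(j <- k :: r) x ord0 j *: e j y) =
    fun y => \sum_(j <- r) x ord0 j *: e j y + x ord0 k *: e k y.
  by apply/funext => y; rewrite big_cons addrC.
rewrite hF//; last exact: lin_closed_sum.
by rewrite ih big_cons addrC.
Qed.

Lemma findim_sub X Y v : findim_subspace Omega X Y -> Y v -> X v.
Proof. by move=> [n [e [_ ->]]] []. Qed.

Lemma findim_comb X Y n (e : 'I_n -> E -> W) x : lin_closed X -> X (fun=> 0) ->
  (forall k, X (e k)) ->
  Y = [set v | X v /\ exists c : 'I_n -> R,
           ae_zero Omega (fun x => v x - \sum_k c k *: e k x)] ->
  Y (comb e x).
Proof.
move=> hX X0 he ->; split; first exact: lin_closed_sum.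
by exists (fun k => x ord0 k); apply: aeW => y _; rewrite subrr.
Qed.

Lemma findim_lin X Y : lin_closed X -> findim_subspace Omega X Y -> lin_closed Y.
Proof.
move=> hX [n [e [he ->]]] u v c [hu [cu au]] [hv [cv av]].
split; first exact: hX.
exists (fun k => cu k + c * cv k); apply: filterS2 au av => x ax bx Ox.
have := ax Ox; have := bx Ox => /eqP; rewrite subr_eq0 => /eqP ->.
move/eqP; rewrite subr_eq0 => /eqP ->.
apply/eqP; rewrite subr_eq0; apply/eqP; rewrite scaler_sumr -big_split /=.
by apply: eq_bigr => k _; rewrite scalerDl scalerA.
Qed.

Lemma findim0 X Y : lin_closed X -> X (fun=> 0) -> findim_subspace Omega X Y ->
  Y (fun=> 0).
Proof.
move=> hX X0 [n [e [he ->]]]; split => //.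
exists (fun=> 0); apply: aeW => x _; rewrite big1 ?subr0// => k _.
by rewrite scale0r.
Qed.

End findim.

(** The columns of [cokermx K] span the kernel of K, and row vectors killed by
them are combinations of the rows of K. *)
Lemma solvable_orthogonal (F : fieldType) k l (K : 'M[F]_(k, l)) (w : 'rV[F]_l) :
  (forall c : 'cV[F]_l, K *m c = 0 -> w *m c = 0) -> exists z, z *m K = w.
Proof.
move=> h; suff /submxP[z zw] : (w <= K)%MS by exists z.
rewrite submxE; apply/eqP/rowP => j; rewrite [RHS]mxE.
have kc : K *m col j (cokermx K) = 0.
  by rewrite colE mulmxA mulmx_coker mul0mx.
have := h _ kc; rewrite colE mulmxA -colE => /colP/(_ ord0).
by rewrite mxE [RHS]mxE.
Qed.

Lemma le_of_sqr_le (R : realType) (beta a b c : R) : 0 < beta -> 0 <= a -> 0 <= b ->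
  beta * c <= a -> a ^+ 2 <= b * c -> beta * a <= b.
Proof.
move=> beta0 a0 b0 h1 h2; rewrite leNgt; apply/negP => h3.
have agt0 : 0 < a by nra.
suff : beta * a ^+ 2 < beta * a ^+ 2 by rewrite ltxx.
apply: (@le_lt_trans _ _ (b * a)); first by nra.
by rewrite expr2 mulrA ltr_pM2r.
Qed.

Section discrete.
Context (R : realType) (d : nat) (Omega : set 'rV[R]_d) (M : R).
Hypothesis oO : open Omega.
Hypothesis bO : forall x, Omega x -> `|x| <= M.
Let E := 'rV[R]_d.
Let leb := @lebesgue_rV R d.
Let mO : measurable Omega. Proof. exact: open_rV_measurable. Qed.
Let fO : (leb Omega < +oo)%E. Proof. exact: lebesgue_rV_bounded mO bO. Qed.

Local Opaque weak_partial intdot b2 normV symgrad normL2.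

Lemma spV0 : spV Omega (fun=> 0).
Proof.
move=> i; have := H10_0 oO bO; congr H10; apply/funext => x; by rewrite mxE.
Qed.

Lemma spV_lin_closed : lin_closed (spV Omega).
Proof. by move=> u v c hu hv; exact: (spV_lin oO bO c hu hv). Qed.

Lemma spQ0 : spQ Omega (fun=> 0).
Proof. by split; [exact: L2_0|rewrite /Rintegral integral0]. Qed.

Lemma spQ_lin_closed : @lin_closed R d R^o (spQ Omega).
Proof.
move=> p q c [pL p0] [qL q0]; split; first exact/(L2D mO)/L2Z.
have ip := itg_L2 mO fO pL; have iq := itg_L2 mO fO qL.
have := RintegralD mO ip (itgZ mO c iq).
by rewrite (RintegralZl c mO iq) p0 q0 mulr0 addr0.
Qed.

Lemma spM0 : spM Omega (fun=> 0).
Proof.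
split; last by apply: aeW => x _; rewrite trmx0.
by move=> i j; have := L2_0 mO; congr L2; apply/funext => x; rewrite mxE.
Qed.

Lemma spM_lin_closed : lin_closed (spM Omega).
Proof.
move=> S T c [hS sS] [hT sT]; split; first exact/(L2mxD mO)/L2mxZ.
apply: filterS2 sS sT => x h1 h2 Ox.
by rewrite linearD linearZ /= h1// h2.
Qed.

Context (Vh : set (E -> 'rV[R]_d)) (Qh : set (E -> R)) (beta : R).
Hypothesis fV : findim_subspace Omega (spV Omega) Vh.
Hypothesis fQ : @findim_subspace R d Omega R^o (spQ Omega) Qh.
Hypothesis beta0 : 0 < beta.
Hypothesis betaP : (beta%:E <= infsup Omega Vh Qh)%E.

Lemma Vh_V v : Vh v -> spV Omega v. Proof. exact: findim_sub fV. Qed.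
Lemma Qh_Q q : Qh q -> spQ Omega q. Proof. exact: (@findim_sub R d Omega R^o _ _ _ fQ). Qed.

(** The inf-sup condition in the form of an estimate: it also covers the pressures
and velocities vanishing almost everywhere, which the quotients exclude. *)
Lemma infsup_le q K : Qh q -> 0 <= K ->
  (forall v, Vh v -> b2 Omega v q <= K * normV Omega v) ->
  beta * normL2 Omega q <= K.
Proof.
move=> hq K0 h; have qL := (Qh_Q hq).1.
have [q0|qn0] := eqVneq (normL2 Omega q) 0; first by rewrite q0 mulr0.
have qgt0 : 0 < normL2 Omega q by rewrite lt_neqAle eq_sym qn0 normL2_ge0.
rewrite -ler_pdivlMr// -lee_fin (le_trans betaP)//.
apply: (@le_trans _ _ (ereal_sup
    [set (b2 Omega v q / (normV Omega v * normL2 Omega q))%:E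
      | v in [set v | Vh v /\ ~ ae_zero Omega v]])).
  apply: ereal_inf_lbound; exists q => //; split => // qz; move: qn0.
  rewrite (@ae_eq_normL2 _ _ _ mO q (fun=> 0) qL.1)//.
  by rewrite normL2_0 eqxx.
apply: ge_ereal_sup => _ [v [hv _] <-]; rewrite lee_fin.
have [v0|vn0] := eqVneq (normV Omega v) 0.
  by rewrite v0 mul0r invr0 mulr0 divr_ge0// normL2_ge0.
have vgt0 : 0 < normV Omega v by rewrite lt_neqAle eq_sym vn0 normV_ge0.
rewrite ler_pdivrMr ?mulr_gt0// [leRHS](_ : _ = K * normV Omega v); first exact: h.
by move: (normL2 Omega q) qn0 (normV Omega v) => a a0 b; field.
Qed.

(** A saddle-point system in the coefficients of r and q.  Its matrix may be
singular, since generators need not be independent; but coefficients in its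
kernel represent functions vanishing almost everywhere, which the right-hand side
kills, and [solvable_orthogonal] applies. *)
Lemma discrete_riesz (l : (E -> R) -> R) :
  (forall p q c, L2 Omega p -> L2 Omega q ->
    l (fun x => p x + c * q x) = l p + c * l q) ->
  (forall p q, L2 Omega p -> L2 Omega q -> ae_eq leb Omega p q -> l p = l q) ->
  (forall q, L2 Omega q -> normL2 Omega q = 0 -> l q = 0) ->
  exists r q, [/\ Vh r, Qh q,
    (forall v, Vh v ->
      intdot Omega (symgrad Omega r) (symgrad Omega v) = b2 Omega v q) &
    forall q', Qh q' -> b2 Omega r q' = l q'].
Proof.
move=> l_lin l_ae l_null.
have [n [e [he VE]]] := fV; have [m [g [hg QE]]] := fQ.
have De k := L2mx_symgrad oO (he k).
have gL l' := (hg l').1.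
pose A : 'M[R]_n := \matrix_(i, j)
  intdot Omega (symgrad Omega (e i)) (symgrad Omega (e j)).
pose B : 'M[R]_(n, m) := \matrix_(i, j) b2 Omega (e i) (g j).
have Vc x : Vh (comb e x).
  exact: findim_comb spV_lin_closed spV0 he VE.
have Qc x : Qh (@comb R d R^o m g x).
  exact: findim_comb spQ_lin_closed spQ0 hg QE.
have cV x := Vh_V (Vc x).
have cQ x := (Qh_Q (Qc x)).1.
have dotE S x : L2mx Omega S -> intdot Omega S (symgrad Omega (comb e x)) =
    \sum_k x ord0 k * intdot Omega S (symgrad Omega (e k)).
  move=> hS; apply: (comb_functional (X := spV Omega)
    (F := fun v => intdot Omega S (symgrad Omega v)) x spV_lin_closed spV0 he).
  by move=> u v c hu hv; exact: (intdot_symgrad_lin oO bO c hu hv hS).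
have b2Vc x q : L2 Omega q ->
    b2 Omega (comb e x) q = \sum_k x ord0 k * b2 Omega (e k) q.
  move=> hq; apply: (comb_functional (X := spV Omega)
    (F := fun v => b2 Omega v q) x spV_lin_closed spV0 he).
  by move=> u v c hu hv; exact: (b2_linl oO bO c hu hv hq).
have lQc x : l (@comb R d R^o m g x) = \sum_k x ord0 k * l (g k).
  apply: (@comb_functional R d R^o (spQ Omega) m g x l spQ_lin_closed spQ0 hg).
  by move=> p q c [hp _] [hq _]; exact: l_lin.
have b2Qc v x : spV Omega v ->
    b2 Omega v (@comb R d R^o m g x) = \sum_k x ord0 k * b2 Omega v (g k).
  move=> hv; apply: (@comb_functional R d R^o (spQ Omega) m g x (b2 Omega v)
    spQ_lin_closed spQ0 hg).
  by move=> p q c [hp _] [hq _]; exact: (b2_linr oO c hv hp hq).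
(* elements agree almost everywhere with a combination of the generators *)
have V_ae v : Vh v -> exists x, forall S q, L2mx Omega S -> L2 Omega q ->
    intdot Omega S (symgrad Omega v) = intdot Omega S (symgrad Omega (comb e x)) /\
    b2 Omega v q = b2 Omega (comb e x) q.
  move=> hv; have hvV := Vh_V hv; move: (hv); rewrite VE => -[_ [c hc]].
  exists (\row_k c k) => S q hS hq.
  have z : ae_zero Omega (v \- comb e (\row_k c k)).
    apply: filterS hc => x hx Ox; rewrite -[RHS](hx Ox) /comb /=.
    by congr (_ - _); apply: eq_bigr => k _; rewrite mxE.
  have hd := spV_sub oO bO hvV (cV (\row_k c k)).
  have n0 := normV_ae0 oO bO hd z.
  split; apply/eqP; rewrite -subr_eq0 -normr_eq0 eq_le normr_ge0 andbT.
    rewrite -(intdot_symgrad_sub oO bO hvV (cV _) hS).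
    have := intdot_cs mO hS (L2mx_symgrad oO hd).
    by rewrite -[normL2mx _ (symgrad _ _)]/(normV _ _) n0 mulr0.
  rewrite -(b2_subl oO bO hvV (cV _) hq).
  by have := b2_bound oO hd hq; rewrite n0 mulr0 mul0r.
have Q_ae q : Qh q -> exists x, ae_eq leb Omega q (@comb R d R^o m g x).
  move=> hq; move: (hq); rewrite QE => -[_ [c hc]]; exists (\row_k c k).
  apply: filterS hc => x hx Ox; apply/eqP; rewrite -subr_eq0 -[X in _ == X](hx Ox).
  by apply/eqP; congr (_ - _); apply: eq_bigr => k _; rewrite mxE.
pose K : 'M[R]_(n + m) := block_mx A B (- B^T) 0.
pose ell : 'rV[R]_m := \row_k l (g k).
have AE x i : (A *m x^T) i ord0 =
    intdot Omega (symgrad Omega (e i)) (symgrad Omega (comb e x)).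
  rewrite mxE dotE//; apply: eq_bigr => k _; rewrite !mxE mulrC; congr (_ * _).
have BE y i : (B *m y^T) i ord0 = b2 Omega (e i) (@comb R d R^o m g y).
  by rewrite mxE b2Qc//; apply: eq_bigr => k _; rewrite !mxE mulrC.
have BtE x i : (B^T *m x^T) i ord0 = b2 Omega (comb e x) (g i).
  by rewrite mxE b2Vc//; apply: eq_bigr => k _; rewrite !mxE mulrC.
have [z zK] : exists z, z *m K = row_mx 0 ell.
  apply: solvable_orthogonal => c.
  pose x := (usubmx c)^T; pose y := (dsubmx c)^T.
  have -> : c = col_mx x^T y^T by rewrite !trmxK vsubmxK.
  rewrite /K mul_block_col mul0mx addr0 => /eqP.
  rewrite col_mx_eq0 => /andP[/eqP e1 /eqP e2].
  have {}e1 i : intdot Omega (symgrad Omega (e i)) (symgrad Omega (comb e x)) +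
      b2 Omega (e i) (@comb R d R^o m g y) = 0.
    by rewrite -AE -BE; move/colP/(_ i) : e1; rewrite mxE => ->; rewrite mxE.
  have {}e2 i : b2 Omega (comb e x) (g i) = 0.
    rewrite -BtE; move/colP/(_ i) : e2; rewrite mulNmx mxE => /eqP.
    by rewrite [X in _ == X]mxE oppr_eq0 => /eqP.
  have Dr := L2mx_symgrad oO (cV x).
  have r0 : normV Omega (comb e x) = 0.
    apply/eqP; rewrite -sqrf_eq0 [_ ^+ 2]sqr_normL2mx dotE//.
    have -> : \sum_k x ord0 k * intdot Omega (symgrad Omega (comb e x))
        (symgrad Omega (e k)) = - b2 Omega (comb e x) (@comb R d R^o m g y).
      rewrite b2Vc// -sumrN; apply: eq_bigr => k _.
      by rewrite -mulrN; congr (_ * _); apply/eqP; rewrite -addr_eq0 intdotC e1.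
    by rewrite b2Qc// big1 ?oppr0// => k _; rewrite e2 mulr0.
  have e3 i : b2 Omega (e i) (@comb R d R^o m g y) = 0.
    rewrite -[LHS]add0r -[RHS](e1 i); congr (_ + _); apply/esym/eqP.
    rewrite -normr_eq0 eq_le normr_ge0 andbT.
    have := intdot_cs mO (De i) Dr.
    by rewrite -[normL2mx _ (symgrad _ (comb e x))]/(normV _ _) r0 mulr0.
  have y0 : beta * normL2 Omega (@comb R d R^o m g y) <= 0.
    apply: infsup_le => // v hv; rewrite mul0r.
    have [x' hx'] := V_ae _ hv.
    have [_ ->] := hx' _ _ Dr (cQ y).
    by rewrite b2Vc// big1// => k _; rewrite e3 mulr0.
  have {}y0 : normL2 Omega (@comb R d R^o m g y) = 0.
    by apply/eqP; rewrite eq_le normL2_ge0 andbT -(ler_pM2l beta0) mulr0.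
  rewrite mul_row_col mul0mx add0r; apply/matrixP => i j; rewrite !ord1 [RHS]mxE.
  rewrite -(l_null _ (cQ y) y0) lQc mxE; apply: eq_bigr => k _.
  by rewrite !mxE mulrC.
pose x := lsubmx z; pose y := rsubmx z.
have zE : z = row_mx x y by rewrite hsubmxK.
move: zK; rewrite zE /K mul_row_block mulmx0 addr0 => /eq_row_mx[e1 e2].
have symA : A^T = A.
  by apply/matrixP => i j; rewrite mxE [LHS]mxE [RHS]mxE; exact: intdotC.
have {}e1 : A *m x^T = B *m y^T.
  move: e1; rewrite mulmxN => /eqP; rewrite subr_eq0 => /eqP/(congr1 trmx).
  by rewrite !trmx_mul trmxK symA.
have {}e2 : B^T *m x^T = ell^T by rewrite -trmx_mul e2.
exists (comb e x), (@comb R d R^o m g y); split => //.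
- have e3 i : intdot Omega (symgrad Omega (comb e x)) (symgrad Omega (e i)) =
      b2 Omega (e i) (@comb R d R^o m g y).
    by rewrite intdotC -AE e1 BE.
  move=> v hv; have [x' hx'] := V_ae _ hv.
  have Dr := L2mx_symgrad oO (cV x).
  have [-> ->] := hx' _ _ Dr (cQ y).
  rewrite (dotE _ _ Dr) (b2Vc _ _ (cQ y)).
  by apply: eq_bigr => k _; rewrite e3.
- move=> q hq; have [y' hy'] := Q_ae _ hq.
  have qL := (Qh_Q hq).1.
  rewrite (b2_aer oO (cV x) qL (cQ y') hy') (l_ae _ _ qL (cQ y') hy').
  rewrite (b2Qc _ _ (cV x)) lQc; apply: eq_bigr => k _.
  by rewrite -BtE e2 mxE mxE.
Qed.

(** For q such that r represents the functional v |-> b_2(v, q), the inf-sup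
condition gives beta ||q|| <= ||r||, while ||r||^2 = b_2(r, q) = b_2(u, q). *)
Lemma discrete_correction u : spV Omega u -> exists r, [/\ Vh r,
  (forall q, Qh q -> b2 Omega r q = b2 Omega u q) &
  beta * normV Omega r <= d%:R * normV Omega u].
Proof.
move=> hu.
have [|||r [q [hr hq rv rq]]] := @discrete_riesz (b2 Omega u).
- by move=> p q c hp hq; exact: (b2_linr oO c hu hp hq).
- by move=> p q hp hq; exact: (b2_aer oO hu hp hq).
- move=> q hq q0; apply/eqP; rewrite -normr_eq0 eq_le normr_ge0 andbT.
  by have := b2_bound oO hu hq; rewrite q0 mulr0.
exists r; split; [exact: hr|exact: rq|].
have hrV := Vh_V hr; have qL := (Qh_Q hq).1.
have Dr := L2mx_symgrad oO hrV.
have h1 : beta * normL2 Omega q <= normV Omega r.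
  apply: infsup_le => //; first exact: normV_ge0.
  move=> v hv; rewrite -(rv _ hv).
  exact: (intdot_le mO Dr (L2mx_symgrad oO (Vh_V hv))).
have h2 : normV Omega r ^+ 2 <= d%:R * normV Omega u * normL2 Omega q.
  rewrite [_ ^+ 2]sqr_normL2mx (rv _ hr) (rq _ hq).
  exact: (b2_le oO hu qL).
have n1 := normV_ge0 Omega r; have n2 := normV_ge0 Omega u.
exact: (le_of_sqr_le beta0 n1 (mulr_ge0 (ler0n R d) n2) h1 h2).
Qed.

End discrete.

(** * Elementary inequalities of the error analysis *)

Section absorption.
Context (R : realType).
Implicit Types x t F k : R.

Lemma apriori_arith alpha k x t F : 0 < alpha -> 0 <= x -> 0 <= F -> 0 <= k ->
  0 <= t -> alpha * t ^+ 2 <= F * x -> x ^+ 2 <= k * t * x ->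
  x <= alpha^-1 * k ^+ 2 * F.
Proof.
move=> a0 x0 F0 k0 t0 h1 h2.
have [->|xn0] := eqVneq x 0.
  by rewrite mulr_ge0// mulr_ge0 ?sqr_ge0// invr_ge0 ltW.
have xgt0 : 0 < x by rewrite lt_neqAle eq_sym xn0.
have h3 : x <= k * t by rewrite -(ler_pM2r xgt0) -expr2.
have h4 : x ^+ 2 <= k ^+ 2 * t ^+ 2 by rewrite -exprMn lerXn2r ?nnegrE ?mulr_ge0.
rewrite -(ler_pM2l a0) !mulrA divff ?gt_eqF// mul1r -(ler_pM2r xgt0).
have := ler_wpM2l (ltW a0) h4; have := ler_wpM2l (sqr_ge0 k) h1.
rewrite !expr2; lra.
Qed.

(** Solves the quadratic inequality for t, with t, a, e the stress error, the
velocity error and the approximation error of the stress. *)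
Lemma quadratic_absorption (alpha k a t e : R) : 0 < alpha -> 0 <= k -> 0 <= a -> 0 <= e ->
  alpha * t ^+ 2 <= a * t + k * t * e + a * e ->
  t <= a / alpha + (k / alpha + 1) * e.
Proof.
move=> a0 k0 ha he h; rewrite leNgt; apply/negP => ht.
have ia : 0 < alpha^-1 by rewrite invr_gt0.
have ht' : a + (k + alpha) * e < alpha * t.
  rewrite -(ltr_pM2r ia) [ltRHS]mulrC mulrA mulVf ?gt_eqF// mul1r.
  apply: le_lt_trans ht; rewrite le_eqVlt; apply/orP; left; apply/eqP.
  by field; rewrite gt_eqF.
have t0 : 0 < t.
  apply: le_lt_trans ht; rewrite addr_ge0//; first by rewrite mulr_ge0// ltW.
  by rewrite mulr_ge0// addr_ge0// mulr_ge0// ltW.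
have h1 : a * e <= alpha * t * e by apply: ler_wpM2r => //; nra.
have h2 := ltr_pM2r t0 (a + (k + alpha) * e) (alpha * t).
rewrite ht' in h2; nra.
Qed.

(** The closing step.  The norms eu, w, et, ep, zu, au, aT, ap are those of u - u_h,
u_h - z, T - T_h, p - p_h, u - z, u - v_h, T - S_h, p - q_h; the smallness condition
is multiplied by w, so that it can be met for w = 0 whatever the sign of Dhat. *)
Lemma error_absorption (alpha beta gamma Lambda theta D Cu n : R) :
  0 < alpha -> 0 < beta -> 0 < gamma -> 0 < Lambda -> theta < 1 ->
  0 <= D -> 0 <= Cu -> 0 <= n ->
  exists C : R, 0 < C /\ forall eu w et ep zu au aT ap : R,
    0 <= eu -> 0 <= w -> 0 <= et -> 0 <= ep -> 0 <= zu -> 0 <= au -> 0 <= aT -> 0 <= ap ->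
    beta * zu <= (beta + n) * au ->
    eu <= zu + w ->
    w <= zu + gamma * Lambda * et + alpha * D * Cu * (zu + zu + w) + alpha * n * ap ->
    (gamma / alpha * Lambda + alpha * D * Cu) * w <= theta * w ->
    et <= eu / alpha + ((alpha + gamma * Lambda) / alpha + 1) * aT ->
    beta * (ep - ap) <= n * ap + 2 * (D * Cu) * eu + et ->
    eu + et + ep <= C * (au + aT + ap).
Proof.
move=> a0 b0 g0 l0 th1 D0 Cu0 n0.
pose kz := (beta + n) / beta.
pose kt := (alpha + gamma * Lambda) / alpha + 1.
pose kw := ((1 + gamma / alpha * Lambda + 2 * (alpha * D * Cu)) * kz
  + gamma * Lambda * kt + alpha * n) / (1 - theta).
pose ke := kz + kw.
pose kT := ke / alpha + kt.
pose kp := (n + 2 * (D * Cu) * ke + kT) / beta + 1.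
have th : 0 < 1 - theta by rewrite subr_gt0.
have a1 := ltW a0; have b1 := ltW b0; have g1 := ltW g0; have l1 := ltW l0.
have ia : 0 <= alpha^-1 by rewrite invr_ge0.
have gl : 0 <= gamma * Lambda by rewrite mulr_ge0.
have gal : 0 <= gamma / alpha * Lambda by rewrite mulr_ge0// mulr_ge0.
have DC : 0 <= D * Cu by rewrite mulr_ge0.
have aDC : 0 <= alpha * D * Cu by rewrite mulr_ge0// mulr_ge0.
have an : 0 <= alpha * n by rewrite mulr_ge0.
have kz0 : 0 <= kz by rewrite divr_ge0// addr_ge0.
have kt0 : 0 <= kt by rewrite addr_ge0// divr_ge0// addr_ge0.
have kw0 : 0 <= kw.
  rewrite divr_ge0 ?(ltW th)//; apply: addr_ge0 an; apply: addr_ge0.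
    by rewrite mulr_ge0// !addr_ge0// mulr_ge0.
  by rewrite mulr_ge0.
have ke0 : 0 <= ke by rewrite addr_ge0.
have kT0 : 0 <= kT by rewrite addr_ge0// divr_ge0.
have kp0 : 0 <= kp.
  rewrite addr_ge0// divr_ge0 ?(ltW b0)// addr_ge0// addr_ge0//.
  by rewrite mulr_ge0// mulr_ge0.
exists (ke + kT + kp + 1); split; first by rewrite ltr_wpDl// addr_ge0// addr_ge0.
move=> eu w et ep zu au aT ap eu0 w0 et0 ep0 zu0 au0 aT0 ap0 hz he hw hth ht hp.
pose N := au + aT + ap.
have N0 : 0 <= N by rewrite !addr_ge0.
have auN : au <= N by rewrite /N -addrA lerDl addr_ge0.
have aTN : aT <= N by rewrite /N addrAC lerDr addr_ge0.
have apN : ap <= N by rewrite /N lerDr addr_ge0.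
have zN : zu <= kz * N.
  rewrite /kz mulrAC ler_pdivlMr// mulrC; apply: (le_trans hz).
  by rewrite ler_wpM2l// addr_ge0.
have wN : w <= kw * N.
  rewrite /kw mulrAC ler_pdivlMr//.
  have h1 : gamma * Lambda * et <=
      gamma / alpha * Lambda * (zu + w) + gamma * Lambda * kt * N.
    apply: (le_trans (ler_wpM2l gl ht)).
    have -> : gamma / alpha * Lambda * (zu + w) + gamma * Lambda * kt * N =
        gamma * Lambda * ((zu + w) / alpha + kt * N) by ring.
    apply: ler_wpM2l => //; apply: lerD; first exact: ler_wpM2r.
    exact: ler_wpM2l.
  have h2 := ler_wpM2l an apN.
  have c0 : 0 <= 1 + gamma / alpha * Lambda + 2 * (alpha * D * Cu).
    by rewrite !addr_ge0// mulr_ge0.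
  have h3 := ler_wpM2l c0 zN.
  move: h1 h2 h3 hth hw; clear; lra.
have eN : eu <= ke * N by rewrite /ke mulrDl (le_trans he)// lerD.
have tN : et <= kT * N.
  rewrite /kT mulrDl (le_trans ht)// lerD//; last exact: ler_wpM2l.
  by rewrite mulrAC ler_wpM2r.
have pN : ep <= kp * N.
  have h1 : (ep - ap) * beta <= (n + 2 * (D * Cu) * ke + kT) * N.
    rewrite mulrC (le_trans hp)//.
    have -> : (n + 2 * (D * Cu) * ke + kT) * N =
        n * N + 2 * (D * Cu) * (ke * N) + kT * N by ring.
    rewrite lerD// lerD//; first exact: ler_wpM2l.
    by rewrite ler_wpM2l// mulr_ge0.
  move: h1; rewrite -ler_pdivlMr// mulrAC => h1.
  by rewrite /kp mulrDl mul1r -lerBlDr (le_trans _ h1)// lerB.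
rewrite -/N; move: (N) (ke) (kT) (kp) N0 eN tN pN; clear => N ke kT kp; nra.
Qed.

End absorption.

(** The products of the stress error (a), of the error of its nonlinear part (b)
and of the velocity error (c) with T_h, S_h, T - T_h and T - S_h, in this order.
The term gamma b3 is the one that monotonicity allows to discard. *)
Lemma stress_energy_bound (R : realType) (alpha gamma Lambda n t e m : R)
    (a1 a2 a3 a4 b1 b2 b3 b4 c1 c2 c3 c4 : R) :
  alpha * a1 + gamma * b1 = c1 -> alpha * a2 + gamma * b2 = c2 ->
  a4 - a3 = a1 - a2 -> b4 - b3 = b1 - b2 -> c4 - c3 = c1 - c2 ->
  0 <= gamma * b3 -> alpha * a4 <= alpha * (t * e) -> c3 <= n * t ->
  - c4 <= n * e -> gamma * b4 <= gamma * (m * e) ->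
  gamma * (m * e) <= gamma * (Lambda * t * e) ->
  alpha * a3 <= n * t + (alpha + gamma * Lambda) * t * e + n * e.
Proof.
move=> h1 h2 ha hb hc m0 k1 k2 k3 k4 k5.
have -> : alpha * a3 = alpha * a4 + c3 - c4 - gamma * b3 + gamma * b4.
  have -> : a3 = a4 - (a1 - a2) by lra.
  have -> : b4 = b3 + (b1 - b2) by lra.
  have -> : c4 = c3 + (c1 - c2) by lra.
  by rewrite -h1 -h2; ring.
lra.
Qed.

(** * A priori bounds and the stress error *)

Section stability.
Context (R : realType) (d : nat) (Omega : set 'rV[R]_d) (M : R).
Hypothesis oO : open Omega.
Hypothesis bO : forall x, Omega x -> `|x| <= M.
Let E := 'rV[R]_d.
Let leb := @lebesgue_rV R d.
Let mO : measurable Omega. Proof. exact: open_rV_measurable. Qed.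
Let fO : (leb Omega < +oo)%E. Proof. exact: lebesgue_rV_bounded mO bO. Qed.

(** The quotients of v and of -v are opposite. *)
Lemma normHm1_ge0 f : L2mx Omega f -> 0 <= normHm1 Omega f.
Proof.
move=> hf.
have [[v [hv vn0]]|h] := pselect (exists v, spV Omega v /\ ~ ae_zero Omega v).
  have vgt0 : 0 < normV Omega v.
    rewrite lt_neqAle normV_ge0 andbT eq_sym; apply/eqP => v0.
    exact: vn0 (normV_eq0 oO bO hv v0).
  have h1 := normHm1P oO bO hf hv.
  have hw := spV_lin oO bO (-1) (spV0 oO bO) hv.
  have h2 := normHm1P oO bO hf hw.
  have e1 : intdot Omega f (fun x => 0 + -1 *: v x) = - intdot Omega f v.
    rewrite -[RHS]mulN1r -(intdotZr mO (-1) hf (L2mx_V hv)); congr intdot.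
    by apply/funext => x; rewrite add0r.
  have e2 : normV Omega (fun x => 0 + -1 *: v x) = normV Omega v.
    have e : normV Omega (fun x => 0 + -1 *: v x) = normV Omega ((fun=> 0) \- v).
      by rewrite sub_lin.
    rewrite e (normV_subC oO bO (spV0 oO bO) hv); congr normV.
    by apply/funext => x; rewrite /= subr0.
  rewrite e1 e2 in h2; have := lerD h1 h2.
  rewrite subrr -mulr2n (pmulrn_lge0 _ (ltn0Sn 1)) (pmulr_lge0 _ vgt0); exact: id.
rewrite /normHm1 (_ : [set _ | _ in _] = set0) ?sup0//.
by apply/seteqP; split => // x [v hv _]; apply: h; exists v.
Qed.

Context (alpha gamma C1 Lambda : R) (mu : R -> R).
Hypothesis alpha0 : 0 < alpha.
Hypothesis gamma0 : 0 < gamma.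
Hypothesis visc : viscosity mu C1.
Hypothesis lambda0 : 0 < Lambda.
Hypothesis lip : forall S T : 'M[R]_d,
  frobenius (nonlin mu T - nonlin mu S) <= Lambda * frobenius (T - S).
Local Notation N T := (@nonlin R d mu \o T).

Lemma normL2mx_nonlin_max T : L2mx Omega T ->
  normL2mx Omega (N T) <= mu_max mu * normL2mx Omega T.
Proof.
move=> hT; apply: (normL2mx_le mO (L2mx_nonlin visc mO hT) hT (mu_max_ge0 visc)).
by move=> x _; exact: (nonlin_le_max visc).
Qed.

Lemma normL2mx_nonlin_lip T : L2mx Omega T ->
  normL2mx Omega (N T) <= Lambda * normL2mx Omega T.
Proof.
move=> hT; apply: (normL2mx_le mO (L2mx_nonlin visc mO hT) hT (ltW lambda0)).
by move=> x _; have := lip 0 (T x); rewrite nonlin0 !subr0.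
Qed.

Lemma normL2mx_nonlin_C1 T : L2mx Omega T ->
  normL2mx Omega (N T) <= C1 * Num.sqrt (fine (leb Omega)).
Proof.
move=> hT.
have C10 : 0 <= C1 by exact: le_trans (frobenius_ge0 _) (nonlin_le_C1 visc 0).
have -> : C1 * Num.sqrt (fine (leb Omega)) = normL2 Omega (fun=> C1).
  by rewrite /normL2 Rintegral_cst// sqrtrM ?sqr_ge0// sqrtr_sqr ger0_norm//.
apply: (normL2_le mO (L2_frobenius mO (L2mx_nonlin visc mO hT)) (L2_cst mO fO C1)).
by move=> x _; rewrite !ger0_norm ?frobenius_ge0//; exact: (nonlin_le_C1 visc).
Qed.

Lemma nonlin_sub_lip S T : L2mx Omega S -> L2mx Omega T ->
  normL2mx Omega (N T \- N S) <= Lambda * normL2mx Omega (T \- S).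
Proof.
move=> hS hT; have hNS := L2mx_nonlin visc mO hS.
have hNT := L2mx_nonlin visc mO hT.
apply: (normL2mx_le mO (L2mxB mO hNT hNS) (L2mxB mO hT hS) (ltW lambda0)).
by move=> x _; exact: lip.
Qed.

Lemma intdot_monotone S T : 0 <= intdot Omega (N T \- N S) (T \- S).
Proof. by apply: Rintegral_ge0 => x _; exact: (nonlin_monotone visc). Qed.

Local Opaque intdot normL2mx nonlin mu_max normHm1 normV symgrad.

Lemma Cu_ge0 f : L2mx Omega f -> 0 <= Cu Omega f alpha gamma mu C1 Lambda.
Proof.
move=> hf; have F0 := normHm1_ge0 hf.
have ia : 0 <= alpha^-1 by rewrite invr_ge0 ltW.
have C10 : 0 <= C1 by exact: le_trans (frobenius_ge0 _) (nonlin_le_C1 visc 0).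
rewrite /Cu !le_min; apply/andP; split; first (apply/andP; split).
- exact: (mulr_ge0 (mulr_ge0 ia (sqr_ge0 _)) F0).
- apply: (addr_ge0 (mulr_ge0 (ltW alpha0) F0)).
  exact: (mulr_ge0 (mulr_ge0 (ltW gamma0) C10) (sqrtr_ge0 _)).
- exact: (mulr_ge0 (mulr_ge0 ia (sqr_ge0 _)) F0).
Qed.

(** Common to both problems: the law is only used with the stress and the strain as
tests, and convection and pressure enter through the last hypothesis. *)
Lemma velocity_le_Cu f T u : L2mx Omega f -> L2mx Omega T -> spV Omega u ->
  (forall S, S = T \/ S = symgrad Omega u ->
    alpha * intdot Omega T S + gamma * intdot Omega (N T) S =
    intdot Omega (symgrad Omega u) S) ->
  intdot Omega T (symgrad Omega u) <= intdot Omega f u ->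
  normV Omega u <= Cu Omega f alpha gamma mu C1 Lambda.
Proof.
move=> hf hT hu hS hfu.
have F0 := normHm1_ge0 hf; have hF := normHm1P oO bO hf hu.
have Du := L2mx_symgrad oO hu; have NT := L2mx_nonlin visc mO hT.
have x0 := normV_ge0 Omega u; have t0 := normL2mx_ge0 Omega T.
have eT := hS _ (or_introl erefl); have eD := hS _ (or_intror erefl).
have NT0 : 0 <= intdot Omega (N T) T.
  have := intdot_monotone (fun=> 0) T; congr (_ <= intdot _ _ _).
    by apply/funext => x; rewrite /= nonlin0 subr0.
  by apply/funext => x; rewrite /= subr0.
have h1 : alpha * normL2mx Omega T ^+ 2 <= normHm1 Omega f * normV Omega u.
  rewrite sqr_normL2mx; apply: le_trans hF; apply: le_trans hfu.
  rewrite [leRHS]intdotC -eT lerDl; exact: (mulr_ge0 (ltW gamma0) NT0).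
have h2 k : 0 <= k -> normL2mx Omega (N T) <= k * normL2mx Omega T ->
    normV Omega u <= alpha^-1 * (alpha + gamma * k) ^+ 2 * normHm1 Omega f.
  move=> k0 hk; apply: (apriori_arith alpha0 x0 F0 _ t0 h1).
    by rewrite addr_ge0 ?(ltW alpha0)// mulr_ge0 ?(ltW gamma0).
  rewrite [_ ^+ 2]sqr_normL2mx -eD.
  have c1 := ler_wpM2l (ltW alpha0) (intdot_le mO hT Du).
  have c2 := ler_wpM2l (ltW gamma0) (intdot_le mO NT Du).
  have c3 := ler_wpM2l (ltW gamma0) (ler_wpM2r x0 hk).
  have -> : (alpha + gamma * k) * normL2mx Omega T * normV Omega u =
      alpha * (normL2mx Omega T * normV Omega u) +
      gamma * (k * normL2mx Omega T * normV Omega u).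
    by move: (normL2mx _ _) (normV _ _); move=> a b; ring.
  exact: (lerD c1 (le_trans c2 c3)).
rewrite /Cu !le_min; apply/andP; split; first (apply/andP; split).
- exact: (h2 _ (mu_max_ge0 visc) (normL2mx_nonlin_max hT)).
- have [->|un0] := eqVneq (normV Omega u) 0.
    apply: addr_ge0; first exact: (mulr_ge0 (ltW alpha0) F0).
    rewrite -mulrA; apply: (mulr_ge0 (ltW gamma0)).
    exact: le_trans (normL2mx_ge0 _ _) (normL2mx_nonlin_C1 hT).
  have ugt0 : 0 < normV Omega u by rewrite lt_neqAle eq_sym un0.
  rewrite -(ler_pM2r ugt0) -expr2 [_ ^+ 2]sqr_normL2mx -eD mulrDl.
  apply: lerD.
    rewrite -mulrA; apply: (ler_wpM2l (ltW alpha0)).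
    exact: le_trans hfu hF.
  rewrite -!mulrA; apply: (ler_wpM2l (ltW gamma0)).
  apply: (le_trans (intdot_le mO NT Du)); rewrite mulrA.
  exact: (ler_wpM2r x0 (normL2mx_nonlin_C1 hT)).
- exact: (h2 _ (ltW lambda0) (normL2mx_nonlin_lip hT)).
Qed.

(** T_h and S_h are the discrete tests available in both laws; their difference
is T - T_h up to the approximation error T - S_h. *)
Lemma stress_error T Th u uh Sh : L2mx Omega T -> L2mx Omega Th ->
  L2mx Omega Sh -> spV Omega u -> spV Omega uh ->
  (forall S, S = Th \/ S = Sh ->
    alpha * intdot Omega T S + gamma * intdot Omega (N T) S =
    intdot Omega (symgrad Omega u) S) ->
  (forall S, S = Th \/ S = Sh ->
    alpha * intdot Omega Th S + gamma * intdot Omega (N Th) S =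
    intdot Omega (symgrad Omega uh) S) ->
  normL2mx Omega (T \- Th) <= normV Omega (u \- uh) / alpha
    + ((alpha + gamma * Lambda) / alpha + 1) * normL2mx Omega (T \- Sh).
Proof.
move=> hT hTh hSh hu huh e1 e2.
have NT := L2mx_nonlin visc mO hT; have NTh := L2mx_nonlin visc mO hTh.
have huuh := spV_sub oO bO hu huh.
have Du := L2mx_symgrad oO hu; have Duh := L2mx_symgrad oO huh.
have De := L2mx_symgrad oO huuh.
have hN := L2mxB mO NT NTh; have heT := L2mxB mO hT hTh.
have hTSh := L2mxB mO hT hSh.
have kge : 0 <= alpha + gamma * Lambda.
  by rewrite addr_ge0 ?(ltW alpha0)// mulr_ge0 ?(ltW gamma0) ?(ltW lambda0).
have eq S : L2mx Omega S -> S = Th \/ S = Sh ->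
    alpha * intdot Omega (T \- Th) S + gamma * intdot Omega (N T \- N Th) S =
    intdot Omega (symgrad Omega (u \- uh)) S.
  move=> hS hS'; rewrite [RHS]intdotC (intdot_symgrad_sub oO bO hu huh hS).
  rewrite (intdotC Omega S (symgrad Omega u)) (intdotC Omega S (symgrad Omega uh)).
  rewrite -(e1 _ hS') -(e2 _ hS').
  rewrite (intdotBl mO hT hTh hS) (intdotBl mO NT NTh hS).
  by rewrite !mulrBr opprD addrACA.
have r1 S : L2mx Omega S -> intdot Omega S (T \- Sh) - intdot Omega S (T \- Th) =
    intdot Omega S Th - intdot Omega S Sh.
  move=> hS; rewrite (intdotBr mO hT hSh hS) (intdotBr mO hT hTh hS).
  by rewrite opprB addrC addrA subrK.
apply: (quadratic_absorption alpha0 kge (normV_ge0 _ _) (normL2mx_ge0 _ _)).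
rewrite sqr_normL2mx.
have m0 := mulr_ge0 (ltW gamma0) (intdot_monotone Th T).
have k3 : - intdot Omega (symgrad Omega (u \- uh)) (T \- Sh) <=
    normV Omega (u \- uh) * normL2mx Omega (T \- Sh).
  apply: le_trans (intdot_cs mO De hTSh); rewrite -normrN; exact: ler_norm.
exact: (stress_energy_bound (eq _ hTh (or_introl erefl)) (eq _ hSh (or_intror erefl))
  (r1 _ heT) (r1 _ hN) (r1 _ De) m0
  (ler_wpM2l (ltW alpha0) (intdot_le mO heT hTSh)) (intdot_le mO De heT) k3
  (ler_wpM2l (ltW gamma0) (intdot_le mO hN hTSh))
  (ler_wpM2l (ltW gamma0) (ler_wpM2r (normL2mx_ge0 Omega (T \- Sh))
    (nonlin_sub_lip hTh hT)))).
Qed.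

End stability.

(** * Velocity and pressure errors *)

Section residuals.
Context (R : realType).

Lemma velocity_energy_absorption (alpha gamma l n D c zu w et ap tr s1 s2 s3 s4 b x eu : R) :
  0 < alpha -> 0 <= gamma -> 0 <= w -> 0 <= zu -> 0 <= D * c -> 0 <= n -> 0 <= ap ->
  0 <= l -> 0 <= et ->
  tr + s1 + b = 0 -> alpha * s1 + gamma * s2 = s3 -> s3 = s4 - w ^+ 2 ->
  b <= n * w * ap -> s4 <= zu * w -> - s2 <= l * et * w ->
  tr = x ->
  x <= D * eu * c * w + D * c * zu * w -> eu <= zu + w ->
  w <= zu + gamma * l * et + alpha * D * c * (zu + zu + w) + alpha * n * ap.
Proof.
move=> a0 g0 w0 zu0 Dc0 n0 ap0 l0 et0 h1 h2 h3 k1 k2 k3 hx hxb he.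
have [->|wn0] := eqVneq w 0.
  have a1 := ltW a0; apply: addr_ge0; last exact: mulr_ge0 (mulr_ge0 a1 n0) ap0.
  apply: addr_ge0; last first.
    rewrite -(mulrA alpha) addr0.
    exact: mulr_ge0 (mulr_ge0 a1 Dc0) (addr_ge0 zu0 zu0).
  exact: addr_ge0 zu0 (mulr_ge0 (mulr_ge0 g0 l0) et0).
have wgt0 : 0 < w by rewrite lt_neqAle eq_sym wn0.
rewrite -(ler_pM2r wgt0).
have m1 : gamma * (- s2) <= gamma * (l * et * w) by apply: ler_wpM2l.
have m2 : alpha * b <= alpha * (n * w * ap) by apply: ler_wpM2l => //; exact: ltW.
have m3 : alpha * tr <= alpha * (D * eu * c * w + D * c * zu * w).
  by rewrite hx; apply: ler_wpM2l hxb; exact: ltW.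
have m4 : alpha * (w * (D * c) * eu) <= alpha * (w * (D * c) * (zu + w)).
  by apply: ler_wpM2l; [exact: ltW|apply: ler_wpM2l => //; exact: mulr_ge0].
have m5 : w ^+ 2 = s4 - gamma * s2 + alpha * (tr + b).
  have -> : tr + b = - s1.
    by apply/eqP; rewrite -subr_eq0 opprK addrAC h1.
  have -> : w ^+ 2 = s4 - s3 by rewrite h3 subKr.
  rewrite -h2; ring.
move: m1 m2 m3 m4 m5 k2; rewrite expr2; lra.
Qed.

Lemma pressure_residual_bound (t1 t2 s b1 b2 b3 D eu et ap v n : R) :
  t1 + t2 + s + (b1 - b2) = 0 -> - t1 <= D * eu * v -> - t2 <= D * eu * v ->
  - s <= et * v -> - (b1 - b3) <= n * v * ap ->
  b3 - b2 <= (n * ap + 2 * D * eu + et) * v.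
Proof. move=> *; lra. Qed.

Lemma sub_via_common (x y n a b c : R) : x = a - b -> y = a - c -> n = b - c -> x = y - n.
Proof. by move=> -> -> ->; rewrite opprB addrA subrK. Qed.

End residuals.

Section error.
Context (R : realType) (d : nat) (Omega : set 'rV[R]_d) (M : R).
Hypothesis oO : open Omega.
Hypothesis bO : forall x, Omega x -> `|x| <= M.
Hypothesis hd : d = 2%N \/ d = 3%N.
Let E := 'rV[R]_d.
Let mO : measurable Omega. Proof. exact: open_rV_measurable. Qed.

Lemma trilin_anti (u v w : E -> 'rV[R]_d) :
  - trilin Omega u v w = trilin Omega u w v.
Proof. by rewrite /trilin opprB. Qed.

Local Opaque intdot normL2mx nonlin mu_max normHm1 normV symgrad trilin b2 Cu.

Context (Dhat : R).
Hypothesis trilin_le : forall u v w, spV Omega u -> spV Omega v -> spV Omega w ->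
  trilin Omega u v w <= Dhat * normV Omega u * normV Omega v * normV Omega w.
Let D := Num.max Dhat 0.
Let D0 : 0 <= D. Proof. by rewrite le_max lexx orbT. Qed.

Lemma trilin_le_max u v w : spV Omega u -> spV Omega v -> spV Omega w ->
  trilin Omega u v w <= D * normV Omega u * normV Omega v * normV Omega w.
Proof.
move=> hu hv hw; apply: (le_trans (trilin_le hu hv hw)).
do 3 (apply: ler_wpM2r; first exact: normV_ge0).
by rewrite le_max lexx.
Qed.

Lemma trilinN_le_max u v w : spV Omega u -> spV Omega v -> spV Omega w ->
  - trilin Omega u v w <= D * normV Omega u * normV Omega v * normV Omega w.
Proof.
move=> hu hv hw; rewrite trilin_anti [leRHS]mulrAC.
exact: (trilin_le_max hu hw hv).
Qed.

(** Since d(w; w, w) = 0, a negative Dhat forces w = 0. *)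
Lemma trilin_const_ge0 w : spV Omega w -> 0 < normV Omega w -> D = Dhat.
Proof.
move=> hw w0; rewrite /D; apply/max_idPl.
have := trilin_le hw hw hw; rewrite trilin0.
by rewrite !(pmulr_lge0 _ w0).
Qed.

(** The third velocity z is u_h for the pressure estimate, and the divergence-free
approximation for the velocity estimate. *)
Lemma trilin_diff u z uh v : spV Omega u -> spV Omega z -> spV Omega uh -> spV Omega v ->
  trilin Omega u u v - trilin Omega uh z v =
  trilin Omega (u \- uh) u v + trilin Omega uh (u \- z) v.
Proof.
move=> hu hz huh hv.
rewrite (trilinB1 oO bO hd hu huh hu hv) (trilinB2 oO bO hd huh hu hz hv).
by rewrite addrA subrK.
Qed.

Context (Vh : set (E -> 'rV[R]_d)) (Qh : set (E -> R)) (beta : R).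
Hypothesis fV : findim_subspace Omega (spV Omega) Vh.
Hypothesis fQ : @findim_subspace R d Omega R^o (spQ Omega) Qh.
Hypothesis beta0 : 0 < beta.
Hypothesis betaP : (beta%:E <= infsup Omega Vh Qh)%E.

(** Adding the correction of u - v_h to v_h restores the discrete divergence
constraint. *)
Lemma velocity_split u vh : spV Omega u -> (forall q, Qh q -> b2 Omega u q = 0) ->
  Vh vh -> exists z, spVh0 Omega Vh Qh z /\
  beta * normV Omega (u \- z) <= (beta + d%:R) * normV Omega (u \- vh).
Proof.
move=> hu u_div hvh; have hvhV := Vh_V fV hvh; have huv := spV_sub oO bO hu hvhV.
have [r [hr rq rle]] := discrete_correction oO bO fV fQ beta0 betaP huv.
have hrV := Vh_V fV hr.
pose z := fun x => vh x + 1 *: r x.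
have hz : Vh z := findim_lin (spV_lin_closed oO bO) fV 1 hvh hr.
have hzV := Vh_V fV hz.
exists z; split.
  split; first exact: hz.
  move=> q hq; have hqL := (Qh_Q fQ hq).1.
  have e := b2_linl oO bO 1 hvhV hrV hqL.
  rewrite mul1r (rq _ hq) (b2_subl oO bO hu hvhV hqL) addrC subrK in e.
  exact: etrans e (u_div _ hq).
have rE : z \- vh = r by apply/funext => x; rewrite /z /= scale1r addrC addKr.
have tri := normV_triangle oO bO hu hvhV hzV.
rewrite (normV_subC oO bO hvhV hzV) rE in tri.
apply: (le_trans (ler_wpM2l (ltW beta0) tri)); rewrite mulrDr mulrDl.
exact: lerD (lexx _) rle.
Qed.

Context (alpha gamma C1 Lambda c : R) (mu : R -> R).
Hypothesis alpha0 : 0 < alpha.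
Hypothesis gamma0 : 0 < gamma.
Hypothesis visc : viscosity mu C1.
Hypothesis lambda0 : 0 < Lambda.
Hypothesis lip : forall S T : 'M[R]_d,
  frobenius (nonlin mu T - nonlin mu S) <= Lambda * frobenius (T - S).
Local Notation N T := (@nonlin R d mu \o T).

Context (T Th : E -> 'M[R]_d) (u uh : E -> 'rV[R]_d) (p ph : E -> R).
Hypothesis hT : L2mx Omega T.
Hypothesis hTh : L2mx Omega Th.
Hypothesis hu : spV Omega u.
Hypothesis huh : Vh uh.
Hypothesis hp : L2 Omega p.
Hypothesis hph : Qh ph.
Hypothesis uc : normV Omega u <= c.
Hypothesis uhc : normV Omega uh <= c.
Hypothesis momentum : forall v, Vh v ->
  trilin Omega u u v - trilin Omega uh uh v
  + intdot Omega (T \- Th) (symgrad Omega v)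
  + (b2 Omega v p - b2 Omega v ph) = 0.

Let huhV : spV Omega uh. Proof. exact: (Vh_V fV huh). Qed.
Let hphL : L2 Omega ph. Proof. exact: (Qh_Q fQ hph).1. Qed.
Let c0 : 0 <= c. Proof. exact: le_trans (normV_ge0 _ _) uc. Qed.

(** The pressure p_h disappears because w is discretely divergence-free, and the
term d(u_h; w, w) because the form is skew-symmetric. *)
Lemma velocity_error z qh : spVh0 Omega Vh Qh z -> Qh qh ->
  let w := uh \- z in
  alpha * intdot Omega (T \- Th) (symgrad Omega w)
    + gamma * intdot Omega (N T \- N Th) (symgrad Omega w)
    = intdot Omega (symgrad Omega (u \- uh)) (symgrad Omega w) ->
  Vh w -> (forall q, Qh q -> b2 Omega w q = 0) ->
  normV Omega w <= normV Omega (u \- z) + gamma * Lambda * normL2mx Omega (T \- Th)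
    + alpha * D * c * (normV Omega (u \- z) + normV Omega (u \- z) + normV Omega w)
    + alpha * d%:R * normL2 Omega (p \- qh).
Proof.
move=> [hz zdiv] hqh w ew hw wdiv.
have hzV := Vh_V fV hz; have hwV := Vh_V fV hw.
have hqL := (Qh_Q fQ hqh).1.
have huz := spV_sub oO bO hu hzV; have huuh := spV_sub oO bO hu huhV.
have NT := L2mx_nonlin visc mO hT; have NTh := L2mx_nonlin visc mO hTh.
have Dw := L2mx_symgrad oO hwV; have Duz := L2mx_symgrad oO huz.
have mom := momentum hw.
rewrite (etrans (wdiv _ hph) (esym (wdiv _ hqh))) in mom.
rewrite -(b2_subr oO hwV hp hqL) in mom.
have e3 : intdot Omega (symgrad Omega (u \- uh)) (symgrad Omega w) =
    intdot Omega (symgrad Omega (u \- z)) (symgrad Omega w) - normV Omega w ^+ 2.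
  apply: (sub_via_common (etrans (intdotC _ _ _) (intdot_symgrad_sub oO bO hu huhV Dw))
    (etrans (intdotC _ _ _) (intdot_symgrad_sub oO bO hu hzV Dw))).
  exact: etrans (sqr_normL2mx _ _) (intdot_symgrad_sub oO bO huhV hzV Dw).
have ble := b2_le oO hwV (L2B mO hp hqL).
have s2 : - intdot Omega (N T \- N Th) (symgrad Omega w) <=
    Lambda * normL2mx Omega (T \- Th) * normV Omega w.
  apply: (@le_trans _ _ (normL2mx Omega (N T \- N Th) * normV Omega w)).
    apply: le_trans (intdot_cs mO (L2mxB mO NT NTh) Dw).
    by rewrite -normrN; exact: ler_norm.
  apply: ler_wpM2r; first exact: normV_ge0.
  exact: (nonlin_sub_lip oO visc lambda0 lip hTh hT).
have x1 : trilin Omega (u \- uh) u w <= D * normV Omega (u \- uh) * c * normV Omega w.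
  apply: (le_trans (trilin_le_max huuh hu hwV)).
  apply: ler_wpM2r; first exact: normV_ge0.
  apply: (ler_wpM2l _ uc); apply: (mulr_ge0 D0); exact: normV_ge0.
have x2 : trilin Omega uh (u \- z) w <= D * c * normV Omega (u \- z) * normV Omega w.
  apply: (le_trans (trilin_le_max huhV huz hwV)).
  do 2 (apply: ler_wpM2r; first exact: normV_ge0).
  exact: (ler_wpM2l D0 uhc).
have trE : trilin Omega u u w - trilin Omega uh uh w =
    trilin Omega (u \- uh) u w + trilin Omega uh (u \- z) w.
  rewrite -(trilin_diff hu hzV huhV hwV); congr (_ - _).
  by apply/eqP; rewrite -subr_eq0 -(trilinB2 oO bO hd huhV huhV hzV hwV) trilin0.
have tri : normV Omega (u \- uh) <= normV Omega (u \- z) + normV Omega w.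
  have := normV_triangle oO bO hu hzV huhV.
  by rewrite (normV_subC oO bO hzV huhV).
exact: (velocity_energy_absorption alpha0 (ltW gamma0) (normV_ge0 _ _) (normV_ge0 _ _)
  (mulr_ge0 D0 c0) (ler0n R d) (normL2_ge0 _ _) (ltW lambda0) (normL2mx_ge0 _ _)
  mom ew e3 ble (intdot_le mO Duz Dw) s2 trE (lerD x1 x2) tri).
Qed.

(** The momentum equations express b_2(v_h, q_h - p_h) by the errors already
estimated, and the inf-sup condition turns this into a norm. *)
Lemma pressure_error qh : Qh qh ->
  beta * (normL2 Omega (p \- ph) - normL2 Omega (p \- qh)) <=
  d%:R * normL2 Omega (p \- qh) + 2 * (D * c) * normV Omega (u \- uh)
    + normL2mx Omega (T \- Th).
Proof.
move=> hqh; have hqL := (Qh_Q fQ hqh).1.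
have huuh := spV_sub oO bO hu huhV.
have hdiff : Qh (qh \- ph).
  have := @findim_lin R d Omega R^o _ _ (spQ_lin_closed oO bO) fQ _ _ (-1) hqh hph.
  by congr Qh; apply/funext => x; rewrite /= scaleN1r.
have tri : normL2 Omega (p \- ph) - normL2 Omega (p \- qh) <= normL2 Omega (qh \- ph).
  rewrite lerBlDl; have := normL2D mO (L2B mO hp hqL) (L2B mO hqL hphL).
  congr (normL2 _ _ <= _); apply/funext => x; by rewrite /= addrA subrK.
apply: (le_trans (ler_wpM2l (ltW beta0) tri)).
apply: (infsup_le oO fQ betaP hdiff).
  apply: addr_ge0 (normL2mx_ge0 _ _); apply: addr_ge0.
    exact: (mulr_ge0 (ler0n R d) (normL2_ge0 _ _)).
  apply: (mulr_ge0 _ (normV_ge0 _ _)); apply: (mulr_ge0 (ler0n R 2)).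
  exact: (mulr_ge0 D0 c0).
move=> v hv; have hvV := Vh_V fV hv; have Dv := L2mx_symgrad oO hvV.
have mom := momentum hv; rewrite (trilin_diff hu huhV huhV hvV) in mom.
have x1 : - trilin Omega (u \- uh) u v <= D * c * normV Omega (u \- uh) * normV Omega v.
  apply: (le_trans (trilinN_le_max huuh hu hvV)).
  apply: ler_wpM2r; first exact: normV_ge0.
  rewrite [leRHS]mulrAC; apply: (ler_wpM2l _ uc).
  apply: (mulr_ge0 D0); exact: normV_ge0.
have x2 : - trilin Omega uh (u \- uh) v <= D * c * normV Omega (u \- uh) * normV Omega v.
  apply: (le_trans (trilinN_le_max huhV huuh hvV)).
  do 2 (apply: ler_wpM2r; first exact: normV_ge0).
  exact: (ler_wpM2l D0 uhc).
have x3 : - intdot Omega (T \- Th) (symgrad Omega v) <=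
    normL2mx Omega (T \- Th) * normV Omega v.
  apply: le_trans (intdot_cs mO (L2mxB mO hT hTh) Dv).
  by rewrite -normrN; exact: ler_norm.
have x4 : - b2 Omega v (p \- qh) <= d%:R * normV Omega v * normL2 Omega (p \- qh).
  apply: le_trans (b2_bound oO hvV (L2B mO hp hqL)).
  by rewrite -normrN; exact: ler_norm.
rewrite (b2_subr oO hvV hqL hphL); rewrite (b2_subr oO hvV hp hqL) in x4.
exact: (pressure_residual_bound mom x1 x2 x3 x4).
Qed.

End error.

(** * Quasi-optimality *)

Lemma le_inf_sum (R : realType) (A B C : set R) (e k : R) : 0 < k ->
  A !=set0 -> B !=set0 -> C !=set0 ->
  (forall a b c, A a -> B b -> C c -> e <= k * (a + b + c)) ->
  e <= k * (inf A + inf B + inf C).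
Proof.
move=> k0 A0 B0 C0 h; rewrite -ler_pdivrMl//.
have h1 a b c : A a -> B b -> C c -> k^-1 * e <= a + b + c.
  by move=> ha hb hc; rewrite ler_pdivrMl//; exact: h.
have h2 a b : A a -> B b -> k^-1 * e - a - b <= inf C.
  move=> ha hb; apply: lb_le_inf => // c hc; have := h1 _ _ _ ha hb hc; lra.
have h3 a : A a -> k^-1 * e - a - inf C <= inf B.
  move=> ha; apply: lb_le_inf => // b hb; have := h2 _ _ ha hb; lra.
have h4 : k^-1 * e - inf B - inf C <= inf A.
  apply: lb_le_inf => // a ha; have := h3 _ ha; lra.
lra.
Qed.

Lemma residual_sub (R : realType) (a b c a1 b1 c1 f : R) :
  a + b + c = f -> a1 + b1 + c1 = f -> a - a1 + (b - b1) + (c - c1) = 0.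
Proof. by move=> <- h; apply/eqP; rewrite -(subrr (a + b + c)) -{2}h; apply/eqP; ring. Qed.

Local Opaque intdot normL2mx nonlin mu_max normHm1 normV symgrad trilin b2 Cu.

Theorem theorem3 (R : realType) (d : nat) (Omega : set 'rV[R]_d)
    (f : 'rV[R]_d -> 'rV[R]_d) (alpha gamma : R) (mu : R -> R) (C1 : R)
    (Mh : R -> set ('rV[R]_d -> 'M[R]_d))
    (Vh : R -> set ('rV[R]_d -> 'rV[R]_d))
    (Qh : R -> set ('rV[R]_d -> R)) (beta Dhat Lambda theta : R) :
  d = 2%N \/ d = 3%N ->
  lipschitz_domain Omega ->
  L2mx Omega f ->
  0 < alpha -> 0 < gamma -> 0 < C1 ->
  viscosity mu C1 ->
  discrete_spaces Omega Mh Vh Qh beta ->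
  (forall u v w, spV Omega u -> spV Omega v -> spV Omega w ->
    trilin Omega u v w <= Dhat * normV Omega u * normV Omega v * normV Omega w) ->
  0 < Lambda ->
  @traceless_lipschitz R d mu Lambda ->
  0 < theta -> theta < 1 ->
  gamma / alpha * Lambda
    + alpha * Dhat * Cu Omega f alpha gamma mu C1 Lambda <= theta ->
  exists C : R, 0 < C /\
    forall (T : 'rV[R]_d -> 'M[R]_d) (u : 'rV[R]_d -> 'rV[R]_d)
      (p : 'rV[R]_d -> R),
    solution_P Omega f alpha gamma mu T u p ->
    forall h : R, 0 < h ->
    forall (Th : 'rV[R]_d -> 'M[R]_d) (uh : 'rV[R]_d -> 'rV[R]_d)
      (ph : 'rV[R]_d -> R),
    solution_Ph Omega f alpha gamma mu (Mh h) (Vh h) (Qh h) Th uh ph ->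
    normV Omega (u \- uh) + normL2mx Omega (T \- Th) + normL2 Omega (p \- ph)
      <= C * (distV Omega (Vh h) u + distM Omega (Mh h) T + distQ Omega (Qh h) p).
Proof.
move=> hd [_ oO bd _ _] hf a0 g0 C10 visc [fin _ [b0 bP] incl] hDhat l0 lip0 _ th1 small.
have [M bO] : exists M, forall x, Omega x -> `|x| <= M.
  by case: bd => M [_ hM]; exists (M + 1) => x Ox; apply: (hM (M + 1)); rewrite ?ltrDl.
have mO : measurable Omega := open_rV_measurable oO.
have lip := lipschitz_all (Lambda := Lambda) (mu := mu) (_ : (2 <= d)%N) lip0.
have {}lip : forall S T : 'M[R]_d,
    frobenius (nonlin mu T - nonlin mu S) <= Lambda * frobenius (T - S).
  by apply: lip; case: hd => ->.
have c0 := Cu_ge0 oO bO Lambda a0 g0 visc hf.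
set c := Cu Omega f alpha gamma mu C1 Lambda in c0 small.
(* Dhat may be negative if all velocities vanish *)
pose D := Num.max Dhat 0.
have D0 : 0 <= D by rewrite le_max lexx orbT.
have [C [C0 hC]] := error_absorption a0 b0 g0 l0 th1 D0 c0 (ler0n R d).
exists C; split => // T u p [[hTM hu hpQ] mom cons divu] h h0 Th uh ph.
move=> [[hTh huh hph] momh consh divuh].
have [fM fV fQ] := fin h h0.
have hT := hTM.1; have hp := hpQ.1.
have hThM := findim_sub fM hTh; have hThL := hThM.1.
have huhV := Vh_V fV huh; have hphL := (Qh_Q fQ hph).1.
have divQh q : Qh h q -> b2 Omega u q = 0 by move=> /(Qh_Q fQ); exact: divu.
have convE v : spV Omega v ->
    intdot Omega (convect Omega u u) v = trilin Omega u u v.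
  exact: (convect_trilin oO bO hd hu (div_free oO bO hu divu)).
have uc : normV Omega u <= c.
  apply: (velocity_le_Cu oO bO a0 g0 visc l0 lip hf hT hu).
    by move=> S [->|->]; apply: cons => //; exact: (spM_symgrad oO hu).
  by rewrite -(mom _ hu) (convE _ hu) trilin0 add0r (divu _ hpQ) addr0.
have uhc : normV Omega uh <= c.
  apply: (velocity_le_Cu oO bO a0 g0 visc l0 lip hf hThL huhV).
    by move=> S [->|->]; apply: consh => //; exact: incl.
  by rewrite -(momh _ huh) trilin0 add0r (divuh _ hph) addr0.
have momentum v : Vh h v -> trilin Omega u u v - trilin Omega uh uh v
    + intdot Omega (T \- Th) (symgrad Omega v) + (b2 Omega v p - b2 Omega v ph) = 0.
  move=> hv; have hvV := Vh_V fV hv.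
  have e1 := mom _ hvV; have e2 := momh _ hv; rewrite (convE _ hvV) in e1.
  rewrite (intdotBl mO hT hThL (L2mx_symgrad oO hvV)).
  exact: (residual_sub e1 e2).
have V0 := findim0 (spV_lin_closed oO bO) (spV0 oO bO) fV.
have M0 := findim0 (spM_lin_closed oO) (spM0 oO) fM.
have Q0 := @findim0 R d Omega R^o _ _ (spQ_lin_closed oO bO) (spQ0 oO) fQ.
apply: (le_inf_sum C0).
- by exists (normV Omega (u \- (fun=> 0))), (fun=> 0).
- by exists (normL2mx Omega (T \- (fun=> 0))), (fun=> 0).
- by exists (normL2 Omega (p \- (fun=> 0))), (fun=> 0).
move=> _ _ _ [vh hvh <-] [Sh hSh <-] [qh hqh <-].
have [z [hz0 hz]] := velocity_split oO bO fV fQ b0 (bP h h0) hu divQh hvh.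
have [hzh divz] := hz0; have hzV := Vh_V fV hzh.
have hw : Vh h (uh \- z).
  by rewrite sub_lin; exact: (findim_lin (spV_lin_closed oO bO) fV (-1) huh hzh).
have divw q : Qh h q -> b2 Omega (uh \- z) q = 0.
  move=> hq; rewrite (b2_subl oO bO huhV hzV (Qh_Q fQ hq).1).
  by rewrite (divuh _ hq) (divz _ hq) subrr.
have hwV := Vh_V fV hw.
have Mw := incl _ h0 _ (conj hw divw).
have NT := L2mx_nonlin visc mO hT; have NTh := L2mx_nonlin visc mO hThL.
have Dw := L2mx_symgrad oO hwV.
have ew : alpha * intdot Omega (T \- Th) (symgrad Omega (uh \- z))
    + gamma * intdot Omega ((@nonlin R d mu \o T) \- (@nonlin R d mu \o Th))
        (symgrad Omega (uh \- z))
    = intdot Omega (symgrad Omega (u \- uh)) (symgrad Omega (uh \- z)).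
  rewrite [RHS]intdotC (intdot_symgrad_sub oO bO hu huhV Dw).
  rewrite (intdotBl mO hT hThL Dw) (intdotBl mO NT NTh Dw).
  rewrite (intdotC Omega _ (symgrad Omega u)) (intdotC Omega _ (symgrad Omega uh)).
  rewrite -(cons _ (findim_sub fM Mw)) -(consh _ Mw).
  by rewrite !mulrBr opprD addrACA.
have huuh := spV_sub oO bO hu huhV; have huz := spV_sub oO bO hu hzV.
apply: (hC _ (normV Omega (uh \- z)) _ _ (normV Omega (u \- z))).
- exact: normV_ge0.
- exact: normV_ge0.
- exact: normL2mx_ge0.
- exact: normL2_ge0.
- exact: normV_ge0.
- exact: normV_ge0.
- exact: normL2mx_ge0.
- exact: normL2_ge0.
- exact: hz.
- rewrite (normV_subC oO bO huhV hzV); exact: (normV_triangle oO bO hu hzV huhV).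
- exact: (velocity_error oO bO hd hDhat fV fQ a0 g0 visc l0 lip hT hThL hu huh hp hph
    uc uhc momentum hz0 hqh ew hw divw).
- have [->|wn0] := eqVneq (normV Omega (uh \- z)) 0; first by rewrite !mulr0.
  have wgt0 : 0 < normV Omega (uh \- z) by rewrite lt_neqAle eq_sym wn0 normV_ge0.
  apply: (ler_wpM2r (normV_ge0 _ _)).
  by rewrite /D (trilin_const_ge0 hDhat hwV wgt0).
- apply: (stress_error oO bO a0 g0 visc l0 lip hT hThL (findim_sub fM hSh).1 hu huhV).
    by move=> S [->|->]; apply: cons; [exact: hThM|exact: (findim_sub fM hSh)].
  by move=> S [->|->]; apply: consh.
- exact: (pressure_error oO bO hd hDhat fV fQ b0 (bP h h0) hT hThL hu huh hp hph
    uc uhc momentum hqh).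
Qed.
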